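(* Let $\alpha,\alpha',\beta,\beta',\gamma,\rho,\lambda,\nu\in\mathbb{C}$ with $\nu\notin\{-1,-2,-3,\dots\}$, and let $x>0$. Suppose that $\operatorname{Re}(\gamma)>0$ and that, for every integer $n\ge 0$, $$\operatorname{Re}(\rho+n)>\max\{0,\ \operatorname{Re}(\alpha+\alpha'+\beta-\gamma),\ \operatorname{Re}(\alpha'-\beta')\}.$$ Then $$\left(I_{0,+}^{\alpha,\alpha',\beta,\beta',\gamma}\,t^{\rho-1}S_\nu(\lambda t)\right)(x)=x^{\rho+\gamma-\alpha-\alpha'-1}\,\frac{\Gamma(\nu+1)}{\sqrt{\pi}}\;{}_4\Psi_4\left[\begin{array}{c}\left(\tfrac12,\tfrac12\right),(\rho,1),(\rho+\gamma-\alpha-\alpha'-\beta,1),(\rho+\beta'-\alpha',1)\\ \left(\nu+1,\tfrac12\right),(\rho+\beta',1),(\rho+\gamma-\alpha-\alpha',1),(\rho+\gamma-\alpha'-\beta,1)\end{array}\Big|\,\lambda x\right].$$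
   Context: Appell function $F_3$: for $c\notin\{0,-1,-2,\dots\}$ and $|u|<1,|v|<1$, $$F_3(a,a',b,b';c;u,v)=\sum_{m,n\ge0}\frac{(a)_m(a')_n(b)_m(b')_n}{(c)_{m+n}\,m!\,n!}u^mv^n,$$ where $(a)_m=a(a+1)\cdots(a+m-1)$, extended by analytic continuation to $u,v\in\mathbb{C}\setminus[1,\infty)$. Left-sided Marichev–Saigo–Maeda operator: for $\operatorname{Re}(\gamma)>0$ and $x>0$, $$\left(I_{0,+}^{\alpha,\alpha',\beta,\beta',\gamma}f\right)(x)=\frac{x^{-\alpha}}{\Gamma(\gamma)}\int_0^x(x-t)^{\gamma-1}t^{-\alpha'}F_3\left(\alpha,\alpha',\beta,\beta';\gamma;1-\frac tx,1-\frac xt\right)f(t)\,dt.$$ Bessel–Struve kernel: for $\nu\in\mathbb{C}\setminus\{-1,-2,\dots\}$ and $z\in\mathbb{C}$, $$S_\nu(z)=\sum_{n=0}^\infty\frac{\Gamma(\nu+1)\,\Gamma\left(\frac{n+1}{2}\right)}{\sqrt\pi\,n!\,\Gamma\left(\frac n2+\nu+1\right)}z^n,$$ with $1/\Gamma$ understood as $0$ at the poles of $\Gamma$. Generalized Wright function: $${}_p\Psi_q\left[\begin{array}{c}(a_1,A_1),\dots,(a_p,A_p)\\(b_1,B_1),\dots,(b_q,B_q)\end{array}\Big|\,z\right]=\sum_{k=0}^\infty\frac{\prod_{i=1}^p\Gamma(a_i+A_ik)}{\prod_{j=1}^q\Gamma(b_j+B_jk)}\frac{z^k}{k!},$$ with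 $1/\Gamma$ understood as $0$ at the poles of $\Gamma$. Complex powers of positive reals use the real logarithm. *)

(* Defs.v *)
From Stdlib Require Export Reals Factorial List.
From Coquelicot Require Export Coquelicot.
Export ListNotations.

Open Scope R_scope.
Open Scope C_scope.

(** Limits and sums are total operators built with Coquelicot's [iota]; they
    are meaningful when the corresponding limit exists. *)

Definition Clim_seq (u : nat -> C) : C :=
  iota (T := C_CompleteNormedModule)
    (fun l => filterlim u eventually (locally l)).

Definition CSeries (a : nat -> C) : C :=
  iota (T := C_CompleteNormedModule)
    (fun l => is_series (V := C_NormedModule) a l).

(** Sum of an absolutely convergent double series: the partial sums of the
    moduli over squares are bounded, which makes the order of summation
    irrelevant, and those of the series tend to [l]. *)
Definition is_series2 (a : nat -> nat -> C) (l : C) : Prop :=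
  (exists M : R, forall N : nat,
     (sum_n (fun m => sum_n (fun n => Cmod (a m n)) N) N <= M)%R) /\
  filterlim (fun N : nat => sum_n (fun m => sum_n (a m) N) N)
    eventually (locally l).

(** [t ^ z] for [t > 0], with the real logarithm. *)
Definition Rcpow (t : R) (z : C) : C :=
  RtoC (exp (Re z * ln t)) *
  (cos (Im z * ln t), sin (Im z * ln t)).

Fixpoint pochhammer (a : C) (n : nat) : C :=
  match n with
  | O => 1
  | S m => pochhammer a m * (a + INR m)
  end.

(** Gauss' product:
    [1 / Gamma z = lim z (z+1) ... (z+n) / (n! n^z)] for every complex [z].
    It is entire and vanishes exactly at [0, -1, -2, ...], so that it is
    [1 / Gamma] with the value [0] at the poles of [Gamma]. *)
Definition rGamma (z : C) : C :=
  Clim_seq (fun n => pochhammer z (S n) / (INR (fact n) * Rcpow (INR n) z)).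

(** Only meaningful outside [0, -1, -2, ...]. *)
Definition Gamma (z : C) : C := / rGamma z.

Definition appellF3_term (a a' b b' c u v : C) (m n : nat) : C :=
  pochhammer a m * pochhammer a' n * pochhammer b m * pochhammer b' n
  / (pochhammer c (m + n) * INR (fact m) * INR (fact n)) * u ^ m * v ^ n.

(** [G] is the sum of a convergent double power series on a polydisc
    centred at [(u0, v0)]. *)
Definition analytic2_at (G : C -> C -> C) (u0 v0 : C) : Prop :=
  exists (r : R) (k : nat -> nat -> C), (0 < r)%R /\
    forall h1 h2 : C, (Cmod h1 < r)%R -> (Cmod h2 < r)%R ->
      is_series2 (fun m n => k m n * h1 ^ m * h2 ^ n) (G (u0 + h1) (v0 + h2)).

(** [w] is the value at [(u, v)] of the analytic continuation of the double
    series, from the bidisc [|u| < 1, |v| < 1], along the segment from [(0, 0)]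
    to [(u, v)].  The product of two copies of [C \ [1, +oo)] is star-shaped
    about [(0, 0)], so on it this is the single-valued analytic continuation of
    the series.  It covers points with [(1 - u) (1 - v) = 1], where other
    branches of [F3] are singular but this one is not. *)
Definition is_appellF3 (a a' b b' c u v w : C) : Prop :=
  exists G : C -> C -> C,
    (forall u1 v1 : C, (Cmod u1 < 1)%R -> (Cmod v1 < 1)%R ->
       is_series2 (appellF3_term a a' b b' c u1 v1) (G u1 v1)) /\
    (forall s : R, (0 <= s <= 1)%R -> analytic2_at G (s * u) (s * v)) /\
    G u v = w.

Definition appellF3 (a a' b b' c u v : C) : C :=
  iota (T := C_CompleteNormedModule) (is_appellF3 a a' b b' c u v).

Definition MSM_integrand (al al' be be' ga : C) (f : R -> C) (x t : R) : C :=
  Rcpow (x - t) (ga - 1) * Rcpow t (- al') *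
  appellF3 al al' be be' ga (1 - t / x) (1 - x / t) * f t.

(** The integral over [(0, x)] is improper at both ends. *)
Definition ex_MSM (al al' be be' ga : C) (f : R -> C) (x : R) : Prop :=
  ex_RInt_gen (V := C_R_NormedModule)
    (MSM_integrand al al' be be' ga f x) (at_right 0) (at_left x).

Definition MSM (al al' be be' ga : C) (f : R -> C) (x : R) : C :=
  Rcpow x (- al) / Gamma ga *
  RInt_gen (V := C_R_CompleteNormedModule)
    (MSM_integrand al al' be be' ga f x) (at_right 0) (at_left x).

Definition BesselStruve (nu z : C) : C :=
  CSeries (fun n =>
    Gamma (nu + 1) * Gamma ((INR n + 1) / 2)
    / (sqrt PI * INR (fact n)) * rGamma (INR n / 2 + nu + 1) * z ^ n).

Definition Cprod (l : list C) : C := fold_right Cmult 1 l.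

Definition Wright_term (num den : list (C * R)) (z : C) (k : nat) : C :=
  Cprod (map (fun p : C * R => Gamma (fst p + snd p * INR k)) num) *
  Cprod (map (fun p : C * R => rGamma (fst p + snd p * INR k)) den) *
  (z ^ k / INR (fact k)).

Definition ex_Wright (num den : list (C * R)) (z : C) : Prop :=
  ex_series (V := C_NormedModule) (Wright_term num den z).

(** Generalized Wright function: [num] lists the [(a_i, A_i)] and [den] the
    [(b_j, B_j)]. *)
Definition Wright (num den : list (C * R)) (z : C) : C :=
  CSeries (Wright_term num den z).

(* Main.v *)
Require Import Defs.
From Stdlib Require Import Lra Lia.

(** Put [y = 1 - t / x].  On the path of integration [(1 - u) (1 - v) = 1], and
    Pfaff's transformation in [v] gives
    [t^(-a') F3(a, a', b, b'; c; 1 - t / x, 1 - x / t) = x^(-a') H(y)], with a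
    power series [H] in [y].  That this is the continuation along the segment
    from [(0, 0)] follows from the identity theorem on segments: near the origin
    the two series agree by rearrangement.

    It remains to show that
    [int_0^1 t^(rho - 1) (1 - t)^(c - 1) H(1 - t) dt] is [Gamma c] times a
    quotient of Gamma functions, and to integrate the Bessel-Struve series
    termwise.  When [a], [a'], [b], [c - b'] have positive real parts, integrate
    [H] termwise and sum the resulting double series by applying Gauss' theorem
    twice; for real parameters all its terms are positive, which gives absolute
    convergence in the complex case.  In general this double series does not
    converge absolutely.  But [t^(rho - 1) (1 - t)^(c - 1) H(1 - t)] is, up to a
    constant, a combination of the corresponding function with
    [(a', b', c)], [(b, c)] or [(a, c)] raised by [1] and of the derivative of
    [t^rho (1 - t)^c H+(1 - t)], where [H+] belongs to the raised parameters, so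
    the formula descends to all parameters. *)

(** On the path [1 - x / t] runs to minus infinity, so the double series of [F3] covers only part of
    it. After Pfaff's transformation the second variable [v / (v - 1)] equals the first one, [y],
    and stays in the unit disc. The prefactor [(1 - v)^(-a')] is multiplied into the coefficients:
    the candidate continuation is then a plain double power series in [u] and [v / (v - 1)], and one
    composition lemma shows that it is analytic.

    The boundary terms of the raising step vanish only if the raised series grows more slowly than
    [(1 - y)^(-Re rho)]. A growth bound therefore descends together with the value of the integral.
    All conditions on [rho] are expressed through [c - a - a' - b] and [b' - a'], which raising
    leaves unchanged; this is why the parameters are raised in these combinations.

    Gauss' product also serves for estimates: it yields the Beta integral and, since
    [|n^a| = n^(Re a)], the bound of [|(a)_n|] by a constant times [(Re a)_n], which reduces
    absolute convergence to positive real parameters. *)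

(* [ring] and [field] read the carrier off the first term, which must not be a
   Coquelicot sum typed in [AbelianMonoid.sort C_AbelianMonoid]. *)
Lemma Cplus_0_inj (x y : C) : 0 + x = 0 + y -> x = y.
Proof. rewrite !Cplus_0_l. auto. Qed.
Ltac cring := apply Cplus_0_inj; ring.
Ltac cfield := apply Cplus_0_inj; field.
Lemma Rplus_0_inj (x y : R) : (0 + x = 0 + y -> x = y)%R.
Proof. rewrite !Rplus_0_l. auto. Qed.
Ltac rring := apply Rplus_0_inj; ring.

(** * Limits of complex functions along a filter *)

Notation is_Cseries := (is_series (V := C_NormedModule)).

(** Balls of [C] are balls of a product, which costs a factor [sqrt 2] against [Cmod]. This form
    pays it once. The filter stays arbitrary because limits are taken along sequences, at one-sided
    ends and along pairs of endpoints. *)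
Definition Flim {T : Type} (F : (T -> Prop) -> Prop) (f : T -> C) (l : C) : Prop :=
  forall eps : R, (0 < eps)%R -> F (fun x => (Cmod (f x - l) < eps)%R).

Lemma Flim_iff {T : Type} (F : (T -> Prop) -> Prop) {FF : Filter F} (f : T -> C) (l : C) :
  filterlim f F (locally l) <-> Flim F f l.
Proof.
  split.
  - intros H eps He.
    assert (He2 : (0 < eps / sqrt 2)%R).
    { apply Rdiv_lt_0_compat; auto. apply sqrt_lt_R0; lra. }
    specialize (H (fun z => Cmod (z - l) < eps)%R). unfold filtermap in H.
    apply H. exists (mkposreal _ He2). intros y Hy.
    pose proof (C_NormedModule_mixin_compat2 l y (mkposreal _ He2) Hy) as H2.
    simpl in H2. replace (sqrt 2 * (eps / sqrt 2))%R with eps in H2. exact H2.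
    field. apply Rgt_not_eq, sqrt_lt_R0; lra.
  - intros H P [eps HP].
    unfold filtermap. generalize (H eps (cond_pos eps)). apply filter_imp.
    intros x Hx. apply HP. apply C_NormedModule_mixin_compat1. exact Hx.
Qed.

Lemma is_series_C_iff (a : nat -> C) (l : C) :
  is_Cseries a l <-> Flim eventually (sum_n a) l.
Proof. apply (Flim_iff eventually (sum_n a) l). Qed.

Lemma is_series_C_unique (a : nat -> C) (l1 l2 : C) :
  is_Cseries a l1 -> is_Cseries a l2 -> l1 = l2.
Proof.
  intros H1 H2.
  exact (filterlim_locally_unique (V := C_NormedModule) (F := eventually) (sum_n a) l1 l2 H1 H2).
Qed.

Lemma CSeries_unique (a : nat -> C) (l : C) :
  is_Cseries a l -> CSeries a = l.
Proof.
  intros H. apply (iota_unique (K := C_AbsRing) (V := C_CompleteNormedModule)); auto.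
  intros y Hy. eapply is_series_C_unique; eauto.
Qed.

Lemma is_series2_unique (a : nat -> nat -> C) (l1 l2 : C) :
  is_series2 a l1 -> is_series2 a l2 -> l1 = l2.
Proof.
  intros [_ H1] [_ H2].
  exact (filterlim_locally_unique (V := C_NormedModule) (F := eventually) _ l1 l2 H1 H2).
Qed.

Lemma Flim_const {T : Type} (F : (T -> Prop) -> Prop) {FF : Filter F} (l : C) :
  Flim F (fun _ => l) l.
Proof.
  intros eps He. apply filter_forall. intros _.
  replace (l - l) with (RtoC 0) by ring. rewrite Cmod_0. exact He.
Qed.

Lemma Flim_ext_ev {T : Type} (F : (T -> Prop) -> Prop) {FF : Filter F} (f g : T -> C) l :
  F (fun x => f x = g x) -> Flim F f l -> Flim F g l.
Proof.
  intros H1 H2 eps He. specialize (H2 eps He).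
  generalize (filter_and _ _ H1 H2). apply filter_imp. intros x [<- H]; exact H.
Qed.

Lemma Flim_plus {T : Type} (F : (T -> Prop) -> Prop) {FF : Filter F} (f g : T -> C) lf lg :
  Flim F f lf -> Flim F g lg -> Flim F (fun x => f x + g x) (lf + lg).
Proof.
  intros Hf Hg eps He.
  assert (He2 : (0 < eps / 2)%R) by lra.
  generalize (filter_and _ _ (Hf _ He2) (Hg _ He2)).
  apply filter_imp. intros x [H1 H2].
  replace (f x + g x - (lf + lg)) with ((f x - lf) + (g x - lg)) by ring.
  eapply Rle_lt_trans. apply Cmod_triangle. lra.
Qed.

Lemma Flim_mult {T : Type} (F : (T -> Prop) -> Prop) {FF : Filter F} (f g : T -> C) lf lg :
  Flim F f lf -> Flim F g lg -> Flim F (fun x => f x * g x) (lf * lg).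
Proof.
  intros Hf Hg eps He.
  set (M := (Cmod lf + Cmod lg + 1)%R).
  assert (HM : (0 < M)%R) by (unfold M; pose proof (Cmod_ge_0 lf); pose proof (Cmod_ge_0 lg); lra).
  (* With both errors below [d <= 1], the error of the product is at most
     [d * d + d * |lg| + |lf| * d <= d * M]. *)
  set (d := Rmin 1 (eps / (2 * M))).
  assert (Hd : (0 < d)%R).
  { apply Rmin_pos. lra. apply Rdiv_lt_0_compat; lra. }
  generalize (filter_and _ _ (Hf d Hd) (Hg d Hd)).
  apply filter_imp. intros x [H1 H2].
  replace (f x * g x - lf * lg) with ((f x - lf) * (g x - lg) + ((f x - lf) * lg + lf * (g x - lg))) by ring.
  assert (d <= 1)%R by apply Rmin_l.
  assert (Hd2 : (d <= eps / (2 * M))%R) by apply Rmin_r.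
  assert (Hd3 : (d * M <= eps / 2)%R).
  { apply Rmult_le_compat_r with (r := M) in Hd2; [|lra].
    replace (eps / (2 * M) * M)%R with (eps / 2)%R in Hd2 by (field; lra). exact Hd2. }
  eapply Rle_lt_trans. apply Cmod_triangle.
  eapply Rle_lt_trans. apply Rplus_le_compat_l. apply Cmod_triangle.
  rewrite !Cmod_mult.
  pose proof (Cmod_ge_0 (f x - lf)). pose proof (Cmod_ge_0 (g x - lg)).
  pose proof (Cmod_ge_0 lf). pose proof (Cmod_ge_0 lg).
  apply Rle_lt_trans with (d * M)%R; [|lra].
  unfold M. nra.
Qed.

Lemma Flim_unique (f : nat -> C) l1 l2 :
  Flim eventually f l1 -> Flim eventually f l2 -> l1 = l2.
Proof.
  intros H1 H2. apply Flim_iff in H1; [|apply eventually_filter].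
  apply Flim_iff in H2; [|apply eventually_filter].
  exact (filterlim_locally_unique (V := C_NormedModule) (F := eventually) f l1 l2 H1 H2).
Qed.

Lemma Flim_Cmod_le {T : Type} (F : (T -> Prop) -> Prop) {FF : ProperFilter F} (f : T -> C) l M :
  Flim F f l -> F (fun x => Cmod (f x) <= M)%R -> (Cmod l <= M)%R.
Proof.
  intros H HM. apply Rle_trans with (M + 0)%R; [|lra]. apply Rle_plus_epsilon. intros eps He.
  destruct (filter_ex _ (filter_and _ _ (H eps He) HM)) as [x [Hx1 Hx2]].
  rewrite Rplus_0_r.
  replace l with (f x - (f x - l)) by ring.
  eapply Rle_trans. apply Cmod_triangle. rewrite Cmod_opp. lra.
Qed.

Lemma Flim_inv {T : Type} (F : (T -> Prop) -> Prop) {FF : Filter F} (f : T -> C) (l : C) :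
  l <> 0 -> Flim F f l -> Flim F (fun x => / f x) (/ l).
Proof.
  intros Hl H eps He.
  assert (Hm : (0 < Cmod l)%R) by (exact (proj1 (Cmod_gt_0 l) Hl)).
  (* The first bound keeps [|f x|] above [|l| / 2]; the second one makes [d / (|l| / 2 * |l|)] at
     most [eps]. *)
  set (d := Rmin (Cmod l / 2) (eps * (Cmod l * Cmod l) / 2)).
  assert (Hd : (0 < d)%R).
  { apply Rmin_pos. lra. apply Rdiv_lt_0_compat; [|lra]. apply Rmult_lt_0_compat; auto. nra. }
  generalize (H d Hd). apply filter_imp. intros x Hx.
  assert (H1 : (d <= Cmod l / 2)%R) by apply Rmin_l.
  assert (H2 : (d <= eps * (Cmod l * Cmod l) / 2)%R) by apply Rmin_r.
  assert (H3 : (Cmod l / 2 <= Cmod (f x))%R).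
  { assert (Cmod l <= Cmod (f x) + Cmod (f x - l))%R; [|lra].
    replace l with (f x + - (f x - l)) at 1 by ring.
    eapply Rle_trans. apply Cmod_triangle. rewrite Cmod_opp. lra. }
  assert (Hf : f x <> 0). { apply (proj2 (Cmod_gt_0 _)). lra. }
  replace (/ f x - / l) with (- (f x - l) * (/ f x * / l)) by (field; auto).
  rewrite !Cmod_mult, Cmod_opp, !Cmod_inv by auto.
  apply Rle_lt_trans with (Cmod (f x - l) * (/ (Cmod l / 2) * / Cmod l))%R.
  - apply Rmult_le_compat_l. apply Cmod_ge_0.
    apply Rmult_le_compat_r. apply Rlt_le, Rinv_0_lt_compat; auto.
    apply Rinv_le_contravar; lra.
  - apply Rlt_le_trans with (d * (/ (Cmod l / 2) * / Cmod l))%R.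
    + apply Rmult_lt_compat_r; auto.
      apply Rmult_lt_0_compat; apply Rinv_0_lt_compat; lra.
    + apply Rle_trans with ((eps * (Cmod l * Cmod l) / 2) * (/ (Cmod l / 2) * / Cmod l))%R.
      * apply Rmult_le_compat_r; auto.
        apply Rlt_le, Rmult_lt_0_compat; apply Rinv_0_lt_compat; lra.
      * right. field. lra.
Qed.

Lemma Flim_inv_INR : Flim eventually (fun n => RtoC (/ INR n)) 0.
Proof.
  intros eps He. destruct (archimed_cor1 eps He) as [K [HK HK0]]. exists K. intros n Hn.
  replace (RtoC (/ INR n) - 0) with (RtoC (/ INR n)) by ring.
  assert (0 < INR K)%R by (apply lt_0_INR; auto).
  assert (INR K <= INR n)%R by (apply le_INR; auto).
  rewrite Cmod_R, Rabs_pos_eq. apply Rle_lt_trans with (/ INR K)%R; auto. apply Rinv_le_contravar; auto.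
  left. apply Rinv_0_lt_compat. lra.
Qed.

Lemma Flim_pow {T : Type} (F : (T -> Prop) -> Prop) {FF : Filter F} (f : T -> C) (l : C) k :
  Flim F f l -> Flim F (fun x => f x ^ k) (l ^ k).
Proof.
  intros H. induction k. exact (Flim_const F 1). exact (Flim_mult F _ _ _ _ H IHk).
Qed.

(** * Finite sums and series of complex numbers *)

Lemma Csum_Sn (a : nat -> C) n : sum_n a (S n) = sum_n a n + a (S n).
Proof. exact (sum_Sn (G := C_AbelianMonoid) a n). Qed.

Lemma Rsum_Sn (a : nat -> R) n : sum_n a (S n) = (sum_n a n + a (S n))%R.
Proof. exact (sum_Sn (G := R_AbelianMonoid) a n). Qed.

Lemma Csum_O (a : nat -> C) : sum_n a 0 = a 0%nat.
Proof. exact (sum_O (G := C_AbelianMonoid) a). Qed.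

Lemma Rsum_O (a : nat -> R) : sum_n a 0 = a 0%nat.
Proof. exact (sum_O (G := R_AbelianMonoid) a). Qed.

Lemma Csum_ext_le (a b : nat -> C) n :
  (forall k, (k <= n)%nat -> a k = b k) -> sum_n a n = sum_n b n.
Proof. intros H. apply sum_n_ext_loc. exact H. Qed.

Lemma Csum_plus (a b : nat -> C) n :
  sum_n (fun k => a k + b k) n = sum_n a n + sum_n b n.
Proof. exact (sum_n_plus (G := C_AbelianMonoid) a b n). Qed.

Lemma Csum_mult_l (c : C) (a : nat -> C) n :
  sum_n (fun k => c * a k) n = c * sum_n a n.
Proof. exact (sum_n_mult_l (K := C_Ring) c a n). Qed.

Lemma Csum_mult_r (c : C) (a : nat -> C) n :
  sum_n (fun k => a k * c) n = sum_n a n * c.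
Proof. exact (sum_n_mult_r (K := C_Ring) c a n). Qed.

Lemma Rsum_mult_l (c : R) (a : nat -> R) n :
  sum_n (fun k => c * a k)%R n = (c * sum_n a n)%R.
Proof. exact (sum_n_mult_l (K := R_Ring) c a n). Qed.

Lemma Rsum_mult_r (c : R) (a : nat -> R) n :
  sum_n (fun k => a k * c)%R n = (sum_n a n * c)%R.
Proof. exact (sum_n_mult_r (K := R_Ring) c a n). Qed.

Lemma Rsum_le (a b : nat -> R) n :
  (forall k, (k <= n)%nat -> (a k <= b k)%R) -> (sum_n a n <= sum_n b n)%R.
Proof.
  induction n; intros H.
  - rewrite !Rsum_O. apply H. lia.
  - rewrite !Rsum_Sn. apply Rplus_le_compat. apply IHn. intros; apply H; lia. apply H; lia.
Qed.

Lemma Rsum_nonneg (a : nat -> R) n : (forall k, (0 <= a k)%R) -> (0 <= sum_n a n)%R.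
Proof.
  intros H. induction n. rewrite Rsum_O; auto. rewrite Rsum_Sn. specialize (H (S n)). lra.
Qed.

Lemma Rsum_incr (a : nat -> R) n m : (forall k, (0 <= a k)%R) -> (n <= m)%nat ->
  (sum_n a n <= sum_n a m)%R.
Proof.
  intros H Hnm. induction Hnm. lra. rewrite Rsum_Sn. specialize (H (S m)). lra.
Qed.

Lemma Cmod_sum_le (a : nat -> C) n : (Cmod (sum_n a n) <= sum_n (fun k => Cmod (a k)) n)%R.
Proof.
  induction n. rewrite Csum_O, Rsum_O. lra.
  rewrite Csum_Sn, Rsum_Sn. eapply Rle_trans. apply Cmod_triangle. lra.
Qed.

Lemma RtoC_sum (a : nat -> R) n : RtoC (sum_n a n) = sum_n (fun k => RtoC (a k)) n.
Proof.
  induction n. rewrite Csum_O, Rsum_O. reflexivity.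
  rewrite Csum_Sn, Rsum_Sn, RtoC_plus, IHn. reflexivity.
Qed.

Lemma Re_sum (a : nat -> C) n : Re (sum_n a n) = sum_n (fun k => Re (a k)) n.
Proof.
  induction n. rewrite Csum_O, Rsum_O. reflexivity.
  rewrite Csum_Sn, Rsum_Sn, <- IHn. reflexivity.
Qed.

Lemma Im_sum (a : nat -> C) n : Im (sum_n a n) = sum_n (fun k => Im (a k)) n.
Proof.
  induction n. rewrite Csum_O, Rsum_O. reflexivity.
  rewrite Csum_Sn, Rsum_Sn, <- IHn. reflexivity.
Qed.

Lemma Flim_sum {T : Type} (F : (T -> Prop) -> Prop) {FF : Filter F}
  (a : T -> nat -> C) (l : nat -> C) n :
  (forall k, (k <= n)%nat -> Flim F (fun x => a x k) (l k)) ->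
  Flim F (fun x => sum_n (a x) n) (sum_n l n).
Proof.
  induction n; intros H.
  - rewrite Csum_O. apply (Flim_ext_ev _ (fun x => a x 0%nat)).
    apply filter_forall. intros; now rewrite Csum_O. apply H; lia.
  - rewrite Csum_Sn. apply (Flim_ext_ev _ (fun x => sum_n (a x) n + a x (S n))).
    apply filter_forall. intros; now rewrite Csum_Sn.
    apply (Flim_plus F). apply IHn. intros; apply H; lia. apply H; lia.
Qed.

Lemma ex_series_nonneg (b : nat -> R) M :
  (forall n, (0 <= b n)%R) -> (forall N, (sum_n b N <= M)%R) -> ex_series b.
Proof.
  intros Hb HM.
  destruct (ex_finite_lim_seq_incr (sum_n b) M) as [l Hl].
  - intros n. apply Rsum_incr; auto.
  - exact HM.
  - exists l. exact Hl.
Qed.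

Lemma sum_le_Series (b : nat -> R) N :
  (forall n, (0 <= b n)%R) -> ex_series b -> (sum_n b N <= Series b)%R.
Proof.
  intros Hb Hex. apply Series_correct in Hex.
  refine (is_lim_seq_incr_compare (sum_n b) _ Hex _ N).
  intros n. apply Rsum_incr; auto.
Qed.

Lemma Series_le_bound (b : nat -> R) M :
  ex_series b -> (forall N, (sum_n b N <= M)%R) -> (Series b <= M)%R.
Proof.
  intros Hex H. apply Series_correct in Hex.
  exact (is_lim_seq_le (sum_n b) (fun _ => M) (Series b) M H Hex (is_lim_seq_const M)).
Qed.

Lemma ex_series_Cmod_le (a : nat -> C) (b : nat -> R) :
  (forall n, (Cmod (a n) <= b n)%R) -> ex_series b -> ex_series (fun n => Cmod (a n)).
Proof.
  intros H Hb.
  apply (ex_series_le (K := R_AbsRing) (V := R_CompleteNormedModule) _ b); auto.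
  intros n. change (Rabs (Cmod (a n)) <= b n)%R. rewrite Rabs_pos_eq; auto. apply Cmod_ge_0.
Qed.

Lemma ex_series_R_le (a b : nat -> R) :
  (forall n, (0 <= a n <= b n)%R) -> ex_series b -> ex_series a.
Proof.
  intros H Hb.
  apply (ex_series_le (K := R_AbsRing) (V := R_CompleteNormedModule) _ b); auto.
  intros n. change (Rabs (a n) <= b n)%R. rewrite Rabs_pos_eq; apply H.
Qed.

Lemma ex_series_R_scal (c : R) (a : nat -> R) :
  ex_series a -> ex_series (fun n => c * a n)%R.
Proof. exact (fun H => ex_series_scal_l c a H). Qed.

Lemma is_series_dominated (a : nat -> C) (b : nat -> R) :
  (forall n, (Cmod (a n) <= b n)%R) -> ex_series b ->
  exists l, is_Cseries a l.
Proof.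
  intros H Hb.
  exact (ex_series_le (K := C_AbsRing) (V := C_CompleteNormedModule) a b H Hb).
Qed.

Lemma Csum_diff_le (a : nat -> C) (b : nat -> R) K N :
  (forall n, (Cmod (a n) <= b n)%R) -> (K <= N)%nat ->
  (Cmod (sum_n a N - sum_n a K) <= sum_n b N - sum_n b K)%R.
Proof.
  intros H HKN. induction HKN.
  - replace (sum_n a K - sum_n a K) with (RtoC 0) by cring. rewrite Cmod_0. lra.
  - rewrite Csum_Sn, Rsum_Sn.
    replace (sum_n a m + a (S m) - sum_n a K) with (sum_n a m - sum_n a K + a (S m)) by cring.
    eapply Rle_trans. apply Cmod_triangle. specialize (H (S m)). lra.
Qed.

Lemma is_series_tail (a : nat -> C) (b : nat -> R) l K :
  (forall n, (Cmod (a n) <= b n)%R) -> ex_series b ->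
  is_Cseries a l ->
  (Cmod (l - sum_n a K) <= Series b - sum_n b K)%R.
Proof.
  intros H Hb Ha. apply is_series_C_iff in Ha.
  apply (Flim_Cmod_le eventually (fun N => sum_n a N - sum_n a K)).
  - apply (Flim_plus eventually _ _ _ _ Ha). apply (Flim_const eventually).
  - exists K. intros N HN. eapply Rle_trans. apply (Csum_diff_le a b); auto.
    assert (sum_n b N <= Series b)%R; [|lra].
    apply sum_le_Series; auto. intros n. eapply Rle_trans. apply Cmod_ge_0. apply H.
Qed.

Lemma is_series_Cmod_le (a : nat -> C) (b : nat -> R) l :
  (forall n, (Cmod (a n) <= b n)%R) -> ex_series b ->
  is_Cseries a l -> (Cmod l <= Series b)%R.
Proof.
  intros H Hb Ha.
  pose proof (is_series_tail a b l 0 H Hb Ha) as H1. rewrite Csum_O, Rsum_O in H1.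
  replace l with (l - a 0%nat + a 0%nat) by cring.
  eapply Rle_trans. apply Cmod_triangle. specialize (H 0%nat). lra.
Qed.

Lemma Series_tail_small (b : nat -> R) eps :
  (0 < eps)%R -> (forall n, (0 <= b n)%R) -> ex_series b ->
  exists K, (Series b - sum_n b K < eps)%R.
Proof.
  intros He Hb Hex. apply Series_correct in Hex.
  destruct (proj2 (is_lim_seq_spec (sum_n b) (Series b)) Hex (mkposreal _ He)) as [K HK].
  exists K. specialize (HK K (Nat.le_refl K)). simpl in HK.
  apply Rabs_def2 in HK. lra.
Qed.

(** Dominated convergence for series: beyond some [K] both tails are below [eps / 3] by the
    majorant, and the first [K] terms converge separately. It is used for sequences and for the
    moving endpoints of improper integrals. *)
Lemma tannery {T : Type} (F : (T -> Prop) -> Prop) {FF : ProperFilter F}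
  (a : T -> nat -> C) (b : nat -> R) (l : nat -> C) (S : T -> C) (SL : C) :
  F (fun x => forall n, (Cmod (a x n) <= b n)%R) -> ex_series b ->
  (forall n, Flim F (fun x => a x n) (l n)) ->
  F (fun x => is_Cseries (a x) (S x)) ->
  is_Cseries l SL ->
  Flim F S SL.
Proof.
  intros Hab Hb Hal HS HSL eps He.
  assert (Hlb : forall n, (Cmod (l n) <= b n)%R).
  { intros n. apply (Flim_Cmod_le F (fun x => a x n)); auto.
    generalize Hab. apply filter_imp. auto. }
  assert (Hbp : forall n, (0 <= b n)%R).
  { intros n. eapply Rle_trans. apply Cmod_ge_0. apply Hlb. }
  assert (He3 : (0 < eps / 3)%R) by lra.
  destruct (Series_tail_small b (eps / 3) He3 Hbp Hb) as [K HK].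
  pose proof (Flim_sum F a l K (fun k _ => Hal k) (eps / 3)%R He3) as Hf.
  generalize (filter_and _ _ (filter_and _ _ Hab HS) Hf).
  apply filter_imp. intros x [[H1 H2] H3].
  pose proof (is_series_tail (a x) b (S x) K H1 Hb H2).
  pose proof (is_series_tail l b SL K Hlb Hb HSL).
  replace (S x - SL) with ((S x - sum_n (a x) K) + ((sum_n (a x) K - sum_n l K) + - (SL - sum_n l K))) by cring.
  eapply Rle_lt_trans. apply Cmod_triangle.
  eapply Rle_lt_trans. apply Rplus_le_compat_l. apply Cmod_triangle.
  rewrite Cmod_opp. lra.
Qed.

Lemma is_series_finite (a : nat -> C) N :
  (forall n, (N < n)%nat -> a n = 0) -> is_Cseries a (sum_n a N).
Proof.
  intros H. apply is_series_C_iff. apply (Flim_ext_ev _ (fun _ => sum_n a N)).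
  - exists N. intros n Hn. induction Hn. auto.
    rewrite Csum_Sn, <- IHHn, H by lia. cring.
  - apply (Flim_const eventually).
Qed.

Lemma is_series_zero : is_Cseries (fun _ => RtoC 0) (RtoC 0).
Proof.
  pose proof (is_series_finite (fun _ => RtoC 0) 0 (fun _ _ => eq_refl)) as H.
  rewrite Csum_O in H. exact H.
Qed.

Lemma is_series_C_plus (a b : nat -> C) la lb :
  is_Cseries a la -> is_Cseries b lb ->
  is_Cseries (fun n => a n + b n) (la + lb).
Proof. apply (is_series_plus (K := C_AbsRing) (V := C_NormedModule)). Qed.

Lemma is_series_C_scal (c : C) (a : nat -> C) la :
  is_Cseries a la ->
  is_Cseries (fun n => c * a n) (c * la).
Proof. apply (is_series_scal (K := C_AbsRing) (V := C_NormedModule)). Qed.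

Lemma is_series_C_ext (a b : nat -> C) l :
  (forall n, a n = b n) ->
  is_Cseries a l -> is_Cseries b l.
Proof. apply is_series_ext. Qed.

Lemma is_series_C_sum (a : nat -> nat -> C) (l : nat -> C) N :
  (forall k, (k <= N)%nat -> is_Cseries (a k) (l k)) ->
  is_Cseries (fun n => sum_n (fun k => a k n) N) (sum_n l N).
Proof.
  induction N; intros H.
  - rewrite Csum_O. apply is_series_C_ext with (a 0%nat). intros; now rewrite Csum_O. apply H; lia.
  - rewrite Csum_Sn. apply is_series_C_ext with (fun n => sum_n (fun k => a k n) N + a (S N) n).
    intros; now rewrite Csum_Sn. apply is_series_C_plus. apply IHN; intros; apply H; lia. apply H; lia.
Qed.

Lemma is_series_Re (a : nat -> C) l :
  is_Cseries a l -> is_series (fun n => Re (a n)) (Re l).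
Proof.
  rewrite is_series_C_iff. intros H.
  apply (proj1 (is_lim_seq_spec (sum_n (fun n => Re (a n))) (Re l))). intros eps.
  destruct (H eps (cond_pos eps)) as [K HK]. exists K. intros n Hn.
  rewrite <- Re_sum. eapply Rle_lt_trans; [|apply (HK n Hn)].
  eapply Rle_trans; [|apply Rmax_Cmod]. eapply Rle_trans; [|apply Rmax_l]. right. reflexivity.
Qed.

Lemma is_series_Im (a : nat -> C) l :
  is_Cseries a l -> is_series (fun n => Im (a n)) (Im l).
Proof.
  rewrite is_series_C_iff. intros H.
  apply (proj1 (is_lim_seq_spec (sum_n (fun n => Im (a n))) (Im l))). intros eps.
  destruct (H eps (cond_pos eps)) as [K HK]. exists K. intros n Hn.
  rewrite <- Im_sum. eapply Rle_lt_trans; [|apply (HK n Hn)].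
  eapply Rle_trans; [|apply Rmax_Cmod]. eapply Rle_trans; [|apply Rmax_r]. right. reflexivity.
Qed.

(** * Double series *)

Definition dbounded (b : nat -> nat -> R) : Prop :=
  exists M : R, forall N : nat, (sum_n (fun m => sum_n (b m) N) N <= M)%R.

Lemma is_series2_iff (a : nat -> nat -> C) l :
  is_series2 a l <-> (dbounded (fun m n => Cmod (a m n)) /\
    Flim eventually (fun N => sum_n (fun m => sum_n (a m) N) N) l).
Proof. unfold is_series2. rewrite (Flim_iff eventually). reflexivity. Qed.

(** A rectangle lies in a square, and the terms are nonnegative. *)
Lemma dbounded_rect (b : nat -> nat -> R) M :
  (forall m n, (0 <= b m n)%R) ->
  (forall N : nat, (sum_n (fun m => sum_n (b m) N) N <= M)%R) ->
  forall N K, (sum_n (fun m => sum_n (b m) K) N <= M)%R.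
Proof.
  intros Hb HM N K.
  apply Rle_trans with (sum_n (fun m => sum_n (b m) (max N K)) (max N K)); auto.
  apply Rle_trans with (sum_n (fun m => sum_n (b m) (max N K)) N).
  - apply Rsum_le. intros. apply Rsum_incr; auto. lia.
  - apply Rsum_incr. intros; apply Rsum_nonneg; auto. lia.
Qed.

(** Tonelli's theorem: all rectangles have the bound [M]; letting the width of a rectangle of fixed
    height grow replaces its rows by their full sums. *)
Lemma dbounded_rows (b : nat -> nat -> R) :
  (forall m n, (0 <= b m n)%R) -> dbounded b ->
  (forall m, ex_series (b m)) /\ ex_series (fun m => Series (b m)).
Proof.
  intros Hb [M HM]. pose proof (dbounded_rect b M Hb HM) as HR.
  assert (Hrow : forall m, ex_series (b m)).
  { intros m. apply ex_series_nonneg with M; auto. intros N.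
    eapply Rle_trans; [|apply (HR m N)].
    destruct m. rewrite Rsum_O; lra. rewrite Rsum_Sn.
    assert (0 <= sum_n (fun m0 => sum_n (b m0) N) m)%R by (apply Rsum_nonneg; intros; apply Rsum_nonneg; auto).
    lra. }
  split; auto.
  apply ex_series_nonneg with M.
  - intros m. eapply Rle_trans; [|apply (sum_le_Series (b m) 0); auto]. rewrite Rsum_O; auto.
  - intros N.
    assert (Hl : is_lim_seq (fun K => sum_n (fun m => sum_n (b m) K) N) (sum_n (fun m => Series (b m)) N)).
    { induction N.
      - apply is_lim_seq_ext with (fun K => sum_n (b 0%nat) K). intros; now rewrite Rsum_O.
        rewrite Rsum_O. exact (Series_correct _ (Hrow 0%nat)).
      - apply is_lim_seq_ext with (fun K => sum_n (fun m => sum_n (b m) K) N + sum_n (b (S N)) K)%R.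
        intros; now rewrite Rsum_Sn.
        rewrite Rsum_Sn. apply is_lim_seq_plus'; auto. exact (Series_correct _ (Hrow (S N))). }
    exact (is_lim_seq_le _ (fun _ => M) _ _ (HR N) Hl (is_lim_seq_const M)).
Qed.

Lemma dbounded_of_rows (b : nat -> nat -> R) :
  (forall m n, (0 <= b m n)%R) -> (forall m, ex_series (b m)) ->
  ex_series (fun m => Series (b m)) -> dbounded b.
Proof.
  intros Hb H1 H2. exists (Series (fun m => Series (b m))). intros N.
  apply Rle_trans with (sum_n (fun m => Series (b m)) N).
  - apply Rsum_le. intros. apply sum_le_Series; auto.
  - apply sum_le_Series; auto. intros m.
    eapply Rle_trans; [|apply (sum_le_Series (b m) 0); auto]. rewrite Rsum_O; auto.
Qed.

Lemma dbounded_le (a b : nat -> nat -> R) :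
  (forall m n, (a m n <= b m n)%R) -> dbounded b -> dbounded a.
Proof.
  intros H [M HM]. exists M. intros N. eapply Rle_trans; [|apply (HM N)].
  apply Rsum_le; intros; apply Rsum_le; auto.
Qed.

Lemma dbounded_scal (c : R) (b : nat -> nat -> R) :
  (0 <= c)%R -> dbounded b -> dbounded (fun m n => c * b m n)%R.
Proof.
  intros Hc [M HM]. exists (c * M)%R. intros N.
  rewrite (sum_n_ext _ (fun m => c * sum_n (b m) N)%R) by (intros; apply Rsum_mult_l).
  rewrite Rsum_mult_l. apply Rmult_le_compat_l; auto.
Qed.

(** Dominated convergence is applied within each row and then to the row sums, whose majorant is the
    row sums of [b]. *)
Lemma tannery2 {T : Type} (F : (T -> Prop) -> Prop) {FF : ProperFilter F}
  (a : T -> nat -> nat -> C) (b : nat -> nat -> R) (l : nat -> nat -> C)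
  (rl : nat -> C) (S : T -> C) (SL : C) (r : T -> nat -> C) :
  (forall x m n, (Cmod (a x m n) <= b m n)%R) -> dbounded b ->
  (forall m n, Flim F (fun x => a x m n) (l m n)) ->
  (forall x m, is_Cseries (a x m) (r x m)) ->
  (forall x, is_Cseries (r x) (S x)) ->
  (forall m, is_Cseries (l m) (rl m)) ->
  is_Cseries rl SL ->
  Flim F S SL.
Proof.
  intros Hab Hb Hal Hr HS Hrl HSL.
  assert (Hbp : forall m n, (0 <= b m n)%R).
  { intros. destruct (filter_ex (F := F) (fun _ => True)) as [x _]. apply filter_true.
    eapply Rle_trans. apply Cmod_ge_0. apply (Hab x). }
  destruct (dbounded_rows b Hbp Hb) as [H1 H2].
  apply (tannery F r (fun m => Series (b m)) rl S SL); auto.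
  - apply filter_forall. intros x m. apply is_series_Cmod_le with (a x m); auto.
  - intros m. apply (tannery F (fun x => a x m) (b m) (l m) (fun x => r x m) (rl m)); auto.
    + apply filter_forall; auto.
    + apply filter_forall; auto.
  - apply filter_forall; auto.
Qed.

(** A square partial sum is the iterated sum of the array cut off outside the square, so dominated
    convergence applies to the cut-off arrays. *)
Lemma is_series2_of_rows (a : nat -> nat -> C) (r : nat -> C) l :
  dbounded (fun m n => Cmod (a m n)) ->
  (forall m, is_Cseries (a m) (r m)) ->
  is_Cseries r l -> is_series2 a l.
Proof.
  intros Hb Hr Hl. apply is_series2_iff. split; auto.
  apply (tannery2 eventually
    (fun N m n => if andb (Nat.leb m N) (Nat.leb n N) then a m n else 0)
    (fun m n => Cmod (a m n)) a r _ l
    (fun N m => if Nat.leb m N then sum_n (a m) N else 0)); auto.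
  - intros N m n. destruct andb; simpl. lra. rewrite Cmod_0. apply Cmod_ge_0.
  - intros m n. apply (Flim_ext_ev _ (fun _ => a m n)).
    + exists (max m n). intros N HN.
      rewrite (proj2 (Nat.leb_le m N)), (proj2 (Nat.leb_le n N)) by lia. reflexivity.
    + apply (Flim_const eventually).
  - intros N m. destruct (Nat.leb m N); simpl.
    + rewrite (Csum_ext_le (a m) (fun n => if Nat.leb n N then a m n else 0)).
      * apply is_series_finite. intros n Hn. rewrite (proj2 (Nat.leb_gt n N)) by lia. reflexivity.
      * intros k Hk. rewrite (proj2 (Nat.leb_le k N)) by lia. reflexivity.
    + apply is_series_zero.
  - intros N.
    rewrite (Csum_ext_le (fun m => sum_n (a m) N) (fun m => if Nat.leb m N then sum_n (a m) N else 0)).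
    + apply is_series_finite. intros n Hn. rewrite (proj2 (Nat.leb_gt n N)) by lia. reflexivity.
    + intros k Hk. rewrite (proj2 (Nat.leb_le k N)) by lia. reflexivity.
Qed.

Lemma dbounded_row_sums (a : nat -> nat -> C) :
  dbounded (fun m n => Cmod (a m n)) ->
  exists r l, (forall m, is_Cseries (a m) (r m)) /\
    is_Cseries r l /\ is_series2 a l.
Proof.
  intros Hb.
  destruct (dbounded_rows _ (fun m n => Cmod_ge_0 (a m n)) Hb) as [H1 H2].
  assert (Hr : forall m, is_Cseries (a m) (CSeries (a m))).
  { intros m. destruct (is_series_dominated (a m) (fun n => Cmod (a m n))) as [l Hl]; auto.
    intros; lra. rewrite (CSeries_unique _ _ Hl). exact Hl. }
  destruct (is_series_dominated (fun m => CSeries (a m)) (fun m => Series (fun n => Cmod (a m n)))) as [l Hl]; auto.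
  - intros m. apply is_series_Cmod_le with (a m); auto. intros; lra.
  - exists (fun m => CSeries (a m)), l. split; auto. split; auto.
    apply is_series2_of_rows with (fun m => CSeries (a m)); auto.
Qed.

Lemma is_series2_rows (a : nat -> nat -> C) l :
  is_series2 a l ->
  exists r, (forall m, is_Cseries (a m) (r m)) /\
    is_Cseries r l.
Proof.
  intros H. pose proof (proj1 (is_series2_iff a l) H) as [Hb _].
  destruct (dbounded_row_sums a Hb) as [r [l' [Hr [Hl H']]]].
  exists r. split; auto. rewrite (is_series2_unique _ _ _ H H'). exact Hl.
Qed.

Lemma is_series2_ext (a b : nat -> nat -> C) l :
  (forall m n, a m n = b m n) -> is_series2 a l -> is_series2 b l.
Proof.
  intros H [[M HM] Hl]. split.
  - exists M. intros N. eapply Rle_trans; [|apply (HM N)]. apply Rsum_le; intros; apply Rsum_le; intros.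
    rewrite H. lra.
  - eapply filterlim_ext; [|exact Hl]. intros N. apply sum_n_ext; intros; apply sum_n_ext; auto.
Qed.

Lemma is_series2_scal (c : C) (a : nat -> nat -> C) l :
  is_series2 a l -> is_series2 (fun m n => c * a m n) (c * l).
Proof.
  intros H. apply is_series2_iff in H. destruct H as [Hb Hl]. apply is_series2_iff. split.
  - eapply dbounded_le; [|apply (dbounded_scal (Cmod c) _ (Cmod_ge_0 c) Hb)].
    intros; simpl. rewrite Cmod_mult. lra.
  - apply (Flim_ext_ev _ (fun N => c * sum_n (fun m => sum_n (a m) N) N)).
    + apply filter_forall. intros N. rewrite <- Csum_mult_l. apply sum_n_ext. intros m.
      rewrite Csum_mult_l. reflexivity.
    + apply (Flim_mult eventually); auto. apply (Flim_const eventually).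
Qed.

Lemma Csum_triangle (a : nat -> nat -> C) M :
  sum_n (fun N => sum_n (fun m => a m (N - m)%nat) N) M =
  sum_n (fun m => sum_n (a m) (M - m)) M.
Proof.
  induction M.
  - rewrite !Csum_O. reflexivity.
  - rewrite Csum_Sn, IHM, (Csum_Sn _ M).
    rewrite (Csum_Sn (fun m => sum_n (a m) (S M - m)) M).
    rewrite (Csum_ext_le (fun m => sum_n (a m) (S M - m)) (fun m => sum_n (a m) (M - m) + a m (S M - m)%nat)).
    + rewrite Csum_plus. rewrite Nat.sub_diag, Csum_O. cring.
    + intros k Hk. replace (S M - k)%nat with (S (M - k)) by lia. now rewrite Csum_Sn.
Qed.

Lemma Csum_switch (u : nat -> nat -> C) (m n : nat) :
  sum_n (fun i => sum_n (u i) n) m = sum_n (fun j => sum_n (fun i => u i j) m) n.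
Proof. exact (sum_n_switch (G := C_AbelianMonoid) u m n). Qed.

Lemma Rsum_triangle (a : nat -> nat -> R) M :
  sum_n (fun N => sum_n (fun m => a m (N - m)%nat) N) M =
  sum_n (fun m => sum_n (a m) (M - m)) M.
Proof.
  apply RtoC_inj. rewrite !RtoC_sum.
  rewrite (sum_n_ext (fun k => RtoC (sum_n (fun m => a m (k - m)%nat) k)) _ _ (fun k => RtoC_sum _ _)).
  rewrite (sum_n_ext (fun k => RtoC (sum_n (a k) (M - k))) _ _ (fun k => RtoC_sum _ _)).
  apply (Csum_triangle (fun m n => RtoC (a m n))).
Qed.

(** Here the array is cut off outside the triangle [m + n <= N], under the same majorant. Grouping
    by total degree turns a double power series on a line into a power series in one variable. *)
Lemma is_series2_diag (a : nat -> nat -> C) l :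
  is_series2 a l ->
  is_Cseries (fun N => sum_n (fun m => a m (N - m)%nat) N) l.
Proof.
  intros H. pose proof (proj1 (is_series2_iff a l) H) as [Hb _].
  destruct (is_series2_rows a l H) as [r [Hr Hl]].
  apply is_series_C_iff.
  apply (Flim_ext_ev _ (fun M => sum_n (fun m => sum_n (a m) (M - m)) M)).
  { apply filter_forall. intros M. now rewrite Csum_triangle. }
  apply (tannery2 eventually
    (fun N m n => if Nat.leb (m + n) N then a m n else 0)
    (fun m n => Cmod (a m n)) a r _ l
    (fun N m => if Nat.leb m N then sum_n (a m) (N - m) else 0)); auto.
  - intros N m n. destruct Nat.leb; simpl. lra. rewrite Cmod_0. apply Cmod_ge_0.
  - intros m n. apply (Flim_ext_ev _ (fun _ => a m n)).
    + exists (m + n)%nat. intros N HN.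
      rewrite (proj2 (Nat.leb_le (m + n) N)) by lia. reflexivity.
    + apply (Flim_const eventually).
  - intros N m. destruct (Nat.leb_spec m N); simpl.
    + rewrite (Csum_ext_le (a m) (fun n => if Nat.leb (m + n) N then a m n else 0)).
      * apply is_series_finite. intros n Hn. rewrite (proj2 (Nat.leb_gt (m + n) N)) by lia. reflexivity.
      * intros k Hk. rewrite (proj2 (Nat.leb_le (m + k) N)) by lia. reflexivity.
    + eapply is_series_C_ext; [|apply is_series_zero].
      intros n. simpl. rewrite (proj2 (Nat.leb_gt (m + n) N)) by lia. reflexivity.
  - intros N.
    rewrite (Csum_ext_le (fun m => sum_n (a m) (N - m)) (fun m => if Nat.leb m N then sum_n (a m) (N - m) else 0)).
    + apply is_series_finite. intros n Hn. rewrite (proj2 (Nat.leb_gt n N)) by lia. reflexivity.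
    + intros k Hk. rewrite (proj2 (Nat.leb_le k N)) by lia. reflexivity.
Qed.

Lemma dbounded_diag (b : nat -> nat -> R) :
  (forall m n, (0 <= b m n)%R) -> dbounded b ->
  ex_series (fun N => sum_n (fun m => b m (N - m)%nat) N).
Proof.
  intros Hb [M HM]. apply ex_series_nonneg with M.
  - intros. apply Rsum_nonneg. auto.
  - intros N. rewrite Rsum_triangle. eapply Rle_trans; [|apply (HM N)].
    apply Rsum_le. intros. apply Rsum_incr; auto. lia.
Qed.

Lemma is_series2_transpose (a : nat -> nat -> C) l :
  is_series2 a l -> is_series2 (fun m n => a n m) l.
Proof.
  intros [[M HM] Hl]. split.
  - exists M. intros N. eapply Rle_trans; [|apply (HM N)]. right.
    apply (sum_n_switch (G := R_AbelianMonoid) (fun i j => Cmod (a j i))).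
  - eapply filterlim_ext; [|exact Hl]. intros N. apply (Csum_switch a).
Qed.

(** The rearrangement behind every change of variable below: the factor [g j] is expanded in [q],
    and the sum over [j] is carried out first. Since [R2 j] bounds the absolute sum over [q], the
    triple array [e m j * c j q] is absolutely summable. *)
Lemma is_series2_subst (e c : nat -> nat -> C) (g : nat -> C) (R2 : nat -> R)
  (k : nat -> nat -> C) l :
  dbounded (fun m j => Cmod (e m j) * R2 j)%R ->
  (forall j, is_Cseries (c j) (g j)) ->
  (forall j N, (sum_n (fun q => Cmod (c j q)) N <= R2 j)%R) ->
  (forall m q, is_Cseries (fun j => e m j * c j q) (k m q)) ->
  is_series2 (fun m j => e m j * g j) l ->
  is_series2 k l.
Proof.
  intros Hb Hc HR Hk Hl.
  assert (HR0 : forall j, (0 <= R2 j)%R).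
  { intros j. eapply Rle_trans; [|apply (HR j 0%nat)]. rewrite Rsum_O. apply Cmod_ge_0. }
  assert (Hb0 : forall m j, (0 <= Cmod (e m j) * R2 j)%R).
  { intros. apply Rmult_le_pos; auto. apply Cmod_ge_0. }
  destruct (is_series2_rows _ _ Hl) as [rl [Hrl HSL]].
  destruct (dbounded_rows _ Hb0 Hb) as [Hb1 Hb2].
  destruct Hb as [M HM].
  assert (Hcq : forall j q, (Cmod (c j q) <= R2 j)%R).
  { intros j q. eapply Rle_trans; [|apply (HR j q)]. destruct q. rewrite Rsum_O; lra.
    rewrite Rsum_Sn. assert (0 <= sum_n (fun q0 => Cmod (c j q0)) q)%R by (apply Rsum_nonneg; intros; apply Cmod_ge_0). lra. }
  apply is_series2_iff. split.
  - exists (Series (fun m => Series (fun j => Cmod (e m j) * R2 j)))%R. intros N.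
    apply Rle_trans with (sum_n (fun m => Series (fun j => Cmod (e m j) * R2 j)%R) N).
    2:{ apply sum_le_Series; auto. intros m.
        eapply Rle_trans; [|apply (sum_le_Series (fun j => Cmod (e m j) * R2 j)%R 0); auto]. rewrite Rsum_O; auto. }
    apply Rsum_le. intros m _.
    assert (Hex : forall q, ex_series (fun j => Cmod (e m j * c j q))).
    { intros q. apply ex_series_Cmod_le with (fun j => Cmod (e m j) * R2 j)%R; auto.
      intros j. rewrite Cmod_mult. apply Rmult_le_compat_l; auto. apply Cmod_ge_0. }
    apply Rle_trans with (sum_n (fun q => Series (fun j => Cmod (e m j * c j q))) N).
    { apply Rsum_le. intros q _. apply is_series_Cmod_le with (fun j => e m j * c j q); auto. intros; lra. }
    (* Only finitely many [q] occur here, so the exchange with the series over [j] is linearity. *)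
    assert (Hs : is_series (fun j => sum_n (fun q => Cmod (e m j * c j q)) N)
              (sum_n (fun q => Series (fun j => Cmod (e m j * c j q))) N)).
    { clear - Hex. induction N.
      - rewrite Rsum_O. eapply is_series_ext; [|apply Series_correct, (Hex 0%nat)]. intros; simpl. now rewrite Rsum_O.
      - rewrite Rsum_Sn. eapply is_series_ext; [|apply (is_series_plus _ _ _ _ IHN (Series_correct _ (Hex (S N))))].
        intros; simpl. now rewrite Rsum_Sn. }
    rewrite <- (is_series_unique _ _ Hs).
    apply Series_le; auto. intros j. split.
    + apply Rsum_nonneg. intros; apply Cmod_ge_0.
    + erewrite sum_n_ext; [|intros; apply Cmod_mult]. rewrite Rsum_mult_l.
      apply Rmult_le_compat_l; auto. apply Cmod_ge_0.
  (* The square sums of [k] are iterated sums over [m] and [j] in which [m] is cut off and [g j] is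
     replaced by its partial sum; no triple series has to be formed. *)
  - apply (tannery2 eventually
      (fun N m j => if Nat.leb m N then e m j * sum_n (c j) N else 0)
      (fun m j => Cmod (e m j) * R2 j)%R (fun m j => e m j * g j) rl _ l
      (fun N m => if Nat.leb m N then sum_n (k m) N else 0)); auto.
    + intros N m j. destruct Nat.leb; [|rewrite Cmod_0; auto].
      rewrite Cmod_mult. apply Rmult_le_compat_l. apply Cmod_ge_0.
      eapply Rle_trans. apply Cmod_sum_le. auto.
    + exists M; auto.
    + intros m j. apply (Flim_ext_ev _ (fun N => e m j * sum_n (c j) N)).
      * exists m. intros N HN. rewrite (proj2 (Nat.leb_le m N)) by lia. reflexivity.
      * apply (Flim_mult eventually). apply (Flim_const eventually).
        apply is_series_C_iff. auto.
    + intros N m. destruct (Nat.leb m N).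
      * apply is_series_C_ext with (fun j => sum_n (fun q => e m j * c j q) N).
        intros; now rewrite Csum_mult_l.
        apply is_series_C_sum. auto.
      * apply is_series_zero.
    + intros N.
      rewrite (Csum_ext_le (fun m => sum_n (k m) N) (fun m => if Nat.leb m N then sum_n (k m) N else 0)).
      * apply is_series_finite. intros n Hn. rewrite (proj2 (Nat.leb_gt n N)) by lia. reflexivity.
      * intros j Hj. rewrite (proj2 (Nat.leb_le j N)) by lia. reflexivity.
Qed.

Lemma cauchy_product (a b : nat -> C) la lb :
  is_Cseries a la -> is_Cseries b lb ->
  ex_series (fun n => Cmod (a n)) -> ex_series (fun n => Cmod (b n)) ->
  is_series2 (fun m n => a m * b n) (la * lb).
Proof.
  intros Ha Hb Ha' Hb'.
  apply is_series2_of_rows with (fun m => a m * lb).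
  - apply dbounded_of_rows.
    + intros; apply Cmod_ge_0.
    + intros m. eapply ex_series_ext; [intros; symmetry; apply Cmod_mult|].
      exact (ex_series_scal_l (Cmod (a m)) (fun n => Cmod (b n)) Hb').
    + eapply ex_series_ext with (fun m => Cmod (a m) * Series (fun n => Cmod (b n)))%R.
      2:{ exact (ex_series_scal_r (Series (fun n => Cmod (b n))) (fun m => Cmod (a m)) Ha'). }
      intros m. rewrite <- Series_scal_l. apply Series_ext. intros. now rewrite Cmod_mult.
  - intros m. apply is_series_C_scal; auto.
  - rewrite Cmult_comm. eapply is_series_C_ext; [|apply (is_series_C_scal lb a la Ha)].
    intros; apply Cmult_comm.
Qed.

Ltac re_lra := unfold Re in *; simpl in *; lra.

(** * Pochhammer symbols *)

Lemma INR_fact_C_neq (n : nat) : RtoC (INR (fact n)) <> 0.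
Proof. intros H. apply RtoC_inj in H. exact (INR_fact_neq_0 n H). Qed.

Lemma INR_S_C_neq (n : nat) : RtoC (INR (S n)) <> 0.
Proof. intros H. apply RtoC_inj in H. exact (not_0_INR (S n) (Nat.neq_succ_0 n) H). Qed.

Lemma fact_S_C (n : nat) : RtoC (INR (fact (S n))) = RtoC (INR (S n)) * RtoC (INR (fact n)).
Proof. rewrite <- RtoC_mult, <- mult_INR. reflexivity. Qed.

Lemma INR_S_C (n : nat) : RtoC (INR (S n)) = RtoC (INR n) + 1.
Proof. rewrite S_INR, RtoC_plus. reflexivity. Qed.

Lemma INR_add_C (m n : nat) : RtoC (INR (m + n)) = RtoC (INR m) + RtoC (INR n).
Proof. rewrite plus_INR, RtoC_plus. reflexivity. Qed.

Lemma poch_S (a : C) n : pochhammer a (S n) = pochhammer a n * (a + INR n).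
Proof. reflexivity. Qed.

Lemma poch_add (a : C) m n :
  pochhammer a (m + n) = pochhammer a m * pochhammer (a + INR m) n.
Proof.
  induction n.
  - rewrite Nat.add_0_r. simpl. ring.
  - rewrite Nat.add_succ_r, !poch_S, IHn, INR_add_C. ring.
Qed.

Lemma poch_S_l (a : C) n : pochhammer a (S n) = a * pochhammer (a + 1) n.
Proof.
  change (S n) with (1 + n)%nat. rewrite poch_add. simpl. f_equal. ring.
Qed.

Lemma Re_plus_INR (c : C) n : Re (c + INR n) = (Re c + INR n)%R.
Proof. reflexivity. Qed.

Lemma Re_pos_neq_0 (c : C) : (0 < Re c)%R -> c <> 0.
Proof. intros H E. rewrite E in H. simpl in H. lra. Qed.

Lemma poch_neq_0 (c : C) n : (0 < Re c)%R -> pochhammer c n <> 0.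
Proof.
  intros Hc. induction n.
  - simpl. apply Re_pos_neq_0. simpl. lra.
  - rewrite poch_S. apply Cmult_neq_0; auto. apply Re_pos_neq_0.
    rewrite Re_plus_INR. pose proof (pos_INR n). lra.
Qed.

Lemma Re_le_Cmod (c : C) : (Re c <= Cmod c)%R.
Proof.
  eapply Rle_trans; [|apply Rmax_Cmod]. eapply Rle_trans; [|apply Rmax_l]. apply Rle_abs.
Qed.

Lemma Cmod_INR n : Cmod (INR n) = INR n.
Proof. rewrite Cmod_R, Rabs_pos_eq; auto. apply pos_INR. Qed.

Lemma Cmod_plus_INR (a : C) n : (Cmod (a + INR n) <= Cmod a + INR n)%R.
Proof. eapply Rle_trans. apply Cmod_triangle. rewrite Cmod_INR. lra. Qed.

Ltac nz := repeat split;
  first [ assumption | apply INR_fact_C_neq | apply INR_S_C_neq | apply poch_neq_0; assumption ].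

Lemma Csum_shift (f : nat -> C) n :
  sum_n f (S n) = f 0%nat + sum_n (fun k => f (S k)) n.
Proof.
  induction n. rewrite Csum_Sn, !Csum_O. reflexivity.
  rewrite Csum_Sn, IHn, (Csum_Sn (fun k => f (S k))). cring.
Qed.

(* Each term of the convolution is weighted by [i + l = N + 1]. *)
Lemma Csum_conv_S (X : nat -> nat -> C) N :
  INR (S N) * sum_n (fun n => X n (S N - n)%nat) (S N) =
  sum_n (fun n => INR (S n) * X (S n) (N - n)%nat + INR (S (N - n)) * X n (S (N - n))) N.
Proof.
  rewrite <- Csum_mult_l.
  rewrite (Csum_ext_le _ (fun n => INR n * X n (S N - n)%nat + INR (S N - n)%nat * X n (S N - n)%nat)).
  2:{ intros k Hk. rewrite (minus_INR (S N) k) by lia. rewrite RtoC_minus. cring. }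
  rewrite Csum_plus, Csum_plus. f_equal.
  - rewrite Csum_shift. simpl (INR 0). rewrite Cmult_0_l, Cplus_0_l. apply Csum_ext_le.
    intros k Hk. reflexivity.
  - rewrite Csum_Sn, Nat.sub_diag. simpl (INR 0). rewrite Cmult_0_l, Cplus_0_r.
    apply Csum_ext_le. intros k Hk. replace (S N - k)%nat with (S (N - k)) by lia. reflexivity.
Qed.

(** The coefficient of [w^n] in [(1 - w)^(-a)], not the binomial coefficient of [a]. *)
Definition bin (a : C) (n : nat) : C := pochhammer a n / INR (fact n).

Lemma bin_0 a : bin a 0 = 1.
Proof. unfold bin. simpl. field. Qed.

Lemma bin_S (a : C) n : INR (S n) * bin a (S n) = (a + INR n) * bin a n.
Proof.
  unfold bin. rewrite poch_S, fact_S_C. field. split. apply INR_fact_C_neq. apply INR_S_C_neq.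
Qed.

(** The coefficients of [(1 - w)^(-a) (1 - w)^(-b)]. After multiplication by [N + 1] the recurrence
    of [bin] contributes [(a + n) + (b + N - n) = a + b + N], the factor in the recurrence of the
    right-hand side. *)
Lemma vandermonde (a b : C) N :
  sum_n (fun n => bin a n * bin b (N - n)) N = bin (a + b) N.
Proof.
  induction N.
  - rewrite Csum_O. simpl. rewrite !bin_0. ring.
  - assert (INR (S N) * sum_n (fun n => bin a n * bin b (S N - n)) (S N) = INR (S N) * bin (a + b) (S N)).
    { rewrite (Csum_conv_S (fun i l => bin a i * bin b l)), bin_S, <- IHN, <- Csum_mult_l.
      apply Csum_ext_le. intros k Hk.
      assert (E : RtoC (INR N) = INR k + INR (N - k)).
      { rewrite <- INR_add_C. f_equal. f_equal. lia. }
      rewrite E.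
      transitivity ((INR (S k) * bin a (S k)) * bin b (N - k) + bin a k * (INR (S (N - k)) * bin b (S (N - k)))).
      cring. rewrite !bin_S. cring. }
    apply (f_equal (fun z => / INR (S N) * z)) in H.
    rewrite !Cmult_assoc, Cinv_l in H by apply INR_S_C_neq. rewrite !Cmult_1_l in H. exact H.
Qed.

(** This is [2F1(-N, b; c; 1) = (c - b)_N / (c)_N], divided by [N!]. The weight [N + 1] splits the
    sum into the case [N] at [(b + 1, c + 1)] and the case [N] at [(b, c)], so the induction is over
    all [b] and [c]. *)
Lemma chu_vandermonde (b c : C) N : (0 < Re c)%R ->
  sum_n (fun n => (-1) ^ n * bin b n / pochhammer c n / INR (fact (N - n))) N =
  bin (c - b) N / pochhammer c N.
Proof.
  revert b c. induction N; intros b c Hc.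
  - rewrite Csum_O. simpl. rewrite !bin_0. cfield.
  - assert (Hc1 : (0 < Re (c + 1))%R) by re_lra.
    assert (Hcn : c <> 0) by (apply Re_pos_neq_0; auto).
    assert (INR (S N) * sum_n (fun n => (-1) ^ n * bin b n / pochhammer c n / INR (fact (S N - n))) (S N) = INR (S N) * (bin (c - b) (S N) / pochhammer c (S N))).
    { rewrite (Csum_conv_S (fun n l => (-1) ^ n * bin b n / pochhammer c n / INR (fact l))).
      unfold Cdiv at 5. rewrite Cmult_assoc, bin_S.
      rewrite Csum_plus.
      transitivity (- (b / c) * (bin ((c + 1) - (b + 1)) N / pochhammer (c + 1) N) + bin (c - b) N / pochhammer c N).
      - rewrite <- (IHN b c Hc), <- (IHN (b + 1) (c + 1) Hc1), <- Csum_mult_l. f_equal.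
        + apply Csum_ext_le. intros k Hk.
          assert (E : INR (S k) * bin b (S k) = b * bin (b + 1) k).
          { unfold bin. rewrite poch_S_l, fact_S_C. field; nz. }
          rewrite poch_S_l, Cpow_S.
          transitivity (- (-1) ^ k * (INR (S k) * bin b (S k)) / (c * pochhammer (c + 1) k) / INR (fact (N - k))).
          cfield; nz.
          rewrite E. cfield; nz.
        + apply Csum_ext_le. intros k Hk. rewrite fact_S_C. cfield; nz.
      - replace (c + 1 - (b + 1)) with (c - b) by ring.
        assert (E : pochhammer (c + 1) N = pochhammer c N * (c + INR N) / c).
        { rewrite <- poch_S, poch_S_l. field. auto. }
        rewrite E, poch_S. assert (c + INR N <> 0); [|cfield; nz].
        apply Re_pos_neq_0. rewrite Re_plus_INR. pose proof (pos_INR N). lra. }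
    apply (f_equal (fun z => / INR (S N) * z)) in H.
    rewrite !Cmult_assoc, Cinv_l in H by apply INR_S_C_neq. rewrite !Cmult_1_l in H. exact H.
Qed.

(** * Subexponential growth *)

(** [(A)_n / (B)_n] for real arguments: the common majorant of quotients of Pochhammer symbols. *)
Fixpoint rprod (A B : R) (n : nat) : R :=
  match n with O => 1%R | S m => (rprod A B m * ((A + INR m) / (B + INR m)))%R end.


Lemma rprod_nonneg (A B : R) n : (0 <= A)%R -> (0 < B)%R -> (0 <= rprod A B n)%R.
Proof.
  intros HA HB. induction n; simpl. lra. pose proof (pos_INR n). apply Rmult_le_pos; auto.
  apply Rdiv_le_0_compat; lra.
Qed.

(** The factors tend to [1]: beyond some index [J] they are at most [q], and the earlier ones cost
    the constant [K ^ J]. *)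
Lemma rprod_bound (A B q : R) : (0 <= A)%R -> (0 < B)%R -> (1 < q)%R ->
  exists K, (0 < K)%R /\ forall n, (rprod A B n <= K * q ^ n)%R.
Proof.
  intros HA HB Hq.
  (* Each factor [(A + n) / (B + n)] lies between [A / B] and [1]. *)
  set (K := Rmax 1 (A / B)).
  assert (HK1 : (1 <= K)%R) by apply Rmax_l.
  assert (HK2 : (A / B <= K)%R) by apply Rmax_r.
  assert (HAK : (A <= K * B)%R).
  { apply Rmult_le_compat_r with (r := B) in HK2; [|lra].
    replace (A / B * B)%R with A in HK2 by (field; lra). exact HK2. }
  (* For [n >= J] this gives [A <= (q - 1) * n], hence [A + n <= q * (B + n)]. The [+ 1] keeps the
     divisor positive when [A = 0]. *)
  destruct (archimed_cor1 ((q - 1) / (A + 1))) as [J [HJ HJ0]].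
  { apply Rdiv_lt_0_compat; lra. }
  assert (HJ2 : (A <= (q - 1) * INR J)%R).
  { assert (0 < INR J)%R by (apply lt_0_INR; auto).
    apply Rmult_lt_compat_r with (r := (INR J * (A + 1))%R) in HJ; [|nra].
    replace (/ INR J * (INR J * (A + 1)))%R with (A + 1)%R in HJ by (field; lra).
    replace ((q - 1) / (A + 1) * (INR J * (A + 1)))%R with ((q - 1) * INR J)%R in HJ by (field; lra).
    lra. }
  assert (HqJ : forall n, (1 <= q ^ n)%R) by (intros; apply pow_R1_Rle; lra).
  assert (Hsmall : forall n, (rprod A B n <= K ^ n)%R).
  { induction n; simpl. lra. pose proof (pos_INR n).
    rewrite (Rmult_comm K). apply Rmult_le_compat; auto. apply rprod_nonneg; auto.
    apply Rdiv_le_0_compat; lra.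
    apply Rmult_le_reg_r with (B + INR n)%R. lra.
    replace ((A + INR n) / (B + INR n) * (B + INR n))%R with (A + INR n)%R by (field; lra). nra. }
  exists (K ^ J)%R. split. apply pow_lt; lra.
  assert (Hle : forall n, (n <= J)%nat -> (rprod A B n <= K ^ J * q ^ n)%R).
  { intros n Hn. apply Rle_trans with (K ^ J)%R.
    - apply Rle_trans with (K ^ n)%R; auto. apply Rle_pow; auto.
    - rewrite <- (Rmult_1_r (K ^ J)) at 1. apply Rmult_le_compat_l; auto. apply pow_le; lra. }
  intros n. destruct (Nat.le_gt_cases n J) as [Hn | Hn]; auto.
  replace n with (J + (n - J))%nat by lia. generalize (n - J)%nat. clear n Hn. intros n.
  induction n.
  - rewrite Nat.add_0_r. apply Hle. lia.
  - rewrite Nat.add_succ_r. simpl. pose proof (pos_INR (J + n)).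
    replace (K ^ J * (q * q ^ (J + n)))%R with ((K ^ J * q ^ (J + n)) * q)%R by ring.
    apply Rmult_le_compat; auto. apply rprod_nonneg; auto. apply Rdiv_le_0_compat; lra.
    apply Rmult_le_reg_r with (B + INR (J + n))%R. lra.
    replace ((A + INR (J + n)) / (B + INR (J + n)) * (B + INR (J + n)))%R with (A + INR (J + n))%R by (field; lra).
    assert (INR J <= INR (J + n))%R by (apply le_INR; lia). nra.
Qed.

Lemma Cmod_poch_quot (a c : C) (A B : R) n :
  (0 <= A)%R -> (0 < B)%R ->
  (forall j, (Cmod (a + INR j) * (B + INR j) <= Cmod (c + INR j) * (A + INR j))%R) ->
  (forall j, (0 < Cmod (c + INR j))%R) ->
  (Cmod (pochhammer a n / pochhammer c n) <= rprod A B n)%R.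
Proof.
  intros HA HB H Hc. induction n.
  - simpl. replace (1 / 1) with (RtoC 1) by field. rewrite Cmod_1. lra.
  - rewrite !poch_S. simpl rprod.
    assert (Hcn : c + INR n <> 0) by (apply (proj2 (Cmod_gt_0 _)); auto).
    assert (Hp : forall k, pochhammer c k <> 0).
    { induction k. simpl. apply C1_nz. rewrite poch_S. apply Cmult_neq_0; auto. apply (proj2 (Cmod_gt_0 _)); auto. }
    replace (pochhammer a n * (a + INR n) / (pochhammer c n * (c + INR n))) with
      (pochhammer a n / pochhammer c n * ((a + INR n) / (c + INR n))) by (field; auto).
    rewrite Cmod_mult. apply Rmult_le_compat; auto using Cmod_ge_0.
    rewrite Cmod_div by auto. pose proof (pos_INR n). specialize (Hc n). specialize (H n).
    apply Rmult_le_reg_r with ((B + INR n) * Cmod (c + INR n))%R. nra.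
    field_simplify; lra.
Qed.

(** Growth slower than every exponential gives absolute convergence on the whole open unit bidisc.
    Unlike a bound of fixed shape, this condition is closed under products and convolutions. *)
Definition subexp2 (k : nat -> nat -> C) : Prop :=
  forall q : R, (1 < q)%R -> exists K, (0 < K)%R /\
    forall m n, (Cmod (k m n) <= K * (q ^ m * q ^ n))%R.

Lemma subexp2_dbounded k r1 r2 : subexp2 k -> (0 <= r1 < 1)%R -> (0 <= r2 < 1)%R ->
  dbounded (fun m n => Cmod (k m n) * (r1 ^ m * r2 ^ n))%R.
Proof.
  intros Hk H1 H2.
  assert (Hq : exists q, (1 < q /\ q * r1 < 1 /\ q * r2 < 1)%R).
  { set (r := Rmax r1 r2). assert (r1 <= r)%R by apply Rmax_l. assert (r2 <= r)%R by apply Rmax_r.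
    assert (r < 1)%R by (apply Rmax_lub_lt; lra).
    (* A number strictly between [1] and [1 / r] that remains meaningful when [r = 0]. *)
    exists (2 / (1 + r))%R.
    assert (Hr : (2 / (1 + r) * r < 1)%R).
    { apply Rmult_lt_reg_r with (1 + r)%R. lra. field_simplify; lra. }
    assert (Hr1 : (1 < 2 / (1 + r))%R).
    { apply Rmult_lt_reg_r with (1 + r)%R. lra. field_simplify; lra. }
    split; auto. split; nra. }
  destruct Hq as [q [Hq1 [Hq2 Hq3]]].
  destruct (Hk q Hq1) as [K [HK0 HK]].
  assert (Hg : forall r, (0 <= r)%R -> (q * r < 1)%R -> forall N, (sum_n (fun n => (q * r) ^ n)%R N <= / (1 - q * r))%R).
  { intros r Hr Hqr N.
    assert (Hqr' : (Rabs (q * r) < 1)%R) by (rewrite Rabs_pos_eq; auto; nra).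
    rewrite <- (Series_geom (q * r) Hqr').
    apply sum_le_Series. intros; apply pow_le; nra. apply ex_series_geom; auto. }
  exists (K * (/ (1 - q * r1) * / (1 - q * r2)))%R. intros N.
  apply Rle_trans with (sum_n (fun m => sum_n (fun n => K * ((q * r1) ^ m * (q * r2) ^ n))%R N) N).
  - apply Rsum_le. intros m _. apply Rsum_le. intros n _.
    rewrite !Rpow_mult_distr.
    replace (K * (q ^ m * r1 ^ m * (q ^ n * r2 ^ n)))%R with (K * (q ^ m * q ^ n) * (r1 ^ m * r2 ^ n))%R by ring.
    apply Rmult_le_compat_r; auto. apply Rmult_le_pos; apply pow_le; lra.
  - rewrite (sum_n_ext _ (fun m => K * ((q * r1) ^ m * sum_n (fun n => (q * r2) ^ n)%R N))%R).
    2:{ intros m. rewrite <- Rsum_mult_l, <- Rsum_mult_l. reflexivity. }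
    rewrite Rsum_mult_l, Rsum_mult_r. apply Rmult_le_compat_l. lra.
    assert (0 <= q * r1)%R by nra. assert (0 <= q * r2)%R by nra.
    apply Rmult_le_compat.
    + apply Rsum_nonneg. intros; apply pow_le; auto.
    + apply Rsum_nonneg. intros; apply pow_le; auto.
    + apply Hg; lra.
    + apply Hg; lra.
Qed.

Definition csum2 (a : nat -> nat -> C) : C :=
  iota (T := C_CompleteNormedModule) (is_series2 a).

Lemma csum2_unique a l : is_series2 a l -> csum2 a = l.
Proof.
  intros H. apply (iota_unique (K := C_AbsRing) (V := C_CompleteNormedModule)); auto.
  intros y Hy. eapply is_series2_unique; eauto.
Qed.

Lemma csum2_correct a : dbounded (fun m n => Cmod (a m n)) -> is_series2 a (csum2 a).
Proof.
  intros H. destruct (dbounded_row_sums a H) as [r [l [_ [_ Hl]]]].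
  rewrite (csum2_unique _ _ Hl). exact Hl.
Qed.

Lemma subexp2_is_series2 k (u w : C) : subexp2 k -> (Cmod u < 1)%R -> (Cmod w < 1)%R ->
  is_series2 (fun m n => k m n * u ^ m * w ^ n) (csum2 (fun m n => k m n * u ^ m * w ^ n)).
Proof.
  intros Hk Hu Hw. apply csum2_correct.
  eapply dbounded_le; [|apply (subexp2_dbounded k (Cmod u) (Cmod w) Hk)].
  - intros m n. simpl. rewrite !Cmod_mult, !Cmod_pow. lra.
  - split; auto. apply Cmod_ge_0.
  - split; auto. apply Cmod_ge_0.
Qed.

(** Each factor is bounded with base [sqrt q], and the two bases multiply to [q]. *)
Lemma subexp2_mult (k1 k2 : nat -> nat -> C) :
  subexp2 k1 -> subexp2 k2 -> subexp2 (fun m n => k1 m n * k2 m n).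
Proof.
  intros H1 H2 q Hq.
  assert (Hs : (1 < sqrt q)%R). { rewrite <- sqrt_1. apply sqrt_lt_1; lra. }
  assert (Hss : (sqrt q * sqrt q = q)%R) by (apply sqrt_sqrt; lra).
  destruct (H1 _ Hs) as [K1 [HK1 HH1]]. destruct (H2 _ Hs) as [K2 [HK2 HH2]].
  exists (K1 * K2)%R. split. nra. intros m n. rewrite Cmod_mult.
  replace (K1 * K2 * (q ^ m * q ^ n))%R with ((K1 * (sqrt q ^ m * sqrt q ^ n)) * (K2 * (sqrt q ^ m * sqrt q ^ n)))%R.
  apply Rmult_le_compat; auto using Cmod_ge_0.
  transitivity (K1 * K2 * ((sqrt q * sqrt q) ^ m * (sqrt q * sqrt q) ^ n))%R.
  rewrite !Rpow_mult_distr. ring. now rewrite Hss.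
Qed.

Lemma subexp2_l (A B : R) (k : nat -> nat -> C) : (0 <= A)%R -> (0 < B)%R ->
  (forall m n, (Cmod (k m n) <= rprod A B m)%R) -> subexp2 k.
Proof.
  intros HA HB H q Hq. destruct (rprod_bound A B q HA HB Hq) as [K [HK HH]].
  exists K. split; auto. intros m n.
  eapply Rle_trans. apply H. eapply Rle_trans. apply HH.
  assert (1 <= q ^ n)%R by (apply pow_R1_Rle; lra).
  assert (0 < q ^ m)%R by (apply pow_lt; lra).
  apply Rmult_le_compat_l; nra.
Qed.

Lemma subexp2_r (A B : R) (k : nat -> nat -> C) : (0 <= A)%R -> (0 < B)%R ->
  (forall m n, (Cmod (k m n) <= rprod A B n)%R) -> subexp2 k.
Proof.
  intros HA HB H q Hq. destruct (rprod_bound A B q HA HB Hq) as [K [HK HH]].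
  exists K. split; auto. intros m n.
  eapply Rle_trans. apply H. eapply Rle_trans. apply HH.
  assert (1 <= q ^ m)%R by (apply pow_R1_Rle; lra).
  assert (0 < q ^ n)%R by (apply pow_lt; lra).
  apply Rmult_le_compat_l; nra.
Qed.

Lemma poch_1 n : pochhammer 1 n = INR (fact n).
Proof.
  induction n. reflexivity. rewrite poch_S, IHn, fact_S_C, INR_S_C. ring.
Qed.

Lemma Cmod_poch_quot_Re (b c : C) n : (0 < Re c)%R ->
  (Cmod (pochhammer b n / pochhammer c n) <= rprod (Cmod b) (Re c) n)%R.
Proof.
  intros Hc.
  assert (Hj : forall j, (Re c + INR j <= Cmod (c + INR j))%R).
  { intros j. rewrite <- Re_plus_INR. apply Re_le_Cmod. }
  apply Cmod_poch_quot; auto using Cmod_ge_0.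
  - intros j. pose proof (pos_INR j). pose proof (Cmod_plus_INR b j). specialize (Hj j).
    pose proof (Cmod_ge_0 (b + INR j)). pose proof (Cmod_ge_0 b).
    rewrite (Rmult_comm (Cmod (c + INR j))). apply Rmult_le_compat; lra.
  - intros j. pose proof (pos_INR j). specialize (Hj j). lra.
Qed.

Lemma Cmod_bin_le (a : C) n : (Cmod (bin a n) <= rprod (Cmod a) 1 n)%R.
Proof.
  unfold bin. rewrite <- poch_1. apply (Cmod_poch_quot_Re a 1). simpl; lra.
Qed.

(** * The binomial series *)

(** This is [(1 - w)^(-a)] on the unit disc. [Rcpow] takes real bases only, so the series is the
    definition; [Bf_real] identifies the two for real [w]. *)
Definition Bf (a w : C) : C := CSeries (fun n => bin a n * w ^ n).

Lemma bin_ex_series (a w : C) : (Cmod w < 1)%R -> ex_series (fun n => Cmod (bin a n * w ^ n)).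
Proof.
  intros Hw.
  assert (Hk : subexp2 (fun _ n => bin a n)).
  { apply subexp2_r with (Cmod a) 1%R; auto using Cmod_ge_0. lra. intros; apply Cmod_bin_le. }
  pose proof (subexp2_dbounded _ 0 (Cmod w) Hk) as Hd.
  assert (H0 : (0 <= 0 < 1)%R) by lra. assert (H1 : (0 <= Cmod w < 1)%R) by (split; auto using Cmod_ge_0).
  specialize (Hd H0 H1).
  apply dbounded_rows in Hd.
  - destruct Hd as [Hd _]. specialize (Hd 0%nat). eapply ex_series_ext; [|exact Hd].
    intros n. simpl. rewrite Cmod_mult, Cmod_pow. ring.
  - intros. apply Rmult_le_pos. apply Cmod_ge_0. apply Rmult_le_pos; apply pow_le; lra.
Qed.

Lemma Bf_series (a w : C) : (Cmod w < 1)%R -> is_Cseries (fun n => bin a n * w ^ n) (Bf a w).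
Proof.
  intros Hw. destruct (is_series_dominated (fun n => bin a n * w ^ n) (fun n => Cmod (bin a n * w ^ n))) as [l Hl].
  intros; lra. apply bin_ex_series; auto.
  unfold Bf. rewrite (CSeries_unique _ _ Hl). exact Hl.
Qed.

Lemma Bf_mult (a b w : C) : (Cmod w < 1)%R -> Bf a w * Bf b w = Bf (a + b) w.
Proof.
  intros Hw.
  pose proof (cauchy_product _ _ _ _ (Bf_series a w Hw) (Bf_series b w Hw) (bin_ex_series a w Hw) (bin_ex_series b w Hw)) as H.
  apply is_series2_diag in H.
  apply (is_series_C_unique _ _ _ H). eapply is_series_C_ext; [|apply (Bf_series (a + b) w Hw)].
  intros N. cbv beta. rewrite <- vandermonde, <- Csum_mult_r. apply Csum_ext_le. intros m Hm.
  replace (w ^ N) with (w ^ (m + (N - m))) by (f_equal; lia). rewrite Cpow_add_r. cring.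
Qed.

Lemma Bf_0 (w : C) : (Cmod w < 1)%R -> Bf 0 w = 1.
Proof.
  intros Hw. apply CSeries_unique.
  replace (RtoC 1) with (sum_n (fun n => bin 0 n * w ^ n) 0).
  2:{ rewrite Csum_O, bin_0. simpl. cring. }
  apply is_series_finite. intros n Hn. destruct n. lia. unfold bin. rewrite poch_S_l.
  unfold Cdiv. ring.
Qed.

Lemma Bf_neg1 (w : C) : (Cmod w < 1)%R -> Bf (-1) w = 1 - w.
Proof.
  intros Hw. apply CSeries_unique.
  replace (1 - w) with (sum_n (fun n => bin (-1) n * w ^ n) 1).
  2:{ rewrite Csum_Sn, Csum_O, bin_0. unfold bin. simpl. cfield. }
  apply is_series_finite. intros n Hn. destruct n. lia. destruct n. lia.
  unfold bin. rewrite poch_S_l, poch_S_l. replace (-1 + 1) with (RtoC 0) by ring.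
  unfold Cdiv. ring.
Qed.

Lemma one_minus_neq_0 (w : C) : (Cmod w < 1)%R -> 1 - w <> 0.
Proof.
  intros Hw E. assert (w = 1) by (replace w with (1 - (1 - w)) by ring; rewrite E; ring).
  subst w. rewrite Cmod_1 in Hw. lra.
Qed.

Lemma Bf_add_nat (a w : C) n : (Cmod w < 1)%R -> Bf (a + INR n) w = Bf a w / (1 - w) ^ n.
Proof.
  intros Hw. pose proof (one_minus_neq_0 w Hw) as Hn0. induction n.
  - simpl. replace (a + 0) with a by ring. field.
  - rewrite Cpow_S.
    assert (E : Bf (a + INR (S n)) w * (1 - w) = Bf (a + INR n) w).
    { rewrite <- Bf_neg1, Bf_mult by auto. f_equal. rewrite INR_S_C. ring. }
    rewrite IHn in E.
    replace (Bf (a + INR (S n)) w) with (Bf (a + INR (S n)) w * (1 - w) / (1 - w)) by (field; auto).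
    rewrite E. field. split; auto. apply Cpow_nz; auto.
Qed.

(** * Analytic continuation along segments *)

(** A sequence delayed by [n] places is what [w^n] times a power series in [w] contributes to each
    degree. *)
Lemma Csum_shifted (s : C) (b : nat -> C) n N :
  sum_n (fun q => if Nat.leb n q then s * b (q - n)%nat else RtoC 0) N =
  if Nat.leb n N then s * sum_n b (N - n) else RtoC 0.
Proof.
  induction N.
  - rewrite Csum_O. destruct n; simpl; auto. now rewrite Csum_O.
  - rewrite Csum_Sn, IHN.
    destruct (Nat.leb_spec n N).
    + rewrite (proj2 (Nat.leb_le n (S N))) by lia.
      replace (S N - n)%nat with (S (N - n)) by lia. rewrite Csum_Sn. cring.
    + destruct (Nat.leb_spec n (S N)).
      * replace (S N - n)%nat with 0%nat by lia. rewrite Csum_O. cring.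
      * cring.
Qed.

Lemma is_series_shifted (s : C) (b : nat -> C) l n :
  is_Cseries b l ->
  is_Cseries (fun q => if Nat.leb n q then s * b (q - n)%nat else RtoC 0) (s * l).
Proof.
  intros H. pose proof (is_series_C_scal s b l H) as H1.
  apply is_series_C_iff in H1. apply is_series_C_iff. intros eps He.
  destruct (H1 eps He) as [K HK]. exists (K + n)%nat. intros N HN.
  rewrite Csum_shifted, (proj2 (Nat.leb_le n N)) by lia. rewrite <- Csum_mult_l. apply HK. lia.
Qed.

Lemma Csum_shifted_Cmod (s : C) (b : nat -> C) B n N :
  (0 <= B)%R -> (forall K, (sum_n (fun k => Cmod (b k)) K <= B)%R) ->
  (sum_n (fun q => Cmod (if Nat.leb n q then s * b (q - n)%nat else RtoC 0)) N <= Cmod s * B)%R.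
Proof.
  intros HB H.
  assert (E : sum_n (fun q => Cmod (if Nat.leb n q then s * b (q - n)%nat else RtoC 0)) N =
    if Nat.leb n N then (Cmod s * sum_n (fun k => Cmod (b k)) (N - n))%R else 0%R).
  { apply RtoC_inj. rewrite RtoC_sum.
    pose proof (Csum_shifted (Cmod s) (fun k => RtoC (Cmod (b k))) n N) as E.
    rewrite (sum_n_ext _ (fun q => if Nat.leb n q then Cmod s * Cmod (b (q - n)%nat) else RtoC 0)).
    - rewrite E. destruct (Nat.leb n N); auto. rewrite RtoC_mult, RtoC_sum. reflexivity.
    - intros q. destruct (Nat.leb n q). rewrite Cmod_mult, RtoC_mult. reflexivity. now rewrite Cmod_0. }
  rewrite E. destruct (Nat.leb n N).
  - apply Rmult_le_compat_l. apply Cmod_ge_0. auto.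
  - apply Rmult_le_pos; auto. apply Cmod_ge_0.
Qed.

(** * Substituting power series into a double power series *)

Fixpoint pw (om : nat -> C) (j : nat) : nat -> C :=
  match j with
  | O => fun q => if Nat.eqb q 0 then 1 else RtoC 0
  | S j => fun q => sum_n (fun i => om i * pw om j (q - i)%nat) q
  end.

(** [pw om j] holds the coefficients of the [j]-th power of the series with coefficients [om]. The
    absolute sum at radius [r] is submultiplicative under Cauchy products. *)
Lemma pw_abs (om : nat -> C) (r B : R) : (0 <= r)%R ->
  (forall N, (sum_n (fun p => Cmod (om p) * r ^ p)%R N <= B)%R) ->
  forall j N, (sum_n (fun q => Cmod (pw om j q) * r ^ q)%R N <= B ^ j)%R.
Proof.
  intros Hr HB j.
  assert (Hpos : forall (f : nat -> C) k, (0 <= Cmod (f k) * r ^ k)%R).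
  { intros. apply Rmult_le_pos. apply Cmod_ge_0. apply pow_le; auto. }
  assert (HB0 : (0 <= B)%R).
  { eapply Rle_trans; [|apply (HB 0%nat)]. apply Rsum_nonneg. apply Hpos. }
  induction j; intros N.
  - simpl pow. induction N.
    + rewrite Rsum_O. simpl. rewrite Cmod_1. lra.
    + rewrite Rsum_Sn. replace (pw om 0 (S N)) with (RtoC 0) by reflexivity. rewrite Cmod_0. lra.
  - apply Rle_trans with (sum_n (fun q => sum_n (fun i => (Cmod (om i) * r ^ i) * (Cmod (pw om j (q - i)%nat) * r ^ (q - i)))%R q) N).
    + apply Rsum_le. intros q _. simpl pw.
      eapply Rle_trans. apply Rmult_le_compat_r. apply pow_le; auto. apply Cmod_sum_le.
      rewrite <- Rsum_mult_r.
      right. apply sum_n_ext_loc. intros i Hi. rewrite Cmod_mult.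
      replace (r ^ q)%R with (r ^ (i + (q - i)))%R by (f_equal; lia). rewrite pow_add. rring.
    + rewrite (Rsum_triangle (fun i l => (Cmod (om i) * r ^ i) * (Cmod (pw om j l) * r ^ l))%R).
      apply Rle_trans with (sum_n (fun i => (Cmod (om i) * r ^ i) * B ^ j)%R N).
      * apply Rsum_le. intros i _. rewrite Rsum_mult_l. apply Rmult_le_compat_l; auto.
      * rewrite Rsum_mult_r. simpl. apply Rmult_le_compat_r. apply pow_le; auto. auto.
Qed.

Lemma abs_le_radius (om : nat -> C) (r B : R) (h : C) : (Cmod h <= r)%R ->
  (forall N, (sum_n (fun p => Cmod (om p) * r ^ p)%R N <= B)%R) ->
  forall N, (sum_n (fun p => Cmod (om p * h ^ p)) N <= B)%R.
Proof.
  intros Hh HB N. eapply Rle_trans; [|apply (HB N)]. apply Rsum_le. intros k _.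
  rewrite Cmod_mult, Cmod_pow. apply Rmult_le_compat_l. apply Cmod_ge_0.
  apply pow_incr. split; auto. apply Cmod_ge_0.
Qed.

Lemma pw_series (om : nat -> C) (r B : R) (h phi : C) : (Cmod h <= r)%R ->
  (forall N, (sum_n (fun p => Cmod (om p) * r ^ p)%R N <= B)%R) ->
  is_Cseries (fun p => om p * h ^ p) phi ->
  forall j, is_Cseries (fun q => pw om j q * h ^ q) (phi ^ j).
Proof.
  intros Hh HB Hphi j.
  assert (Hr : (0 <= r)%R) by (eapply Rle_trans; [apply Cmod_ge_0|apply Hh]).
  induction j.
  - replace (phi ^ 0) with (sum_n (fun q => pw om 0 q * h ^ q) 0).
    apply is_series_finite. intros n Hn. destruct n. lia. simpl. ring.
    rewrite Csum_O. simpl. cring.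
  - assert (Hex : forall (f : nat -> C) X, (forall N, (sum_n (fun p => Cmod (f p) * r ^ p)%R N <= X)%R) ->
       ex_series (fun n => Cmod (f n * h ^ n))).
    { intros f X HX. apply ex_series_nonneg with X. intros; apply Cmod_ge_0.
      apply abs_le_radius with r; auto. }
    pose proof (cauchy_product _ _ _ _ Hphi IHj (Hex _ _ HB) (Hex _ _ (pw_abs om r B Hr HB j))) as H.
    apply is_series2_diag in H. eapply is_series_C_ext; [|exact H].
    intros q. simpl pw. rewrite <- Csum_mult_r. apply Csum_ext_le. intros i Hi.
    replace (h ^ q) with (h ^ (i + (q - i))) by (f_equal; lia). rewrite Cpow_add_r. cring.
Qed.

(** The number [B] takes over the role of [|psi|]: since [B < 1], the series [E] converges
    absolutely at [(|U|, B)], and this dominates the expansion of every [psi ^ j] in powers of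
    [h]. *)
Lemma subst_pw E om (r B : R) (U h psi : C) :
  subexp2 E -> (0 < r)%R -> (B < 1)%R ->
  (forall N, (sum_n (fun p => Cmod (om p) * r ^ p)%R N <= B)%R) ->
  (Cmod U < 1)%R -> (Cmod h <= r)%R -> is_Cseries (fun p => om p * h ^ p) psi ->
  is_series2 (fun m q => CSeries (fun j => E m j * pw om j q) * U ^ m * h ^ q)
    (csum2 (fun m j => E m j * U ^ m * psi ^ j)).
Proof.
  intros HE Hr HB1 HB HU Hh Hpsi.
  assert (HB0 : (0 <= B)%R).
  { eapply Rle_trans; [|apply (HB 0%nat)]. apply Rsum_nonneg. intros.
    apply Rmult_le_pos. apply Cmod_ge_0. apply pow_le; lra. }
  assert (Hpsi1 : (Cmod psi < 1)%R).
  { apply Rle_lt_trans with B; auto.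
    apply (Flim_Cmod_le eventually _ _ _ (proj1 (is_series_C_iff _ _) Hpsi)).
    apply filter_forall. intros N. eapply Rle_trans. apply Cmod_sum_le. apply abs_le_radius with r; auto. }
  assert (HU0 : (0 <= Cmod U < 1)%R) by (split; auto using Cmod_ge_0).
  assert (Hd0 : forall V : R, (0 <= V < 1)%R -> dbounded (fun m j => Cmod (E m j) * (V ^ m * B ^ j))%R).
  { intros V HV. apply subexp2_dbounded; auto. }
  assert (Hser : forall m q, is_Cseries (fun j => E m j * pw om j q) (CSeries (fun j => E m j * pw om j q))).
  { intros m q.
    (* The first variable is kept at an auxiliary radius [1/2], which is divided out again. What
       matters is that [|pw om j q|] is at most [B ^ j / r ^ q]. *)
    assert (Hhalf : (0 <= 1/2 < 1)%R) by lra.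
    pose proof (Hd0 (1/2)%R Hhalf) as Hd.
    apply dbounded_rows in Hd; [destruct Hd as [Hd _]|].
    2:{ intros. apply Rmult_le_pos. apply Cmod_ge_0. apply Rmult_le_pos; apply pow_le; lra. }
    specialize (Hd m).
    destruct (is_series_dominated (fun j => E m j * pw om j q) (fun j => / ((1/2)^m * r ^ q) * (Cmod (E m j) * ((1 / 2) ^ m * B ^ j)))%R) as [l Hl].
    - intros j. rewrite Cmod_mult.
      assert (0 < r ^ q)%R by (apply pow_lt; auto). assert (0 < (1/2) ^ m)%R by (apply pow_lt; lra).
      replace (/ ((1/2)^m * r ^ q) * (Cmod (E m j) * ((1 / 2) ^ m * B ^ j)))%R with (Cmod (E m j) * (B ^ j / r ^ q))%R by (field; lra).
      apply Rmult_le_compat_l. apply Cmod_ge_0.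
      apply Rmult_le_reg_r with (r ^ q)%R; auto.
      replace (B ^ j / r ^ q * r ^ q)%R with (B ^ j)%R by (field; lra).
      eapply Rle_trans; [|apply (pw_abs om r B (Rlt_le _ _ Hr) HB j q)].
      assert (forall k, (0 <= Cmod (pw om j k) * r ^ k)%R).
      { intros. apply Rmult_le_pos. apply Cmod_ge_0. apply pow_le; lra. }
      destruct q. rewrite Rsum_O; lra. rewrite Rsum_Sn.
      pose proof (Rsum_nonneg (fun q0 => Cmod (pw om j q0) * r ^ q0)%R q H1). lra.
    - apply (ex_series_R_scal (/ ((1/2)^m * r ^ q))). exact Hd.
    - rewrite (CSeries_unique _ _ Hl). exact Hl. }
  apply (is_series2_subst (fun m j => E m j * U ^ m) (fun j q => pw om j q * h ^ q)
    (fun j => psi ^ j) (fun j => B ^ j)%R).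
  - eapply dbounded_le; [|apply (Hd0 (Cmod U) HU0)]. intros m n. simpl.
    rewrite Cmod_mult, Cmod_pow. lra.
  - apply pw_series with r B; auto.
  - intros j. apply abs_le_radius with r; auto. apply pw_abs; auto; lra.
  - intros m q. pose proof (is_series_C_scal (U ^ m * h ^ q) _ _ (Hser m q)) as H.
    replace (CSeries (fun j => E m j * pw om j q) * U ^ m * h ^ q) with
     (U ^ m * h ^ q * CSeries (fun j => E m j * pw om j q)) by ring.
    eapply is_series_C_ext; [|exact H]. intros; simpl; ring.
  - apply subexp2_is_series2; auto.
Qed.

(** A local expansion whose absolute sum on a closed disc stays below [1]. This is more than
    convergence: it is what allows the expansion to be substituted into a series on the unit
    bidisc. *)
Definition locser (phi : C -> C) (z0 : C) : Prop :=
  exists (r B : R) (om : nat -> C), (0 < r)%R /\ (B < 1)%R /\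
    (forall N, (sum_n (fun p => Cmod (om p) * r ^ p)%R N <= B)%R) /\
    (forall h, (Cmod h <= r)%R -> is_Cseries (fun p => om p * h ^ p) (phi (z0 + h))).

Lemma locser_common phi psi u0 v0 : locser phi u0 -> locser psi v0 ->
  exists (r B1 B2 : R) (om1 om2 : nat -> C), (0 < r)%R /\ (B1 < 1)%R /\ (B2 < 1)%R /\
    (forall N, (sum_n (fun p => Cmod (om1 p) * r ^ p)%R N <= B1)%R) /\
    (forall N, (sum_n (fun p => Cmod (om2 p) * r ^ p)%R N <= B2)%R) /\
    (forall h, (Cmod h <= r)%R -> is_Cseries (fun p => om1 p * h ^ p) (phi (u0 + h))) /\
    (forall h, (Cmod h <= r)%R -> is_Cseries (fun p => om2 p * h ^ p) (psi (v0 + h))).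
Proof.
  intros [r1 [B1 [om1 [Hr1 [HB1 [H1 H1']]]]]] [r2 [B2 [om2 [Hr2 [HB2 [H2 H2']]]]]].
  pose proof (Rmin_l r1 r2). pose proof (Rmin_r r1 r2).
  assert (Hr : (0 < Rmin r1 r2)%R) by (apply Rmin_pos; auto).
  exists (Rmin r1 r2), B1, B2, om1, om2. repeat split; auto.
  - intros N. eapply Rle_trans; [|apply (H1 N)]. apply Rsum_le. intros k _.
    apply Rmult_le_compat_l. apply Cmod_ge_0. apply pow_incr. lra.
  - intros N. eapply Rle_trans; [|apply (H2 N)]. apply Rsum_le. intros k _.
    apply Rmult_le_compat_l. apply Cmod_ge_0. apply pow_incr. lra.
  - intros h Hh. apply H1'. lra.
  - intros h Hh. apply H2'. lra.
Qed.

(** The expansions are substituted one variable at a time: [psi] in the second variable, then, after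
    transposition, [phi] in the first. *)
Lemma analytic2_comp E phi psi u0 v0 : subexp2 E -> locser phi u0 -> locser psi v0 ->
  analytic2_at (fun u v => csum2 (fun m j => E m j * phi u ^ m * psi v ^ j)) u0 v0.
Proof.
  intros HE Hphi Hpsi.
  destruct (locser_common _ _ _ _ Hphi Hpsi) as [r [B1 [B2 [om1 [om2 [Hr [HB1 [HB2 [H1 [H2 [H1' H2']]]]]]]]]]].
  set (k1 := fun m q => CSeries (fun j => E m j * pw om2 j q)).
  exists r, (fun p q => CSeries (fun m => k1 m q * pw om1 m p)). split; auto.
  intros h1 h2 Hh1 Hh2.
  specialize (H1' h1 (Rlt_le _ _ Hh1)).
  pose proof (H2' h2 (Rlt_le _ _ Hh2)) as H2h.
  assert (HB0 : (0 <= B1)%R).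
  { eapply Rle_trans; [|apply (H1 0%nat)]. apply Rsum_nonneg. intros.
    apply Rmult_le_pos. apply Cmod_ge_0. apply pow_le; lra. }
  assert (HBC : (Cmod B1 < 1)%R) by (rewrite Cmod_R, Rabs_pos_eq; auto).
  assert (Hp1 : (Cmod (phi (u0 + h1)%C) < 1)%R).
  { apply Rle_lt_trans with B1; auto.
    apply (Flim_Cmod_le eventually _ _ _ (proj1 (is_series_C_iff _ _) H1')).
    apply filter_forall. intros N. eapply Rle_trans. apply Cmod_sum_le. apply abs_le_radius with r; auto. lra. }
  (* Taking [B1] itself as the value of the first variable gives the majorant required by the second
     substitution. *)
  assert (Hdb : forall h, (Cmod h <= r)%R -> dbounded (fun q m => Cmod (k1 m q * h ^ q) * B1 ^ m)%R).
  { intros h Hh.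
    pose proof (subst_pw E om2 r B2 (RtoC B1) h _ HE Hr HB2 H2 HBC Hh (H2' h Hh)) as H.
    apply is_series2_transpose in H. destruct H as [H _]. eapply dbounded_le; [|exact H].
    intros q m. simpl. fold (k1 m q). rewrite !Cmod_mult, (Cmod_pow B1), Cmod_R, (Rabs_pos_eq B1) by auto. lra. }
  assert (Hser : forall q p, is_Cseries (fun m => k1 m q * pw om1 m p) (CSeries (fun m => k1 m q * pw om1 m p))).
  { intros q p.
    (* The expansions hold on the closed disc, so [h = r] is admissible; positive powers of [r] then
       isolate a single coefficient. *)
    assert (Hrr : (Cmod r <= r)%R) by (rewrite Cmod_R, Rabs_pos_eq; lra).
    pose proof (Hdb (RtoC r) Hrr) as Hd.
    apply dbounded_rows in Hd; [destruct Hd as [Hd _]|].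
    2:{ intros. apply Rmult_le_pos. apply Cmod_ge_0. apply pow_le; lra. }
    specialize (Hd q).
    assert (0 < r ^ q)%R by (apply pow_lt; auto). assert (0 < r ^ p)%R by (apply pow_lt; auto).
    destruct (is_series_dominated (fun m => k1 m q * pw om1 m p) (fun m => / (r ^ q * r ^ p) * (Cmod (k1 m q * r ^ q) * B1 ^ m))%R) as [l Hl].
    - intros m. rewrite !Cmod_mult, Cmod_pow, Cmod_R, (Rabs_pos_eq r) by lra.
      replace (/ (r ^ q * r ^ p) * (Cmod (k1 m q) * r ^ q * B1 ^ m))%R with (Cmod (k1 m q) * (B1 ^ m / r ^ p))%R by (field; lra).
      apply Rmult_le_compat_l. apply Cmod_ge_0.
      apply Rmult_le_reg_r with (r ^ p)%R; auto.
      replace (B1 ^ m / r ^ p * r ^ p)%R with (B1 ^ m)%R by (field; lra).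
      eapply Rle_trans; [|apply (pw_abs om1 r B1 (Rlt_le _ _ Hr) H1 m p)].
      assert (Hk : forall k, (0 <= Cmod (pw om1 m k) * r ^ k)%R).
      { intros. apply Rmult_le_pos. apply Cmod_ge_0. apply pow_le; lra. }
      destruct p. rewrite Rsum_O; lra. rewrite Rsum_Sn.
      pose proof (Rsum_nonneg (fun q0 => Cmod (pw om1 m q0) * r ^ q0)%R p Hk). lra.
    - apply (ex_series_R_scal (/ (r ^ q * r ^ p))). exact Hd.
    - rewrite (CSeries_unique _ _ Hl). exact Hl. }
  apply (is_series2_transpose (fun q p => CSeries (fun m => k1 m q * pw om1 m p) * h1 ^ p * h2 ^ q)).
  apply (is_series2_subst (fun q m => k1 m q * h2 ^ q) (fun m p => pw om1 m p * h1 ^ p)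
    (fun m => phi (u0 + h1) ^ m) (fun m => B1 ^ m)%R).
  - apply Hdb. lra.
  - apply pw_series with r B1; auto. lra.
  - intros j. apply abs_le_radius with r; auto. lra. apply pw_abs; auto; lra.
  - intros q p. pose proof (is_series_C_scal (h1 ^ p * h2 ^ q) _ _ (Hser q p)) as H.
    replace (CSeries (fun m => k1 m q * pw om1 m p) * h1 ^ p * h2 ^ q) with
     (h1 ^ p * h2 ^ q * CSeries (fun m => k1 m q * pw om1 m p)) by ring.
    eapply is_series_C_ext; [|exact H]. intros; simpl; ring.
  - pose proof (subst_pw E om2 r B2 (phi (u0 + h1)) h2 _ HE Hr HB2 H2 Hp1 (Rlt_le _ _ Hh2) H2h) as H.
    apply is_series2_transpose in H. eapply is_series2_ext; [|exact H].
    intros q m. simpl. fold (k1 m q). ring.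
Qed.

Lemma locser_id z0 : (Cmod z0 < 1)%R -> locser (fun z => z) z0.
Proof.
  intros Hz. pose proof (Cmod_ge_0 z0).
  exists ((1 - Cmod z0) / 2)%R, (Cmod z0 + (1 - Cmod z0) / 2)%R,
    (fun p => match p with O => z0 | S O => RtoC 1 | _ => RtoC 0 end).
  repeat split; try lra.
  - intros N. destruct N. rewrite Rsum_O. simpl. lra.
    induction N.
    + rewrite Rsum_Sn, Rsum_O. simpl. rewrite Cmod_1. lra.
    + rewrite Rsum_Sn. rewrite Cmod_0. lra.
  - intros h Hh.
    replace (z0 + h) with (sum_n (fun p => match p with O => z0 | S O => RtoC 1 | _ => RtoC 0 end * h ^ p) 1).
    + apply is_series_finite. intros n Hn. destruct n. lia. destruct n. lia. ring.
    + rewrite Csum_Sn, Csum_O. simpl. cring.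
Qed.

Lemma is_series_C_geom (z : C) : (Cmod z < 1)%R -> is_Cseries (fun n => z ^ n) (/ (1 - z)).
Proof.
  intros Hz. pose proof (Bf_series 1 z Hz) as H.
  assert (E : Bf 1 z = / (1 - z)).
  { pose proof (one_minus_neq_0 z Hz).
    replace (RtoC 1) with (0 + INR 1) at 1 by (simpl; ring). rewrite Bf_add_nat, Bf_0 by auto. simpl. field. auto. }
  rewrite <- E. eapply is_series_C_ext; [|exact H]. intros n. simpl. unfold bin. rewrite poch_1.
  field. apply INR_fact_C_neq.
Qed.

(** On the half plane [Re v < 1/2] the Pfaff variable [v / (v - 1)] lies in the unit disc. The half
    plane contains the negative axis, where the kernel is evaluated. *)
Lemma Re_lt_half_Cmod (v : C) : (Re v < 1 / 2)%R -> (Cmod v < Cmod (1 - v)%C)%R.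
Proof.
  intros H. unfold Cmod. apply sqrt_lt_1.
  - apply Rplus_le_le_0_compat; apply pow2_ge_0.
  - apply Rplus_le_le_0_compat; apply pow2_ge_0.
  - destruct v as [x y]. unfold Re in H. simpl in *. nra.
Qed.

Lemma Re_lt_half_neq (v : C) : (Re v < 1 / 2)%R -> 1 - v <> 0.
Proof.
  intros H E. pose proof (Re_lt_half_Cmod v H) as H1. rewrite E, Cmod_0 in H1.
  pose proof (Cmod_ge_0 v). lra.
Qed.

(** With [q = 1 / (1 - z0)] one has [z / (z - 1) = 1 - q / (1 - q h)] at [z = z0 + h], a geometric
    series with constant term [1 - q = z0 / (z0 - 1)]. *)
Lemma locser_pfaff z0 : (Re z0 < 1 / 2)%R -> locser (fun z => z / (z - 1)) z0.
Proof.
  intros Hz. pose proof (Re_lt_half_neq z0 Hz) as Hn.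
  set (q := / (1 - z0)).
  assert (Hq : (0 < Cmod q)%R). { unfold q. rewrite Cmod_inv by auto. apply Rinv_0_lt_compat. exact (proj1 (Cmod_gt_0 _) Hn). }
  assert (Hw : (Cmod (1 - q)%C < 1)%R).
  { replace (1 - q) with (- (z0 / (1 - z0))) by (unfold q; field; auto).
    rewrite Cmod_opp, Cmod_div by auto.
    apply Rmult_lt_reg_r with (Cmod (1 - z0)%C). exact (proj1 (Cmod_gt_0 _) Hn).
    pose proof (Re_lt_half_Cmod z0 Hz). pose proof (proj1 (Cmod_gt_0 _) Hn).
    field_simplify; lra. }
  (* Here [s = |q| r]. As [s <= 1/2], the powers from [s ^ 1] on sum to at most [2 s]; the second
     bound makes [|1 - q| + 2 |q| s] at most the midpoint between [|1 - q|] and [1]. *)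
  set (s := Rmin (1 / 2) ((1 - Cmod (1 - q)%C) / (4 * Cmod q))).
  assert (Hs : (0 < s)%R). { apply Rmin_pos. lra. apply Rdiv_lt_0_compat; lra. }
  assert (Hs1 : (s <= 1 / 2)%R) by apply Rmin_l.
  assert (Hs2 : (Cmod q * s * 2 <= (1 - Cmod (1 - q)%C) / 2)%R).
  { assert (Hs2 : (s <= (1 - Cmod (1 - q)%C) / (4 * Cmod q))%R) by apply Rmin_r.
    apply Rmult_le_compat_l with (r := (Cmod q * 2)%R) in Hs2; [|lra].
    replace (Cmod q * 2 * ((1 - Cmod (1 - q)%C) / (4 * Cmod q)))%R with ((1 - Cmod (1 - q)%C) / 2)%R in Hs2 by (field; lra).
    lra. }
  exists (s / Cmod q)%R, (Cmod (1 - q)%C + Cmod q * s * 2)%R,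
    (fun p => match p with O => (1 - q)%C | S i => (- (q * q ^ S i))%C end).
  repeat split.
  - apply Rdiv_lt_0_compat; auto.
  - lra.
  - intros N.
    assert (HN : forall N, (sum_n (fun i => s ^ S i)%R N <= 2 * s)%R).
    { intros M. simpl. rewrite Rsum_mult_l. rewrite (Rmult_comm 2). apply Rmult_le_compat_l; [lra|].
      assert (Hg : (Rabs s < 1)%R) by (rewrite Rabs_pos_eq; lra).
      apply Rle_trans with (Series (fun n => s ^ n)%R).
      apply sum_le_Series. intros; apply pow_le; lra. apply ex_series_geom; auto.
      rewrite Series_geom by auto. apply Rmult_le_reg_r with (1 - s)%R. lra. field_simplify; lra. }
    assert (Hcs : forall i, (Cmod (- (q * q ^ S i))%C * (s / Cmod q) ^ S i = Cmod q * s ^ S i)%R).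
    { intros i. rewrite Cmod_opp, Cmod_mult, Cmod_pow. unfold Rdiv. rewrite Rpow_mult_distr, pow_inv.
      field. apply pow_nonzero. lra. }
    destruct N.
    + rewrite Rsum_O. simpl. nra.
    + induction N.
      * rewrite Rsum_Sn, Rsum_O, Hcs. specialize (HN 0%nat). rewrite Rsum_O in HN. simpl in *. nra.
      * clear IHN.
        assert (E : forall M, sum_n (fun p => Cmod (match p with O => (1 - q)%C | S i => (- (q * q ^ S i))%C end) * (s / Cmod q) ^ p)%R (S M) = (Cmod (1 - q)%C + Cmod q * sum_n (fun i => s ^ S i)%R M)%R).
        { induction M. rewrite Rsum_Sn, !Rsum_O, Hcs. simpl; rring.
          rewrite Rsum_Sn, IHM, Hcs, (Rsum_Sn (fun i => s ^ S i)%R M). rring. }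
        rewrite E. specialize (HN (S N)). nra.
  - intros h Hh.
    assert (Hqh : (Cmod (q * h)%C < 1)%R).
    { rewrite Cmod_mult. apply Rmult_le_compat_l with (r := Cmod q) in Hh; [|lra].
      replace (Cmod q * (s / Cmod q))%R with s in Hh by (field; lra). lra. }
    pose proof (one_minus_neq_0 _ Hqh) as Hqn.
    pose proof (is_series_C_plus _ _ _ _ (is_series_finite (fun p => match p with O => RtoC 1 | _ => RtoC 0 end) 0 ltac:(intros [|n0] Hn0; [lia|reflexivity]))
      (is_series_C_scal (- q) _ _ (is_series_C_geom _ Hqh))) as H.
    rewrite Csum_O in H.
    assert (Hd : 1 - (z0 + h) <> 0).
    { replace (1 - (z0 + h)) with ((1 - z0) * (1 - q * h)) by (unfold q; field; auto). apply Cmult_neq_0; auto. }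
    assert (Hd' : z0 + h - 1 <> 0).
    { intros E. apply Hd. replace (1 - (z0 + h)) with (- (z0 + h - 1)) by ring. rewrite E. ring. }
    replace ((z0 + h) / (z0 + h - 1)) with (1 + - q * / (1 - q * h)).
    + eapply is_series_C_ext; [|exact H]. intros n. destruct n.
      * simpl. ring.
      * rewrite Cpow_mult_l. ring.
    + replace (1 - q * h) with ((1 - (z0 + h)) * q) by (unfold q; field; auto).
      unfold q. field. repeat split; auto.
Qed.

(** * The identity theorem along a segment *)

Lemma analytic2_line G (u v : C) (s0 : R) : analytic2_at G (s0 * u) (s0 * v) ->
  exists (d : R) (c : nat -> C), (0 < d)%R /\ forall tau : R, (Rabs tau < d)%R ->
    is_Cseries (fun N => c N * RtoC tau ^ N) (G ((s0 + tau)%R * u) ((s0 + tau)%R * v)).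
Proof.
  intros [r [k [Hr H]]].
  pose proof (Cmod_ge_0 u). pose proof (Cmod_ge_0 v).
  exists (r / (Cmod u + Cmod v + 1))%R, (fun N => sum_n (fun m => k m (N - m)%nat * u ^ m * v ^ (N - m)) N).
  split. apply Rdiv_lt_0_compat; lra.
  intros tau Ht.
  assert (Hb : (Rabs tau * (Cmod u + Cmod v + 1) < r)%R).
  { apply Rmult_lt_compat_r with (r := (Cmod u + Cmod v + 1)%R) in Ht; [|lra].
    replace (r / (Cmod u + Cmod v + 1) * (Cmod u + Cmod v + 1))%R with r in Ht by (field; lra). exact Ht. }
  pose proof (Rabs_pos tau).
  assert (Hu : (Cmod (tau * u)%C < r)%R) by (rewrite Cmod_mult, Cmod_R; nra).
  assert (Hv : (Cmod (tau * v)%C < r)%R) by (rewrite Cmod_mult, Cmod_R; nra).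
  specialize (H _ _ Hu Hv).
  replace (s0 * u + tau * u) with ((s0 + tau)%R * u) in H by (rewrite RtoC_plus; ring).
  replace (s0 * v + tau * v) with ((s0 + tau)%R * v) in H by (rewrite RtoC_plus; ring).
  apply is_series2_diag in H. eapply is_series_C_ext; [|exact H].
  intros N. simpl. rewrite <- Csum_mult_r. apply Csum_ext_le. intros m Hm.
  replace (RtoC tau ^ N) with (RtoC tau ^ (m + (N - m))) by (f_equal; lia).
  rewrite Cpow_add_r, !Cpow_mult_l. cring.
Qed.

Lemma is_series_terms_bounded (a : nat -> C) l : is_Cseries a l ->
  exists M, (0 < M)%R /\ forall n, (Cmod (a n) <= M)%R.
Proof.
  intros H.
  destruct (filterlim_bounded (K := C_AbsRing) (V := C_NormedModule) (sum_n a)) as [M HM].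
  { exists l. exact H. }
  assert (HM' : forall n, (Cmod (sum_n a n) <= M)%R) by exact HM.
  exists (2 * M + 1)%R.
  assert (0 <= M)%R by (eapply Rle_trans; [apply Cmod_ge_0|apply (HM' 0%nat)]).
  split. lra.
  intros n. destruct n.
  - specialize (HM' 0%nat). rewrite Csum_O in HM'. lra.
  - pose proof (HM' n). pose proof (HM' (S n)).
    replace (a (S n)) with (sum_n a (S n) + - sum_n a n) by (rewrite Csum_Sn; cring).
    eapply Rle_trans. apply Cmod_triangle. rewrite Cmod_opp. lra.
Qed.

(** Vanishing on the left of the centre suffices to annihilate all coefficients. If those before [N]
    vanish, dividing by [tau ^ N] and letting negative [tau] tend to [0] gives [c N = 0]. *)
Lemma power_series_identity (c : nat -> C) (f : R -> C) (d : R) : (0 < d)%R ->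
  (forall tau : R, (Rabs tau < d)%R -> is_Cseries (fun N => c N * RtoC tau ^ N) (f tau)) ->
  (forall tau : R, (- d < tau < 0)%R -> f tau = 0) ->
  forall tau : R, (Rabs tau < d)%R -> f tau = 0.
Proof.
  intros Hd Hc Hf.
  assert (Hall : forall N i, (i < N)%nat -> c i = 0).
  { induction N; intros i Hi. lia.
    destruct (Nat.eq_dec i N) as [->|Hne]; [|apply IHN; lia].
    assert (Hd2 : (Rabs (d / 2) < d)%R) by (rewrite Rabs_pos_eq; lra).
    destruct (is_series_terms_bounded _ _ (Hc _ Hd2)) as [M [HM HMb]].
    (* These points stay within [d / 4], half the radius at which the terms are bounded by [M]; the
       shifted series thus has a geometric majorant of ratio [1/2]. *)
    set (t := fun n : nat => (- (d / 4) / INR (S n))%R).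
    assert (Ht : forall n, (- d < t n < 0 /\ Rabs (t n) <= d / 4)%R).
    { intros n. unfold t. assert (1 <= INR (S n))%R by (rewrite S_INR; pose proof (pos_INR n); lra).
      assert (Hx : (0 < d / 4 / INR (S n) <= d / 4)%R).
      { split. apply Rdiv_lt_0_compat; lra. apply Rmult_le_reg_r with (INR (S n)). lra.
        replace (d / 4 / INR (S n) * INR (S n))%R with (d / 4)%R by (field; lra). nra. }
      replace (- (d / 4) / INR (S n))%R with (- (d / 4 / INR (S n)))%R by (field; lra).
      rewrite Rabs_Ropp, Rabs_pos_eq by lra. lra. }
    assert (Hl : Flim eventually (fun _ : nat => RtoC 0) (c N)).
    { apply (tannery eventually (fun n k => c (N + k)%nat * RtoC (t n) ^ k)
        (fun k => M * (2 / d) ^ N * (1 / 2) ^ k)%R (fun k => match k with O => c N | _ => RtoC 0 end)).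
      - apply filter_forall. intros n k. rewrite Cmod_mult, Cmod_pow, Cmod_R.
        specialize (HMb (N + k)%nat). rewrite Cmod_mult, Cmod_pow, Cmod_R, (Rabs_pos_eq (d/2)) in HMb by lra.
        assert (Hp : (Rabs (t n) ^ k <= (d / 4) ^ k)%R).
        { apply pow_incr. split. apply Rabs_pos. apply Ht. }
        eapply Rle_trans. apply Rmult_le_compat_l. apply Cmod_ge_0. exact Hp.
        replace (d / 4)%R with ((d / 2) * (1 / 2))%R by field. rewrite Rpow_mult_distr, <- Rmult_assoc.
        apply Rmult_le_compat_r. apply pow_le; lra.
        rewrite pow_add in HMb.
        apply Rmult_le_reg_r with ((d / 2) ^ N)%R. apply pow_lt; lra.
        replace (M * (2 / d) ^ N * (d / 2) ^ N)%R with M.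
        lra. rewrite Rmult_assoc, <- Rpow_mult_distr. replace (2 / d * (d / 2))%R with 1%R by (field; lra).
        rewrite pow1. ring.
      - apply (ex_series_R_scal (M * (2 / d) ^ N)). apply ex_series_geom. rewrite Rabs_pos_eq; lra.
      - intros k. destruct k.
        + apply (Flim_ext_ev _ (fun _ => c N)). apply filter_forall. intros n. rewrite Nat.add_0_r. simpl. ring.
          apply (Flim_const eventually).
        + replace (RtoC 0) with (c (N + S k)%nat * 0 ^ S k) by (simpl; ring).
          apply (Flim_mult eventually). apply (Flim_const eventually). apply (Flim_pow eventually).
          replace (RtoC 0) with (RtoC (- (d / 4)) * 0) by ring.
          apply (Flim_ext_ev eventually (fun n => RtoC (- (d / 4)) * RtoC (/ INR (S n)))).
          { apply filter_forall. intros n. unfold t, Rdiv. rewrite <- RtoC_mult. reflexivity. }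
          apply (Flim_mult eventually). apply (Flim_const eventually).
          intros eps He. destruct (Flim_inv_INR eps He) as [K HK]. exists K. intros n Hn. apply HK. lia.
      - apply filter_forall. intros n. destruct (Ht n) as [Htn Htn2].
        assert (Htd : (Rabs (t n) < d)%R) by lra.
        pose proof (Hc (t n) Htd) as Hs. rewrite (Hf (t n) Htn) in Hs.
        assert (Htz : RtoC (t n) <> 0) by (intros E; apply RtoC_inj in E; lra).
        apply is_series_C_iff in Hs. apply is_series_C_iff.
        pose proof (Flim_mult eventually _ _ _ _ (Flim_const eventually (/ RtoC (t n) ^ N)) Hs) as Hs2.
        rewrite Cmult_0_r in Hs2. intros eps He. destruct (Hs2 eps He) as [K HK].
        exists K. intros n' Hn'.
        replace (sum_n (fun k => c (N + k)%nat * RtoC (t n) ^ k) n') with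
          (/ RtoC (t n) ^ N * sum_n (fun i => c i * RtoC (t n) ^ i) (N + n')%nat).
        apply HK. lia.
        assert (Hp : RtoC (t n) ^ N <> 0) by (apply Cpow_nz; auto).
        assert (E : sum_n (fun i => c i * RtoC (t n) ^ i) (N + n')%nat =
          RtoC (t n) ^ N * sum_n (fun k => c (N + k)%nat * RtoC (t n) ^ k) n').
        { clear - IHN. induction n'.
          - rewrite Nat.add_0_r, Csum_O, Nat.add_0_r. simpl.
            destruct N.
            + rewrite Csum_O. simpl. cring.
            + rewrite Csum_Sn.
              rewrite (Csum_ext_le _ (fun _ => RtoC 0 * RtoC 0)).
              rewrite Csum_mult_l. cring.
              intros j Hj. rewrite IHN by lia. ring.
          - rewrite Nat.add_succ_r, !Csum_Sn, IHn', Nat.add_succ_r.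
            replace (S (N + n')) with (N + S n')%nat by lia. rewrite Cpow_add_r. cring. }
        rewrite E. cfield. auto.
      - replace (c N) with (sum_n (fun k => match k with O => c N | _ => RtoC 0 end) 0) by (now rewrite Csum_O).
        rewrite Csum_O. 
        pose proof (is_series_finite (fun k => match k with O => c N | _ => RtoC 0 end) 0) as Hfin.
        rewrite Csum_O in Hfin. apply Hfin. intros k Hk. destruct k; [lia|reflexivity]. }
    exact (Flim_unique _ _ _ Hl (Flim_const eventually 0)). }
  intros tau Ht. apply (is_series_C_unique _ _ _ (Hc tau Ht)).
  eapply is_series_C_ext; [|apply is_series_zero].
  intros n. simpl. rewrite (Hall (S n) n) by lia. ring.
Qed.

(** Let [m] be the supremum of the parameters up to which the two functions agree. The expansion of
    their difference at [m] vanishes on the left, hence on the right as well, so [m] cannot be below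
    [1]. *)
Lemma analytic2_segment_unique (G1 G2 : C -> C -> C) (u v : C) (d0 : R) :
  (forall s : R, (0 <= s <= 1)%R -> analytic2_at G1 (s * u) (s * v)) ->
  (forall s : R, (0 <= s <= 1)%R -> analytic2_at G2 (s * u) (s * v)) ->
  (0 < d0 <= 1)%R ->
  (forall s : R, (0 <= s <= d0)%R -> G1 (s * u) (s * v) = G2 (s * u) (s * v)) ->
  G1 u v = G2 u v.
Proof.
  intros H1 H2 Hd0 H0.
  set (D := fun s : R => G1 (s * u) (s * v) - G2 (s * u) (s * v)).
  set (E := fun s : R => (0 <= s <= 1)%R /\ forall t, (0 <= t <= s)%R -> D t = 0).
  assert (HE0 : E d0).
  { split. lra. intros t Ht. unfold D. rewrite H0 by auto. ring. }
  destruct (completeness E) as [m [Hub Hlub]].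
  { exists 1%R. intros s [Hs _]. lra. }
  { exists d0; auto. }
  assert (Hm0 : (d0 <= m)%R) by (apply Hub; auto).
  assert (Hm1 : (m <= 1)%R) by (apply Hlub; intros s [Hs _]; lra).
  assert (Hbelow : forall t, (0 <= t < m)%R -> D t = 0).
  { intros t Ht. destruct (Classical_Prop.classic (D t = 0)) as [|Hn]; auto. exfalso.
    assert (m <= t)%R; [|lra]. apply Hlub. intros s [Hs1 Hs2].
    destruct (Rle_lt_dec s t); auto. exfalso. apply Hn, Hs2. lra. }
  assert (Hm01 : (0 <= m <= 1)%R) by lra.
  destruct (analytic2_line G1 u v m (H1 m Hm01)) as [e1 [c1 [He1 Hc1]]].
  destruct (analytic2_line G2 u v m (H2 m Hm01)) as [e2 [c2 [He2 Hc2]]].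
  (* [e <= m] keeps [m + tau] nonnegative for negative [tau], where agreement is known. *)
  set (e := Rmin m (Rmin e1 e2)).
  assert (He : (0 < e)%R) by (repeat apply Rmin_pos; lra).
  assert (Hem : (e <= m)%R) by apply Rmin_l.
  assert (Hee1 : (e <= e1)%R) by (eapply Rle_trans; [apply Rmin_r|apply Rmin_l]).
  assert (Hee2 : (e <= e2)%R) by (eapply Rle_trans; [apply Rmin_r|apply Rmin_r]).
  assert (Hz : forall tau, (Rabs tau < e)%R -> D (m + tau)%R = 0).
  { apply (power_series_identity (fun N => c1 N - c2 N) (fun tau => D (m + tau)%R) e He).
    - intros tau Ht.
      pose proof (is_series_C_plus _ _ _ _ (Hc1 tau ltac:(lra)) (is_series_C_scal (-1) _ _ (Hc2 tau ltac:(lra)))) as H.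
      unfold D. replace (G1 ((m + tau)%R * u) ((m + tau)%R * v) - G2 ((m + tau)%R * u) ((m + tau)%R * v)) with
       (G1 ((m + tau)%R * u) ((m + tau)%R * v) + -1 * G2 ((m + tau)%R * u) ((m + tau)%R * v)) by ring.
      eapply is_series_C_ext; [|exact H]. intros n; simpl; ring.
    - intros tau Ht. apply Hbelow. lra. }
  assert (HD : forall t, (0 <= t < m + e)%R -> D t = 0).
  { intros t Ht. destruct (Rlt_le_dec t m). apply Hbelow; lra.
    replace t with (m + (t - m))%R by ring. apply Hz. rewrite Rabs_pos_eq; lra. }
  assert (Hm : m = 1%R).
  { apply Rle_antisym; auto. destruct (Rle_lt_dec 1 m) as [|Hlt]; auto. exfalso.
    assert (HE : E (Rmin 1 (m + e / 2))).
    { pose proof (Rmin_l 1 (m + e/2)). pose proof (Rmin_r 1 (m + e/2)).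
      split. split; auto. apply Rmin_glb; lra. intros t Ht. apply HD. lra. }
    apply Hub in HE. assert (m < Rmin 1 (m + e / 2))%R by (apply Rmin_glb_lt; lra). lra. }
  assert (HD1 : D 1%R = 0) by (apply HD; lra).
  unfold D in HD1. rewrite !Cmult_1_l in HD1.
  replace (G1 u v) with (G1 u v - G2 u v + G2 u v) by ring. rewrite HD1. ring.
Qed.

(** * The analytic continuation of F3 along [(1 - u) (1 - v) = 1] *)

Definition fcoef (a a' b b' c : C) (m n : nat) : C :=
  pochhammer a m * pochhammer a' n * pochhammer b m * pochhammer b' n
  / (pochhammer c (m + n) * INR (fact m) * INR (fact n)).

(* Pfaff's transformation in [v] turns [F3] into [(1 - v)^(-a')] times the
   series with these coefficients in [u] and [w = v / (v - 1)]. *)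
Definition dcoef (a a' b b' c : C) (m n : nat) : C :=
  pochhammer a m * pochhammer b m * pochhammer a' n * pochhammer (c - b' + INR m) n
  / (pochhammer c (m + n) * INR (fact m) * INR (fact n)).

(** Convolution with [bin (- a')] multiplies the series in [w] by [(1 - w)^(a')], which is Pfaff's
    prefactor [(1 - v)^(-a')]. No complex power of [1 - v] has to be continued. *)
Definition ecoef (a a' b b' c : C) (m j : nat) : C :=
  sum_n (fun n => dcoef a a' b b' c m n * bin (- a') (j - n)) j.

Section F3.

Context (a a' b b' c : C).
Context (Hc : (0 < Re c)%R).

Lemma Re_c_plus m : (0 < Re (c + INR m))%R.
Proof. rewrite Re_plus_INR. pose proof (pos_INR m). lra. Qed.

Lemma Cmod_c_plus m j : (Re c + INR j <= Cmod (c + INR m + INR j)%C)%R.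
Proof.
  eapply Rle_trans; [|apply Re_le_Cmod]. rewrite Re_plus_INR, Re_plus_INR.
  pose proof (pos_INR m). lra.
Qed.

Lemma fcoef_factor m n : fcoef a a' b b' c m n =
  bin a m * (pochhammer b m / pochhammer c m) * bin a' n *
  (pochhammer b' n / pochhammer (c + INR m) n).
Proof.
  pose proof (Re_c_plus m).
  unfold fcoef, bin. rewrite poch_add. field. nz.
Qed.

Lemma dcoef_factor m n : dcoef a a' b b' c m n =
  bin a m * (pochhammer b m / pochhammer c m) * bin a' n *
  (pochhammer (c - b' + INR m) n / pochhammer (c + INR m) n).
Proof.
  pose proof (Re_c_plus m).
  unfold dcoef, bin. rewrite poch_add. field. nz.
Qed.

Lemma subexp2_bin_l (x : C) : subexp2 (fun m _ => bin x m).
Proof.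
  apply subexp2_l with (Cmod x) 1%R; auto using Cmod_ge_0. lra. intros; apply Cmod_bin_le.
Qed.

Lemma subexp2_bin_r (x : C) : subexp2 (fun _ n => bin x n).
Proof.
  apply subexp2_r with (Cmod x) 1%R; auto using Cmod_ge_0. lra. intros; apply Cmod_bin_le.
Qed.

Lemma subexp2_ext (k1 k2 : nat -> nat -> C) :
  (forall m n, k1 m n = k2 m n) -> subexp2 k1 -> subexp2 k2.
Proof.
  intros E H q Hq. destruct (H q Hq) as [K [HK HH]]. exists K. split; auto.
  intros. rewrite <- E. auto.
Qed.

Lemma subexp2_bc : subexp2 (fun m _ => pochhammer b m / pochhammer c m).
Proof.
  apply subexp2_l with (Cmod b) (Re c); auto using Cmod_ge_0. intros; apply Cmod_poch_quot_Re; auto.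
Qed.

Lemma subexp2_fcoef : subexp2 (fcoef a a' b b' c).
Proof.
  eapply subexp2_ext; [intros m n; symmetry; apply fcoef_factor|].
  apply (subexp2_mult (fun m n => bin a m * (pochhammer b m / pochhammer c m) * bin a' n)).
  - apply (subexp2_mult (fun m n => bin a m * (pochhammer b m / pochhammer c m))).
    apply (subexp2_mult (fun m n => bin a m)). apply subexp2_bin_l. apply subexp2_bc. apply subexp2_bin_r.
  - apply subexp2_r with (Cmod b') (Re c); auto using Cmod_ge_0. intros m n.
    apply Cmod_poch_quot; auto using Cmod_ge_0.
    + intros j. pose proof (Cmod_c_plus m j). pose proof (Cmod_plus_INR b' j).
      pose proof (Cmod_ge_0 (b' + INR j)). pose proof (pos_INR j). pose proof (Cmod_ge_0 b').
      rewrite (Rmult_comm (Cmod (c + INR m + INR j))). apply Rmult_le_compat; lra.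
    + intros j. pose proof (Cmod_c_plus m j). pose proof (pos_INR j). lra.
Qed.

Lemma subexp2_dcoef : subexp2 (dcoef a a' b b' c).
Proof.
  eapply subexp2_ext; [intros m n; symmetry; apply dcoef_factor|].
  apply (subexp2_mult (fun m n => bin a m * (pochhammer b m / pochhammer c m) * bin a' n)).
  - apply (subexp2_mult (fun m n => bin a m * (pochhammer b m / pochhammer c m))).
    apply (subexp2_mult (fun m n => bin a m)). apply subexp2_bin_l. apply subexp2_bc. apply subexp2_bin_r.
  - pose proof (Cmod_ge_0 b').
    (* From [|c - b' + m + j| <= |c + m + j| + |b'|] and [|c + m + j| >= Re c + j], each factor is
       at most [1 + |b'| / (Re c + j)], uniformly in [m]. *)
    apply subexp2_r with (Re c + Cmod b')%R (Re c); auto. lra. intros m n.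
    apply Cmod_poch_quot; auto. lra.
    + intros j. pose proof (Cmod_c_plus m j). pose proof (pos_INR j).
      assert (Cmod (c - b' + INR m + INR j)%C <= Cmod (c + INR m + INR j)%C + Cmod b')%R.
      { replace (c - b' + INR m + INR j) with (c + INR m + INR j + - b') by ring.
        eapply Rle_trans. apply Cmod_triangle. rewrite Cmod_opp. lra. }
      nra.
    + intros j. pose proof (Cmod_c_plus m j). pose proof (pos_INR j). lra.
Qed.

(** With [s = sqrt q] each of the [j + 1] summands is at most [K1 K2 s^m s^j]. By Bernoulli's
    inequality [j + 1] is at most a constant times [s^j], which uses up the rest of [q^j]. *)
Lemma subexp2_conv (k : nat -> nat -> C) (beta : nat -> C) :
  subexp2 k -> subexp2 (fun _ n => beta n) ->
  subexp2 (fun m j => sum_n (fun n => k m n * beta (j - n)%nat) j).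
Proof.
  intros H1 H2 q Hq.
  assert (Hs : (1 < sqrt q)%R). { rewrite <- sqrt_1. apply sqrt_lt_1; lra. }
  assert (Hss : (sqrt q * sqrt q = q)%R) by (apply sqrt_sqrt; lra).
  set (s := sqrt q) in *.
  destruct (H1 _ Hs) as [K1 [HK1 HH1]]. destruct (H2 _ Hs) as [K2 [HK2 HH2]].
  assert (Hi : (0 < / (s - 1))%R) by (apply Rinv_0_lt_compat; lra).
  assert (Hjb : forall j, (INR (S j) <= (1 + / (s - 1)) * s ^ j)%R).
  { intros j. assert (Hb : (1 + INR j * (s - 1) <= s ^ j)%R).
    { induction j. simpl; lra. rewrite S_INR. simpl (s ^ S j)%R. pose proof (pos_INR j).
      assert (0 <= INR j * (s - 1) * (s - 1))%R by (repeat apply Rmult_le_pos; lra). nra. }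
    apply Rle_trans with ((1 + / (s - 1)) * (1 + INR j * (s - 1)))%R.
    - rewrite S_INR. replace ((1 + / (s - 1)) * (1 + INR j * (s - 1)))%R with (1 + INR j + (/ (s - 1) + INR j * (s - 1)))%R by (field; lra).
      assert (0 <= INR j * (s - 1))%R by (apply Rmult_le_pos; [apply pos_INR|lra]). lra.
    - apply Rmult_le_compat_l; lra. }
  exists (K1 * K2 * (1 + / (s - 1)))%R. split.
  apply Rmult_lt_0_compat; nra.
  intros m j.
  assert (Hsm : (0 < s ^ m)%R) by (apply pow_lt; lra).
  assert (Hsm1 : (1 <= s ^ m)%R) by (apply pow_R1_Rle; lra).
  assert (Hsj : (0 < s ^ j)%R) by (apply pow_lt; lra).
  eapply Rle_trans. apply Cmod_sum_le.
  apply Rle_trans with (sum_n (fun _ => K1 * K2 * (s ^ m * s ^ j))%R j).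
  - apply Rsum_le. intros n Hn. rewrite Cmod_mult.
    apply Rle_trans with ((K1 * (s ^ m * s ^ n)) * (K2 * (s ^ 0 * s ^ (j - n))))%R.
    + apply Rmult_le_compat; auto using Cmod_ge_0.
    + right. replace (s ^ j)%R with (s ^ (n + (j - n)))%R by (f_equal; lia). rewrite pow_add. simpl. ring.
  - rewrite sum_n_const. rewrite <- Hss, !Rpow_mult_distr.
    apply Rle_trans with ((1 + / (s - 1)) * s ^ j * (K1 * K2 * (s ^ m * s ^ j)))%R.
    + apply Rmult_le_compat_r; auto. apply Rmult_le_pos; nra.
    + replace (K1 * K2 * (1 + / (s - 1)) * (s ^ m * s ^ m * (s ^ j * s ^ j)))%R with
       ((1 + / (s - 1)) * s ^ j * (K1 * K2 * (s ^ m * s ^ j)) * s ^ m)%R by ring.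
      rewrite <- (Rmult_1_r ((1 + / (s - 1)) * s ^ j * (K1 * K2 * (s ^ m * s ^ j)))) at 1.
      apply Rmult_le_compat_l; auto.
      assert (0 < K1 * K2)%R by nra. assert (0 < s ^ m * s ^ j)%R by nra.
      repeat apply Rmult_le_pos; lra.
Qed.

Lemma subexp2_ecoef : subexp2 (ecoef a a' b b' c).
Proof. apply subexp2_conv. apply subexp2_dcoef. apply subexp2_bin_r. Qed.

(** Since [v^n (1 - w)^(-a') = (-w)^n (1 - w)^(-a' - n)], the left side is the coefficient of [w^N]
    after the change of variable. It is summed by Chu-Vandermonde with parameters [b'] and
    [c + m]. *)
Lemma dcoef_sum m N :
  sum_n (fun n => fcoef a a' b b' c m n * ((-1) ^ n * bin (a' + INR n) (N - n))) N =
  dcoef a a' b b' c m N.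
Proof.
  rewrite dcoef_factor. pose proof (Re_c_plus m) as Hcm.
  replace (c - b' + INR m) with (c + INR m - b') by ring.
  assert (E : pochhammer (c + INR m - b') N / pochhammer (c + INR m) N =
     INR (fact N) * (bin (c + INR m - b') N / pochhammer (c + INR m) N)).
  { unfold bin. field. nz. }
  rewrite E, <- chu_vandermonde by auto. rewrite <- !Csum_mult_l. apply Csum_ext_le.
  intros n Hn. rewrite fcoef_factor. unfold bin.
  replace (pochhammer a' N) with (pochhammer a' n * pochhammer (a' + INR n) (N - n)).
  cfield; nz. rewrite <- poch_add. f_equal. lia.
Qed.

Lemma bin_abs_le (x : C) (n k : nat) :
  (Cmod (bin (x + INR n) k) <= Re (bin (Cmod x + INR n) k))%R.
Proof.
  induction k.
  - rewrite !bin_0, Cmod_1. simpl. lra.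
  - assert (HS : (0 < INR (S k))%R) by (rewrite S_INR; pose proof (pos_INR k); lra).
    apply Rmult_le_reg_l with (INR (S k)); auto.
    assert (E1 : (INR (S k) * Cmod (bin (x + INR n) (S k)) = Cmod (x + INR n + INR k)%C * Cmod (bin (x + INR n) k))%R).
    { rewrite <- Cmod_mult, <- bin_S, Cmod_mult, Cmod_INR. reflexivity. }
    assert (E2 : (INR (S k) * Re (bin (Cmod x + INR n) (S k)) = (Cmod x + INR n + INR k) * Re (bin (Cmod x + INR n) k))%R).
    { transitivity (Re (INR (S k) * bin (Cmod x + INR n) (S k))).
      - unfold Re. simpl. ring.
      - rewrite bin_S, <- !RtoC_plus. unfold Re. simpl. ring. }
    rewrite E1, E2. apply Rmult_le_compat; auto using Cmod_ge_0.
    eapply Rle_trans. apply Cmod_plus_INR. apply Rplus_le_compat_r. apply Cmod_plus_INR.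
Qed.

(** Replacing [x] and [w] by their moduli gives a positive series with sum [(1 - |w|)^(-|x| - n)].
    The dependence on [n] is explicit because [n] is summed over afterwards. *)
Lemma bin_abs_sum (x w : C) (n N : nat) : (Cmod w < 1)%R ->
  (sum_n (fun k => Cmod (bin (x + INR n) k * w ^ k)) N <=
   Re (Bf (Cmod x) (Cmod w)) / (1 - Cmod w) ^ n)%R.
Proof.
  intros Hw. pose proof (Cmod_ge_0 w) as Hw0.
  assert (HW : (Cmod (Cmod w) < 1)%R) by (rewrite Cmod_R, Rabs_pos_eq; auto).
  pose proof (is_series_Re _ _ (Bf_series (Cmod x + INR n) (Cmod w) HW)) as Hs.
  rewrite Bf_add_nat in Hs by auto.
  replace (Re (Bf (Cmod x) (Cmod w) / (1 - Cmod w) ^ n)) with (Re (Bf (Cmod x) (Cmod w)) / (1 - Cmod w) ^ n)%R in Hs.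
  2:{ rewrite <- RtoC_minus, <- RtoC_pow. unfold Cdiv. rewrite <- RtoC_inv. unfold Re. simpl. field.
      all: apply pow_nonzero; lra. }
  assert (Hp : forall k, (Cmod (bin (x + INR n) k * w ^ k) <= Re (bin (Cmod x + INR n) k * RtoC (Cmod w) ^ k))%R).
  { intros k. rewrite Cmod_mult, Cmod_pow, <- RtoC_pow.
    replace (Re (bin (Cmod x + INR n) k * RtoC (Cmod w ^ k))) with (Re (bin (Cmod x + INR n) k) * Cmod w ^ k)%R.
    2:{ unfold Re. simpl. ring. }
    apply Rmult_le_compat_r. apply pow_le; auto. apply bin_abs_le. }
  rewrite <- (is_series_unique _ _ Hs).
  eapply Rle_trans; [apply Rsum_le; intros; apply Hp|].
  apply sum_le_Series.
  - intros k. eapply Rle_trans; [|apply Hp]. apply Cmod_ge_0.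
  - eexists. exact Hs.
Qed.

(** Pfaff's transformation by rearrangement. In absolute values [v] is replaced by
    [|w| / (1 - |w|)], which must be below [1]; the bound on [|w|] ensures this, and it is why the
    identity is obtained only near the origin here. *)
Lemma d_series_near (u v w L : C) : (Cmod u < 1)%R -> (Cmod w < 1 / 3)%R -> v = - w / (1 - w) ->
  is_series2 (fun m n => fcoef a a' b b' c m n * u ^ m * v ^ n) L ->
  is_series2 (fun m j => dcoef a a' b b' c m j * u ^ m * w ^ j) (L * Bf a' w).
Proof.
  intros Hu Hw Hv H.
  assert (Hw1 : (Cmod w < 1)%R) by lra.
  pose proof (Cmod_ge_0 w) as Hw0. pose proof (Cmod_ge_0 u) as Hu0.
  pose proof (one_minus_neq_0 w Hw1) as Hwn.
  set (X := Re (Bf (Cmod a') (Cmod w))).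
  assert (HX : (0 <= X)%R).
  { pose proof (bin_abs_sum a' w 0 0 Hw1) as HX. simpl pow in HX. unfold Rdiv in HX. rewrite Rinv_1, Rmult_1_r in HX.
    eapply Rle_trans; [|exact HX]. apply Rsum_nonneg. intros; apply Cmod_ge_0. }
  apply (is_series2_subst (fun m n => fcoef a a' b b' c m n * u ^ m)
    (fun n q => if Nat.leb n q then (- w) ^ n * (bin (a' + INR n) (q - n) * w ^ (q - n)) else RtoC 0)
    (fun n => v ^ n * Bf a' w) (fun n => Cmod w ^ n * (X / (1 - Cmod w) ^ n))%R).
  - set (t := (Cmod w / (1 - Cmod w))%R).
    assert (Ht : (0 <= t < 1)%R).
    { unfold t. split. apply Rdiv_le_0_compat; lra.
      apply Rmult_lt_reg_r with (1 - Cmod w)%R. lra. field_simplify; lra. }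
    eapply dbounded_le; [|apply (dbounded_scal X); [exact HX|apply (subexp2_dbounded _ (Cmod u) t subexp2_fcoef)]]; auto.
    intros m n. simpl. rewrite Cmod_mult, Cmod_pow. right. unfold t, Rdiv.
    rewrite Rpow_mult_distr, pow_inv. ring.
  - intros n. replace (v ^ n * Bf a' w) with ((- w) ^ n * Bf (a' + INR n) w).
    + apply is_series_shifted with (b := fun k => bin (a' + INR n) k * w ^ k). apply Bf_series; auto.
    + rewrite Bf_add_nat by auto. rewrite Hv. unfold Cdiv. rewrite Cpow_mult_l, Cpow_inv by auto. ring.
  - intros n N. replace (Cmod w ^ n)%R with (Cmod ((- w) ^ n)) by (now rewrite Cmod_pow, Cmod_opp).
    apply Csum_shifted_Cmod with (b := fun k => bin (a' + INR n) k * w ^ k).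
    + apply Rdiv_le_0_compat; auto. apply pow_lt. lra.
    + intros K. apply bin_abs_sum. auto.
  - intros m q. rewrite <- dcoef_sum.
    replace (sum_n (fun n => fcoef a a' b b' c m n * ((-1) ^ n * bin (a' + INR n) (q - n))) q * u ^ m * w ^ q) with
      (sum_n (fun n => fcoef a a' b b' c m n * u ^ m * (if Nat.leb n q then (- w) ^ n * (bin (a' + INR n) (q - n) * w ^ (q - n)) else RtoC 0)) q).
    + apply is_series_finite. intros n Hn. rewrite (proj2 (Nat.leb_gt n q)) by lia. ring.
    + rewrite <- Csum_mult_r, <- Csum_mult_r. apply Csum_ext_le. intros n Hn.
      rewrite (proj2 (Nat.leb_le n q)) by lia.
      replace (w ^ q) with (w ^ (n + (q - n))) by (f_equal; lia). rewrite Cpow_add_r.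
      replace (- w) with ((-1) * w) by ring. rewrite Cpow_mult_l. cring.
  - apply is_series2_transpose. apply is_series2_transpose in H.
    rewrite Cmult_comm. apply (is_series2_scal (Bf a' w)) in H. eapply is_series2_ext; [|exact H].
    intros n m. simpl. ring.
Qed.

(** A Cauchy product in the second index. There is no change of variable, so it holds on the whole
    bidisc. *)
Lemma e_series (u w L : C) : (Cmod u < 1)%R -> (Cmod w < 1)%R ->
  is_series2 (fun m j => dcoef a a' b b' c m j * u ^ m * w ^ j) L ->
  is_series2 (fun m j => ecoef a a' b b' c m j * u ^ m * w ^ j) (L * Bf (- a') w).
Proof.
  intros Hu Hw1 H.
  pose proof (Cmod_ge_0 w) as Hw0. pose proof (Cmod_ge_0 u) as Hu0.
  set (X := Series (fun k => Cmod (bin (- a') k * w ^ k))).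
  assert (HXs : forall N, (sum_n (fun k => Cmod (bin (- a') k * w ^ k)) N <= X)%R).
  { intros N. apply sum_le_Series. intros; apply Cmod_ge_0. apply bin_ex_series; auto. }
  assert (HX : (0 <= X)%R).
  { eapply Rle_trans; [|apply (HXs 0%nat)]. apply Rsum_nonneg. intros; apply Cmod_ge_0. }
  apply (is_series2_subst (fun m n => dcoef a a' b b' c m n * u ^ m)
    (fun n q => if Nat.leb n q then w ^ n * (bin (- a') (q - n) * w ^ (q - n)) else RtoC 0)
    (fun n => w ^ n * Bf (- a') w) (fun n => Cmod w ^ n * X)%R).
  - eapply dbounded_le; [|apply (dbounded_scal X); [exact HX|apply (subexp2_dbounded _ (Cmod u) (Cmod w) subexp2_dcoef)]]; auto.
    intros m n. simpl. rewrite Cmod_mult, Cmod_pow. right. ring.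
  - intros n. apply is_series_shifted with (b := fun k => bin (- a') k * w ^ k). apply Bf_series; auto.
  - intros n N. rewrite <- Cmod_pow.
    apply Csum_shifted_Cmod with (b := fun k => bin (- a') k * w ^ k); auto.
  - intros m q. unfold ecoef.
    replace (sum_n (fun n => dcoef a a' b b' c m n * bin (- a') (q - n)) q * u ^ m * w ^ q) with
      (sum_n (fun n => dcoef a a' b b' c m n * u ^ m * (if Nat.leb n q then w ^ n * (bin (- a') (q - n) * w ^ (q - n)) else RtoC 0)) q).
    + apply is_series_finite. intros n Hn. rewrite (proj2 (Nat.leb_gt n q)) by lia. ring.
    + rewrite <- Csum_mult_r, <- Csum_mult_r. apply Csum_ext_le. intros n Hn.
      rewrite (proj2 (Nat.leb_le n q)) by lia.
      replace (w ^ q) with (w ^ (n + (q - n))) by (f_equal; lia). rewrite Cpow_add_r. cring.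
  - apply is_series2_transpose. apply is_series2_transpose in H.
    rewrite Cmult_comm. apply (is_series2_scal (Bf (- a') w)) in H. eapply is_series2_ext; [|exact H].
    intros n m. simpl. ring.
Qed.

(** * The continuation of [F3] and its uniqueness *)

Let G1 (u v : C) : C := csum2 (fun m n => fcoef a a' b b' c m n * u ^ m * v ^ n).
(** Converges for [|u| < 1] and [Re v < 1/2]. This contains the whole path of integration, where [u]
    is in [(0, 1)] and [v] is negative. *)
Let G2 (u v : C) : C := csum2 (fun m j => ecoef a a' b b' c m j * u ^ m * (v / (v - 1)) ^ j).

Lemma Cmod_scal_lt (s : R) (u : C) : (0 <= s <= 1)%R -> (Cmod u < 1)%R -> (Cmod (s * u)%C < 1)%R.
Proof.
  intros Hs Hu. rewrite Cmod_mult, Cmod_R, Rabs_pos_eq by lra. pose proof (Cmod_ge_0 u). nra.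
Qed.

Lemma Re_scal_lt (s : R) (v : C) : (0 <= s <= 1)%R -> (Re v < 1 / 2)%R -> (Re (s * v)%C < 1 / 2)%R.
Proof.
  intros Hs Hv. replace (Re (s * v)%C) with (s * Re v)%R by (unfold Re; simpl; ring).
  destruct (Rle_lt_dec (Re v) 0); nra.
Qed.

Lemma G1_eq_G2 (u v : C) : (Cmod u < 1)%R -> (Cmod v < 1)%R -> (Re v < 1 / 2)%R -> G1 u v = G2 u v.
Proof.
  intros Hu Hv Hrv.
  (* For [s <= 1/8] one has [|s v| <= 1/8], hence the modulus of [s v / (s v - 1)] is at most [1/7],
     below the [1/3] of the rearrangement. *)
  apply (analytic2_segment_unique G1 G2 u v (1 / 8)).
  - intros s Hs. apply (analytic2_comp _ (fun z => z) (fun z => z)). apply subexp2_fcoef.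
    apply locser_id, Cmod_scal_lt; auto. apply locser_id, Cmod_scal_lt; auto.
  - intros s Hs. apply (analytic2_comp _ (fun z => z) (fun z => z / (z - 1))). apply subexp2_ecoef.
    apply locser_id, Cmod_scal_lt; auto. apply locser_pfaff, Re_scal_lt; auto.
  - lra.
  - intros s Hs.
    assert (Hs1 : (0 <= s <= 1)%R) by lra.
    pose proof (Cmod_scal_lt s u Hs1 Hu) as Hsu. pose proof (Cmod_scal_lt s v Hs1 Hv) as Hsv.
    pose proof (Re_scal_lt s v Hs1 Hrv) as Hrs.
    assert (Hsv8 : (Cmod (s * v)%C <= 1 / 8)%R).
    { rewrite Cmod_mult, Cmod_R, Rabs_pos_eq by lra. pose proof (Cmod_ge_0 v). nra. }
    remember (s * u) as u1 eqn:Eu. remember (s * v) as v1 eqn:Ev. clear Eu Ev.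
    pose proof (Re_lt_half_neq v1 Hrs) as Hn.
    assert (Hn' : v1 - 1 <> 0).
    { intros E. apply Hn. replace (1 - v1) with (- (v1 - 1)) by ring. rewrite E. ring. }
    pose proof (subexp2_is_series2 _ u1 v1 subexp2_fcoef Hsu Hsv) as H. fold (G1 u1 v1) in H.
    set (w := v1 / (v1 - 1)).
    assert (Hw : (Cmod w < 1 / 3)%R).
    { unfold w. rewrite Cmod_div by auto. pose proof (proj1 (Cmod_gt_0 _) Hn').
      assert (1 <= Cmod (v1 - 1)%C + Cmod v1)%R.
      { rewrite <- (Cmod_1) at 1. replace (RtoC 1) with (- (v1 - 1) + v1) at 1 by ring.
        eapply Rle_trans. apply Cmod_triangle. rewrite Cmod_opp. lra. }
      apply Rmult_lt_reg_r with (Cmod (v1 - 1)%C); auto. field_simplify; lra. }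
    assert (Hw1 : (Cmod w < 1)%R) by lra.
    apply (d_series_near u1 v1 w) in H; auto.
    + apply e_series in H; auto.
      rewrite <- Cmult_assoc, Bf_mult in H by auto. replace (a' + - a') with (RtoC 0) in H by ring.
      rewrite Bf_0, Cmult_1_r in H by auto.
      symmetry. apply csum2_unique. exact H.
    + unfold w. field. split; auto. replace (v1 - 1 - v1) with (RtoC (-1)) by ring.
      intros E. apply RtoC_inj in E. lra.
Qed.

Lemma is_appellF3_unique (u v w1 w2 : C) :
  is_appellF3 a a' b b' c u v w1 -> is_appellF3 a a' b b' c u v w2 -> w1 = w2.
Proof.
  intros [F1 [HF1 [HA1 <-]]] [F2 [HF2 [HA2 <-]]].
  pose proof (Cmod_ge_0 u). pose proof (Cmod_ge_0 v).
  set (S := (Cmod u + Cmod v + 1)%R).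
  assert (HS : (1 <= S)%R) by (unfold S; lra).
  (* Up to this parameter [s u] and [s v] lie in the unit disc, where both functions are the sum of
     the same series. *)
  apply (analytic2_segment_unique F1 F2 u v (/ (2 * S)) HA1 HA2).
  - split. apply Rinv_0_lt_compat; lra. rewrite <- Rinv_1. apply Rinv_le_contravar; lra.
  - intros s Hs.
    assert (Hs2 : (s * S <= 1 / 2)%R).
    { apply Rle_trans with (/ (2 * S) * S)%R. apply Rmult_le_compat_r; lra. right. field. lra. }
    apply (is_series2_unique (appellF3_term a a' b b' c (s * u) (s * v))).
    + apply HF1; rewrite Cmod_mult, Cmod_R, Rabs_pos_eq by lra; unfold S in *; nra.
    + apply HF2; rewrite Cmod_mult, Cmod_R, Rabs_pos_eq by lra; unfold S in *; nra.
Qed.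

(** The witness is glued from [G1] and [G2]. Along the segment [Re v <= 0], so a neighbourhood stays
    in [Re v < 1/2], where the glued function is [G2] and hence analytic. *)
Lemma is_appellF3_neg (u v : R) : (0 <= u < 1)%R -> (v <= 0)%R ->
  is_appellF3 a a' b b' c u v (G2 u v).
Proof.
  intros Hu Hv.
  (* The definition asks for the series on the full bidisc, including points with [Re v >= 1/2],
     where [G2] is not known to be its sum; hence the case distinction. *)
  exists (fun u1 v1 => if Rlt_dec (Cmod v1) 1 then if Rlt_dec (Cmod u1) 1 then G1 u1 v1 else G2 u1 v1 else G2 u1 v1).
  assert (HG : forall u1 v1, (Cmod u1 < 1)%R -> (Re v1 < 1 / 2)%R ->
    (if Rlt_dec (Cmod v1) 1 then if Rlt_dec (Cmod u1) 1 then G1 u1 v1 else G2 u1 v1 else G2 u1 v1) = G2 u1 v1).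
  { intros u1 v1 H1 H2. destruct Rlt_dec; auto. destruct Rlt_dec; auto. apply G1_eq_G2; auto. }
  assert (Hu1 : (Cmod u < 1)%R) by (rewrite Cmod_R, Rabs_pos_eq; lra).
  assert (Hv1 : (Re v < 1 / 2)%R) by re_lra.
  split; [|split].
  - intros u1 v1 H1 H2. destruct (Rlt_dec (Cmod v1) 1); [|contradiction].
    destruct (Rlt_dec (Cmod u1) 1); [|contradiction]. apply subexp2_is_series2; auto. apply subexp2_fcoef.
  - intros s Hs.
    pose proof (Cmod_scal_lt s u Hs Hu1) as Hsu.
    assert (Hsv : (Re (s * v)%C <= 0)%R) by (unfold Re; simpl; nra).
    assert (Hsv' : (Re (s * v)%C < 1 / 2)%R) by lra.
    destruct (analytic2_comp _ (fun z => z) (fun z => z / (z - 1)) _ _ subexp2_ecoef (locser_id _ Hsu) (locser_pfaff _ Hsv')) as [r [k [Hr Hk]]].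
    set (e := Rmin r (Rmin (1 / 2) (1 - Cmod (s * u)%C))).
    assert (He : (0 < e)%R) by (repeat apply Rmin_pos; lra).
    assert (He1 : (e <= r)%R) by apply Rmin_l.
    assert (He2 : (e <= 1 / 2)%R) by (eapply Rle_trans; [apply Rmin_r|apply Rmin_l]).
    assert (He3 : (e <= 1 - Cmod (s * u)%C)%R) by (eapply Rle_trans; [apply Rmin_r|apply Rmin_r]).
    exists e, k. split; auto. intros h1 h2 Hh1 Hh2. rewrite HG.
    + apply Hk; lra.
    + eapply Rle_lt_trans. apply Cmod_triangle. lra.
    + replace (Re (s * v + h2)) with (Re (s * v)%C + Re h2)%R by reflexivity.
      pose proof (Re_le_Cmod h2). lra.
  - apply HG; auto.
Qed.

(** With [v = - u / (1 - u)] the Pfaff variable [v / (v - 1)] is [u] itself, and grouping by total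
    degree leaves one power series in [u], times [(1 - u)^(a')]. *)
Lemma appellF3_value (u v : R) : (0 <= u < 1)%R -> (v = - u / (1 - u))%R ->
  exists H, is_Cseries (fun N => sum_n (fun m => dcoef a a' b b' c m (N - m)) N * RtoC u ^ N) H /\
  appellF3 a a' b b' c u v = Bf (- a') u * H.
Proof.
  intros Hu Hv.
  assert (Hu1 : (Cmod u < 1)%R) by (rewrite Cmod_R, Rabs_pos_eq; lra).
  pose proof (subexp2_is_series2 _ u u subexp2_dcoef Hu1 Hu1) as Hd.
  pose proof (e_series u u _ Hu1 Hu1 Hd) as He.
  apply is_series2_diag in Hd.
  eexists. split.
  - eapply is_series_C_ext; [|exact Hd]. intros N. simpl. rewrite <- Csum_mult_r.
    apply Csum_ext_le. intros m Hm.
    replace (RtoC u ^ N) with (RtoC u ^ (m + (N - m))) by (f_equal; lia). rewrite Cpow_add_r. cring.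
  - assert (Hv0 : (v <= 0)%R).
    { rewrite Hv. unfold Rdiv. assert (0 < / (1 - u))%R by (apply Rinv_0_lt_compat; lra). nra. }
    pose proof (is_appellF3_neg u v Hu Hv0) as HF.
    transitivity (G2 u v).
    + apply (iota_unique (K := C_AbsRing) (V := C_CompleteNormedModule)); auto.
      intros y Hy. exact (is_appellF3_unique _ _ _ _ Hy HF).
    + unfold G2. rewrite Cmult_comm. apply csum2_unique.
      replace (v / (v - 1)) with (RtoC u). exact He.
      assert (Hn : (- u / (1 - u) - 1 <> 0)%R).
      { replace (- u / (1 - u) - 1)%R with (- / (1 - u))%R by (field; lra).
        assert (0 < / (1 - u))%R by (apply Rinv_0_lt_compat; lra). lra. }
      rewrite Hv, <- RtoC_minus, <- RtoC_div by auto. f_equal. field. split; lra.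
Qed.

End F3.

(** * Complex functions of a real variable *)

(** Componentwise, so that the mean value theorem and the fundamental theorem for real functions
    apply directly. *)
Definition cderiv (f : R -> C) (t : R) (l : C) : Prop :=
  is_derive (fun s => Re (f s)) t (Re l) /\ is_derive (fun s => Im (f s)) t (Im l).

Definition ccont (f : R -> C) (t : R) : Prop :=
  continuous (fun s => Re (f s)) t /\ continuous (fun s => Im (f s)) t.

Lemma C_ext (z w : C) : Re z = Re w -> Im z = Im w -> z = w.
Proof. destruct z, w. unfold Re, Im. simpl. intros -> ->. reflexivity. Qed.

Lemma cderiv_ccont f t l : cderiv f t l -> ccont f t.
Proof.
  intros [H1 H2]. split.
  - apply (ex_derive_continuous (K := R_AbsRing) (V := R_NormedModule)). eexists; exact H1.
  - apply (ex_derive_continuous (K := R_AbsRing) (V := R_NormedModule)). eexists; exact H2.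
Qed.

Lemma cderiv_eq f t l1 l2 : l1 = l2 -> cderiv f t l1 -> cderiv f t l2.
Proof. intros ->. auto. Qed.

Lemma cderiv_const (z : C) t : cderiv (fun _ => z) t 0.
Proof. split; apply (is_derive_const (K := R_AbsRing) (V := R_NormedModule)). Qed.

Lemma cderiv_RtoC (f : R -> R) (t l : R) : is_derive f t l -> cderiv (fun s => RtoC (f s)) t l.
Proof. intros H. split; [exact H|]. exact (is_derive_const (K := R_AbsRing) (V := R_NormedModule) 0%R t). Qed.

Lemma cderiv_plus f g t lf lg : cderiv f t lf -> cderiv g t lg ->
  cderiv (fun s => f s + g s) t (lf + lg).
Proof. intros [H1 H2] [H3 H4]. split; apply (is_derive_plus (K := R_AbsRing) (V := R_NormedModule)); auto. Qed.

Lemma cderiv_mult f g t lf lg : cderiv f t lf -> cderiv g t lg ->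
  cderiv (fun s => f s * g s) t (lf * g t + f t * lg).
Proof.
  intros [H1 H2] [H3 H4].
  pose proof (is_derive_mult _ _ t _ _ H1 H3 Rmult_comm) as H13.
  pose proof (is_derive_mult _ _ t _ _ H2 H4 Rmult_comm) as H24.
  pose proof (is_derive_mult _ _ t _ _ H1 H4 Rmult_comm) as H14.
  pose proof (is_derive_mult _ _ t _ _ H2 H3 Rmult_comm) as H23.
  split.
  - pose proof (is_derive_minus (K := R_AbsRing) (V := R_NormedModule) _ _ t _ _ H13 H24) as H.
    replace (Re (lf * g t + f t * lg)) with
      (minus (plus (mult (Re lf) (Re (g t))) (mult (Re (f t)) (Re lg)))
             (plus (mult (Im lf) (Im (g t))) (mult (Im (f t)) (Im lg)))).
    exact H. unfold minus, plus, opp, mult, Re, Im. simpl. ring.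
  - pose proof (is_derive_plus (K := R_AbsRing) (V := R_NormedModule) _ _ t _ _ H14 H23) as H.
    replace (Im (lf * g t + f t * lg)) with
      (plus (plus (mult (Re lf) (Im (g t))) (mult (Re (f t)) (Im lg)))
             (plus (mult (Im lf) (Re (g t))) (mult (Im (f t)) (Re lg)))).
    exact H. unfold minus, plus, opp, mult, Re, Im. simpl. ring.
Qed.

Lemma cderiv_comp f (g : R -> R) (t : R) (lf : C) (lg : R) : cderiv f (g t) lf -> is_derive g t lg ->
  cderiv (fun s => f (g s)) t (lg * lf).
Proof.
  intros [H1 H2] Hg. split.
  - replace (Re (lg * lf)) with (scal lg (Re lf)) by (unfold scal, Re, Im; simpl; unfold mult; simpl; ring).
    apply (is_derive_comp (fun s => Re (f s)) g); auto.
  - replace (Im (lg * lf)) with (scal lg (Im lf)) by (unfold scal, Re, Im; simpl; unfold mult; simpl; ring).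
    apply (is_derive_comp (fun s => Im (f s)) g); auto.
Qed.

Lemma ccont_const z t : ccont (fun _ => z) t.
Proof. exact (cderiv_ccont _ _ _ (cderiv_const z t)). Qed.

Lemma ccont_plus f g t : ccont f t -> ccont g t -> ccont (fun s => f s + g s) t.
Proof. intros [H1 H2] [H3 H4]. split; apply (continuous_plus (V := R_NormedModule)); auto. Qed.

Lemma ccont_mult f g t : ccont f t -> ccont g t -> ccont (fun s => f s * g s) t.
Proof.
  intros [H1 H2] [H3 H4]. split.
  - apply (continuous_minus (V := R_NormedModule) (fun s => Re (f s) * Re (g s))%R (fun s => Im (f s) * Im (g s))%R);
    apply (continuous_mult (K := R_AbsRing)); auto.
  - apply (continuous_plus (V := R_NormedModule) (fun s => Re (f s) * Im (g s))%R (fun s => Im (f s) * Re (g s))%R);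
    apply (continuous_mult (K := R_AbsRing)); auto.
Qed.

Lemma ccont_comp f (g : R -> R) t : ccont f (g t) -> continuous g t -> ccont (fun s => f (g s)) t.
Proof.
  intros [H1 H2] Hg. split.
  - apply (continuous_comp g (fun s => Re (f s))); auto.
  - apply (continuous_comp g (fun s => Im (f s))); auto.
Qed.

Lemma Cmod_le_Re_Im (z : C) : (Cmod z <= Rabs (Re z) + Rabs (Im z))%R.
Proof.
  destruct z as [x y]. unfold Re, Im; simpl.
  replace (x, y) with (RtoC x + Ci * RtoC y) by (apply C_ext; unfold Re, Im; simpl; ring).
  eapply Rle_trans. apply Cmod_triangle.
  rewrite Cmod_mult, !Cmod_R.
  assert (Cmod Ci = 1%R). { unfold Cmod, Ci; simpl. replace (0 * (0 * 1) + 1 * (1 * 1))%R with 1%R by ring. apply sqrt_1. }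
  rewrite H. lra.
Qed.

Lemma Rabs_Re_le (z : C) : (Rabs (Re z) <= Cmod z)%R.
Proof. eapply Rle_trans; [|apply Rmax_Cmod]. apply Rmax_l. Qed.

Lemma Rabs_Im_le (z : C) : (Rabs (Im z) <= Cmod z)%R.
Proof. eapply Rle_trans; [|apply Rmax_Cmod]. apply Rmax_r. Qed.

(** The real mean value theorem is applied to each component; the two estimates add up to the factor
    [2]. *)
Lemma mean_value_bound (f df : R -> C) (a b M : R) : (a <= b)%R ->
  (forall t, (a <= t <= b)%R -> cderiv f t (df t)) ->
  (forall t, (a <= t <= b)%R -> (Cmod (df t) <= M)%R) ->
  (Cmod (f b - f a) <= 2 * M * (b - a))%R.
Proof.
  intros Hab Hf HM.
  assert (Hr : forall (g dg : R -> R), (forall t, (a <= t <= b)%R -> is_derive g t (dg t)) ->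
    (forall t, (a <= t <= b)%R -> (Rabs (dg t) <= M)%R) -> (Rabs (g b - g a) <= M * (b - a))%R).
  { intros g dg Hg HgM.
    destruct (MVT_gen g a b dg) as [c [Hc1 Hc2]].
    - intros x Hx. rewrite Rmin_left, Rmax_right in Hx by auto. apply Hg. lra.
    - intros x Hx. rewrite Rmin_left, Rmax_right in Hx by auto.
      apply continuity_pt_filterlim. apply (ex_derive_continuous (K := R_AbsRing) (V := R_NormedModule) g).
      exists (dg x). apply Hg. lra.
    - rewrite Rmin_left, Rmax_right in Hc1 by auto. rewrite Hc2, Rabs_mult, (Rabs_pos_eq (b - a)) by lra.
      apply Rmult_le_compat_r. lra. apply HgM. lra. }
  eapply Rle_trans. apply Cmod_le_Re_Im.
  pose proof (Hr (fun t => Re (f t)) (fun t => Re (df t)) (fun t Ht => proj1 (Hf t Ht))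
    (fun t Ht => Rle_trans _ _ _ (Rabs_Re_le _) (HM t Ht))).
  pose proof (Hr (fun t => Im (f t)) (fun t => Im (df t)) (fun t Ht => proj2 (Hf t Ht))
    (fun t Ht => Rle_trans _ _ _ (Rabs_Im_le _) (HM t Ht))).
  replace (Re (f b - f a)) with (Re (f b) - Re (f a))%R by reflexivity.
  replace (Im (f b - f a)) with (Im (f b) - Im (f a))%R by reflexivity. lra.
Qed.

(** * Powers of positive reals *)

Lemma Rcpow_plus t a b : Rcpow t (a + b) = Rcpow t a * Rcpow t b.
Proof.
  unfold Rcpow.
  replace (Re (a + b) * ln t)%R with (Re a * ln t + Re b * ln t)%R by (unfold Re; simpl; ring).
  replace (Im (a + b) * ln t)%R with (Im a * ln t + Im b * ln t)%R by (unfold Im; simpl; ring).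
  rewrite exp_plus, cos_plus, sin_plus. apply C_ext; unfold Re, Im; simpl; ring.
Qed.

Lemma Cmod_Rcpow t z : Cmod (Rcpow t z) = Rpower t (Re z).
Proof.
  unfold Rcpow. rewrite Cmod_mult, Cmod_R, Rabs_pos_eq by (left; apply exp_pos).
  unfold Rpower, Cmod. simpl fst. simpl snd.
  replace (cos (Im z * ln t) ^ 2 + sin (Im z * ln t) ^ 2)%R with 1%R.
  rewrite sqrt_1. ring. pose proof (sin2_cos2 (Im z * ln t)). unfold Rsqr in H. lra.
Qed.

Lemma Rcpow_0 t : Rcpow t 0 = 1.
Proof.
  unfold Rcpow, Re, Im. simpl. rewrite Rmult_0_l, exp_0, cos_0, sin_0.
  apply C_ext; unfold Re, Im; simpl; ring.
Qed.

Lemma Rcpow_neq_0 t z : Rcpow t z <> 0.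
Proof.
  apply (proj2 (Cmod_gt_0 _)). rewrite Cmod_Rcpow. apply exp_pos.
Qed.

Lemma Rcpow_opp t z : Rcpow t (- z) = / Rcpow t z.
Proof.
  pose proof (Rcpow_neq_0 t z).
  assert (E : Rcpow t (- z) * Rcpow t z = 1).
  { rewrite <- Rcpow_plus. replace (- z + z) with (RtoC 0) by ring. apply Rcpow_0. }
  replace (Rcpow t (- z)) with (Rcpow t (- z) * Rcpow t z / Rcpow t z) by (field; auto).
  rewrite E. field. auto.
Qed.

Lemma Rcpow_R t (r : R) : Rcpow t r = RtoC (Rpower t r).
Proof.
  unfold Rcpow, Rpower, Re, Im. simpl. rewrite Rmult_0_l, cos_0, sin_0.
  apply C_ext; unfold Re, Im; simpl; ring.
Qed.

Lemma Rcpow_1 t : (0 < t)%R -> Rcpow t 1 = t.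
Proof. intros Ht. rewrite Rcpow_R, Rpower_1; auto. Qed.

Lemma Rcpow_INR t n : (0 < t)%R -> Rcpow t (INR n) = RtoC t ^ n.
Proof. intros Ht. rewrite Rcpow_R, Rpower_pow, RtoC_pow; auto. Qed.

Lemma Rcpow_S t z : (0 < t)%R -> Rcpow t (z + 1) = t * Rcpow t z.
Proof. intros Ht. rewrite Rcpow_plus, Rcpow_1 by auto. ring. Qed.

Lemma Rcpow_mult_l s t z : (0 < s)%R -> (0 < t)%R -> Rcpow (s * t) z = Rcpow s z * Rcpow t z.
Proof.
  intros Hs Ht. unfold Rcpow. rewrite ln_mult by auto.
  rewrite !Rmult_plus_distr_l, exp_plus, cos_plus, sin_plus.
  apply C_ext; unfold Re, Im; simpl; ring.
Qed.

Lemma Rcpow_base_1 z : Rcpow 1 z = 1.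
Proof.
  unfold Rcpow. rewrite ln_1, !Rmult_0_r, exp_0, cos_0, sin_0.
  apply C_ext; unfold Re, Im; simpl; ring.
Qed.

Lemma cderiv_Rcpow t z : (0 < t)%R -> cderiv (fun s => Rcpow s z) t (z * Rcpow t (z - 1)).
Proof.
  intros Ht.
  assert (E : Rcpow t (z - 1) = Rcpow t z / t).
  { assert (RtoC t <> 0) by (intros E; apply RtoC_inj in E; lra).
    replace z with ((z - 1) + 1) at 2 by ring. rewrite Rcpow_S by auto. field. auto. }
  rewrite E. destruct z as [x y].
  assert (Hti : / RtoC t = RtoC (/ t)) by (rewrite RtoC_inv; auto; lra).
  assert (Hre : forall s, Re (Rcpow s (x, y)) = (exp (x * ln s) * cos (y * ln s))%R).
  { intros s. unfold Rcpow, Re, Im. simpl. ring. }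
  assert (Him : forall s, Im (Rcpow s (x, y)) = (exp (x * ln s) * sin (y * ln s))%R).
  { intros s. unfold Rcpow, Re, Im. simpl. ring. }
  assert (Hmul : (x, y) * (Rcpow t (x, y) / t) =
    ((x * Re (Rcpow t (x, y)) - y * Im (Rcpow t (x, y))) / t, (x * Im (Rcpow t (x, y)) + y * Re (Rcpow t (x, y))) / t)%R).
  { unfold Cdiv. rewrite Hti. apply C_ext; unfold Re, Im; simpl; field; lra. }
  rewrite Hmul, Hre, Him. split.
  - apply (is_derive_ext (fun s => exp (x * ln s) * cos (y * ln s))%R). intros s; symmetry; apply Hre.
    auto_derive. auto. unfold Re; simpl fst. field. lra.
  - apply (is_derive_ext (fun s => exp (x * ln s) * sin (y * ln s))%R). intros s; symmetry; apply Him.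
    auto_derive. auto. unfold Im; simpl snd. field. lra.
Qed.

(** * The reciprocal Gamma function *)

Lemma inv_square_series (K : R) : (0 <= K)%R -> ex_series (fun n => K * (/ INR (S n) * / INR (S n)))%R.
Proof.
  intros HK. apply ex_series_R_scal. apply ex_series_nonneg with 2%R.
  - intros n. assert (0 < INR (S n))%R by (apply lt_0_INR; lia).
    apply Rlt_le, Rmult_lt_0_compat; apply Rinv_0_lt_compat; auto.
  (* Telescoping: [1 / (x + 1)^2 <= 1 / x - 1 / (x + 1)]. *)
  - intros N. apply Rle_trans with (2 - / INR (S N))%R.
    2:{ assert (0 < INR (S N))%R by (apply lt_0_INR; lia).
        assert (0 < / INR (S N))%R by (apply Rinv_0_lt_compat; auto). lra. }
    induction N.
    + rewrite Rsum_O. simpl. lra.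
    + rewrite Rsum_Sn. set (x := INR (S N)) in *.
      assert (Hx : (0 < x)%R) by (apply lt_0_INR; lia).
      replace (INR (S (S N))) with (x + 1)%R by (unfold x; rewrite (S_INR (S N)); ring).
      assert (/ (x + 1) * / (x + 1) <= / x - / (x + 1))%R; [|lra].
      replace (/ x - / (x + 1))%R with (/ x * / (x + 1))%R by (field; lra).
      apply Rmult_le_compat_r. apply Rlt_le, Rinv_0_lt_compat; lra. apply Rinv_le_contravar; lra.
Qed.

(** The partial products are bounded by [exp] of the sum of [b], so their increments
    [s n * (p n - 1)] are summable. *)
Lemma inf_prod_conv (s p : nat -> C) (b : nat -> R) :
  (forall n, s (S n) = s n * p n) -> (forall n, (Cmod (p n - 1) <= b n)%R) -> ex_series b ->
  exists l, Flim eventually s l.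
Proof.
  intros Hs Hp Hb.
  assert (Hbp : forall n, (0 <= b n)%R) by (intros; eapply Rle_trans; [apply Cmod_ge_0|apply Hp]).
  assert (Hexp : forall n, (Cmod (s (S n)) <= Cmod (s 0%nat) * exp (sum_n b n))%R).
  { assert (Hstep : forall n, (Cmod (p n) <= exp (b n))%R).
    { intros n. apply Rle_trans with (1 + b n)%R.
      - replace (p n) with (1 + (p n - 1)) by ring. eapply Rle_trans. apply Cmod_triangle. rewrite Cmod_1.
        specialize (Hp n). lra.
      - destruct (Req_dec (b n) 0) as [E|E]. rewrite E, exp_0. lra.
        left. apply exp_ineq1. auto. }
    induction n.
    - rewrite Hs, Rsum_O, Cmod_mult. apply Rmult_le_compat_l; auto using Cmod_ge_0.
    - rewrite Hs, Rsum_Sn, Cmod_mult, exp_plus, <- Rmult_assoc.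
      apply Rmult_le_compat; auto using Cmod_ge_0. }
  set (M := (Cmod (s 0%nat) * exp (Series b))%R).
  assert (HM : forall n, (Cmod (s n) <= M)%R).
  { intros n. pose proof (Cmod_ge_0 (s 0%nat)).
    assert (HS0 : (0 <= Series b)%R).
    { eapply Rle_trans; [|apply (sum_le_Series b 0); auto]. rewrite Rsum_O; auto. }
    assert (Hmono : forall x y, (x <= y)%R -> (exp x <= exp y)%R).
    { intros x y [H1|H1]. left; apply exp_increasing; auto. rewrite H1; lra. }
    destruct n.
    - unfold M. rewrite <- (Rmult_1_r (Cmod (s 0%nat))) at 1. apply Rmult_le_compat_l; auto.
      rewrite <- exp_0. auto.
    - eapply Rle_trans. apply Hexp. apply Rmult_le_compat_l; auto. apply Hmono, sum_le_Series; auto. }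
  destruct (is_series_dominated (fun n => s (S n) - s n) (fun n => M * b n)%R) as [l Hl].
  - intros n. rewrite Hs. replace (s n * p n - s n) with (s n * (p n - 1)) by ring.
    rewrite Cmod_mult. apply Rmult_le_compat; auto using Cmod_ge_0.
  - apply ex_series_R_scal; auto.
  - exists (s 0%nat + l). apply is_series_C_iff in Hl.
    assert (E : forall n, s (S n) = s 0%nat + sum_n (fun n => s (S n) - s n) n).
    { induction n. rewrite Csum_O. cring. rewrite Csum_Sn, Cplus_assoc, <- IHn. cring. }
    intros eps He. destruct (Hl eps He) as [K HK]. exists (S K). intros n Hn. destruct n. lia.
    rewrite E. replace (s 0%nat + sum_n (fun n => s (S n) - s n) n - (s 0%nat + l)) with
      (sum_n (fun n => s (S n) - s n) n - l) by cring. apply HK. lia.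
Qed.

Lemma Flim_shift (s : nat -> C) l K : Flim eventually s l <-> Flim eventually (fun n => s (K + n)%nat) l.
Proof.
  split; intros H eps He; destruct (H eps He) as [N HN].
  - exists N. intros n Hn. apply HN. lia.
  - exists (N + K)%nat. intros n Hn. replace n with (K + (n - K))%nat by lia. apply HN. lia.
Qed.

(** The reciprocals of the partial products, taken from an index where the factors are away from
    [0], converge by the same criterion. The product of the two limits is [1]. *)
Lemma inf_prod_neq_0 (s p : nat -> C) (b : nat -> R) l :
  (forall n, s (S n) = s n * p n) -> (forall n, (Cmod (p n - 1) <= b n)%R) -> ex_series b ->
  (forall n, s n <> 0) -> Flim eventually s l -> l <> 0.
Proof.
  intros Hs Hp Hb Hn Hl.
  assert (Hb0 : exists K, forall n, (K <= n)%nat -> (b n <= 1 / 2)%R).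
  { pose proof (ex_series_lim_0 _ Hb) as H0.
    assert (He : (0 < 1 / 2)%R) by lra.
    destruct (proj2 (is_lim_seq_spec b 0) H0 (mkposreal _ He)) as [K HK]. exists K. intros n Hk.
    specialize (HK n Hk). simpl in HK. rewrite Rminus_0_r in HK. apply Rabs_def2 in HK. lra. }
  destruct Hb0 as [K HK].
  assert (Hpn : forall n, (K <= n)%nat -> (1 / 2 <= Cmod (p n))%R).
  { intros n Hk. specialize (HK n Hk). specialize (Hp n).
    assert (1 <= Cmod (p n) + Cmod (p n - 1))%R; [|lra].
    rewrite <- Cmod_1 at 1. replace (RtoC 1) with (p n + - (p n - 1)) at 1 by ring.
    eapply Rle_trans. apply Cmod_triangle. rewrite Cmod_opp. lra. }
  (* As [|p| >= 1/2] from [K] on, [|1 / p - 1| <= 2 |p - 1|]. *)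
  destruct (inf_prod_conv (fun n => / s (K + n)%nat) (fun n => / p (K + n)%nat) (fun n => 2 * b (K + n)%nat)%R) as [l' Hl'].
  - intros n. rewrite Nat.add_succ_r, Hs.
    assert (p (K + n)%nat <> 0).
    { intros E. apply (Hn (S (K + n))). rewrite Hs, E. ring. }
    field. auto.
  - intros n. assert (Hk : (K <= K + n)%nat) by lia. specialize (Hpn _ Hk). specialize (Hp (K + n)%nat).
    set (q := p (K + n)%nat) in *.
    assert (Hq : q <> 0) by (apply (proj2 (Cmod_gt_0 _)); lra).
    replace (/ q - 1) with (- (q - 1) * / q) by (field; auto).
    rewrite Cmod_mult, Cmod_opp, Cmod_inv by auto.
    rewrite Rmult_comm. apply Rmult_le_compat; auto using Cmod_ge_0.
    apply Rlt_le, Rinv_0_lt_compat; lra.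
    replace 2%R with (/ (1 / 2))%R by field. apply Rinv_le_contravar; lra.
  - apply ex_series_R_scal. apply (ex_series_incr_n b K). auto.
  - apply (Flim_shift s l K) in Hl.
    pose proof (Flim_mult eventually _ _ _ _ Hl Hl') as H.
    apply (Flim_ext_ev eventually _ (fun _ => RtoC 1)) in H.
    2:{ apply filter_forall. intros n. field. auto. }
    pose proof (Flim_unique _ _ _ H (Flim_const eventually (RtoC 1))) as E.
    intros E0. rewrite E0, Cmult_0_l in E. apply RtoC_inj in E. lra.
Qed.

Definition gauss_seq (z : C) (n : nat) : C :=
  pochhammer z (S n) / (INR (fact n) * Rcpow (INR n) z).

(* For [0 <= h <= 1/2], [(1 + z h) (1 - h)^z] has derivative
   [- z (1 + z) h (1 - h)^(z - 1)] in [h], so it is [1 + O(h^2)]. *)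
Lemma gauss_factor_bound (z : C) : exists K, (0 <= K)%R /\ forall h : R, (0 <= h <= 1 / 2)%R ->
  (Cmod ((1 + z * h) * Rcpow (1 - h) z - 1) <= K * (h * h))%R.
Proof.
  set (A := (Rabs (Re z - 1) * - ln (1 / 2))%R).
  set (B := (Cmod z * Cmod (1 + z)%C * exp A)%R).
  assert (HB : (0 <= B)%R).
  { unfold B. apply Rmult_le_pos. apply Rmult_le_pos; apply Cmod_ge_0. left; apply exp_pos. }
  exists (2 * B)%R. split. lra. intros h Hh.
  set (G := fun h : R => (1 + z * h) * Rcpow (1 - h) z).
  assert (HG : forall t, (0 <= t <= h)%R -> cderiv G t (- (z * (1 + z) * t) * Rcpow (1 - t) (z - 1))).
  { intros t Ht. assert (Ht1 : (0 < 1 - t)%R) by lra.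
    assert (Hd : is_derive (fun s => 1 - s)%R t (-1)%R) by (auto_derive; auto; ring).
    assert (Hd2 : is_derive (fun s : R => s) t 1%R) by (auto_derive; auto).
    pose proof (cderiv_comp (fun s => Rcpow s z) (fun s => 1 - s)%R t _ _ (cderiv_Rcpow (1 - t) z Ht1) Hd) as H1.
    pose proof (cderiv_plus _ _ _ _ _ (cderiv_const 1 t) (cderiv_mult _ _ _ _ _ (cderiv_const z t) (cderiv_RtoC _ _ _ Hd2))) as H2.
    pose proof (cderiv_mult _ _ _ _ _ H2 H1) as H3.
    eapply cderiv_eq; [|exact H3]. simpl.
    replace (Rcpow (1 - t) z) with (RtoC (1 - t) * Rcpow (1 - t) (z - 1)).
    rewrite RtoC_minus. ring.
    rewrite <- Rcpow_S by auto. f_equal. ring. }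
  pose proof (mean_value_bound G _ 0 h (B * h)%R (proj1 Hh) HG) as H.
  assert (E0 : G 0%R = 1).
  { unfold G. rewrite Rminus_0_r, Rcpow_base_1. ring. }
  rewrite E0, Rminus_0_r in H. fold (G h).
  replace (2 * B * (h * h))%R with (2 * (B * h) * h)%R by ring. apply H.
  intros t Ht. rewrite Cmod_mult, Cmod_opp, !Cmod_mult, Cmod_R, Cmod_Rcpow, (Rabs_pos_eq t) by lra.
  unfold B. replace (Cmod z * Cmod (1 + z)%C * exp A * h)%R with (Cmod z * Cmod (1 + z)%C * h * exp A)%R by ring.
  assert (0 <= Cmod z * Cmod (1 + z)%C)%R by (apply Rmult_le_pos; apply Cmod_ge_0).
  apply Rmult_le_compat; [| |apply Rmult_le_compat_l; lra|].
  apply Rmult_le_pos; lra. left; apply exp_pos.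
  assert (Hmono : forall x y, (x <= y)%R -> (exp x <= exp y)%R).
  { intros x y [H1|H1]. left; apply exp_increasing; auto. rewrite H1; lra. }
  unfold Rpower. apply Hmono. unfold A.
  replace (Re (z - 1)) with (Re z - 1)%R by (unfold Re; simpl; ring).
  assert (Hl1 : (ln (1 - t) <= 0)%R). { rewrite <- ln_1. apply ln_le; lra. }
  assert (Hl2 : (ln (1 / 2) <= ln (1 - t))%R). { apply ln_le; lra. }
  eapply Rle_trans. apply Rle_abs. rewrite Rabs_mult, (Rabs_left1 (ln (1 - t))) by lra.
  apply Rmult_le_compat_l. apply Rabs_pos. lra.
Qed.

Lemma INR_SS_pos n : (0 < INR (S n))%R.
Proof. apply lt_0_INR. lia. Qed.

(** The ratio of consecutive terms is [(1 + z h) (1 - h)^z] with [h = 1 / (n + 2)]. Starting at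
    index [1] avoids powers with base [0] and keeps [h <= 1/2]. *)
Lemma gauss_seq_step (z : C) n :
  gauss_seq z (S (S n)) = gauss_seq z (S n) *
   ((1 + z * RtoC (/ INR (S (S n)))) * Rcpow (1 - / INR (S (S n))) z).
Proof.
  unfold gauss_seq. rewrite (poch_S z (S (S n))), (fact_S_C (S n)).
  pose proof (INR_SS_pos n). pose proof (INR_SS_pos (S n)).
  assert (E : Rcpow (1 - / INR (S (S n))) z * Rcpow (INR (S (S n))) z = Rcpow (INR (S n)) z).
  { assert (Hp : (1 - / INR (S (S n)) = INR (S n) / INR (S (S n)))%R).
    { rewrite (S_INR (S n)) in *. field. lra. }
    rewrite <- Rcpow_mult_l; auto. f_equal. rewrite Hp. field. lra. rewrite Hp. apply Rdiv_lt_0_compat; auto. }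
  rewrite <- E. rewrite RtoC_inv by lra.
  pose proof (Rcpow_neq_0 (1 - / INR (S (S n))) z). pose proof (Rcpow_neq_0 (INR (S (S n))) z).
  pose proof (INR_fact_C_neq (S n)). pose proof (INR_S_C_neq (S n)). field. auto.
Qed.

Lemma gauss_factor_series (z : C) : exists b, ex_series b /\ forall n,
  (Cmod ((1 + z * RtoC (/ INR (S (S n)))) * Rcpow (1 - / INR (S (S n))) z - 1) <= b n)%R.
Proof.
  destruct (gauss_factor_bound z) as [K [HK HH]].
  exists (fun n => K * (/ INR (S (S n)) * / INR (S (S n))))%R. split.
  - apply (ex_series_incr_1 (fun n => K * (/ INR (S n) * / INR (S n)))%R). apply inv_square_series; auto.
  - intros n. apply HH. pose proof (INR_SS_pos (S n)).
    split. left; apply Rinv_0_lt_compat; auto.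
    replace (1 / 2)%R with (/ 2)%R by field. apply Rinv_le_contravar. lra.
    rewrite !S_INR. pose proof (pos_INR n). lra.
Qed.

Lemma rGamma_lim (z : C) : Flim eventually (gauss_seq z) (rGamma z).
Proof.
  destruct (gauss_factor_series z) as [b [Hb HH]].
  destruct (inf_prod_conv (fun n => gauss_seq z (S n)) _ b (gauss_seq_step z) HH Hb) as [l Hl].
  apply (proj2 (Flim_shift (gauss_seq z) l 1)) in Hl.
  replace (rGamma z) with l; auto. symmetry.
  apply (iota_unique (K := C_AbsRing) (V := C_CompleteNormedModule)).
  - intros y Hy. apply (Flim_iff eventually) in Hy. apply (Flim_unique _ _ _ Hy Hl).
  - apply (Flim_iff eventually). exact Hl.
Qed.

Lemma rGamma_neq_0 (z : C) : (0 < Re z)%R -> rGamma z <> 0.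
Proof.
  intros Hz. destruct (gauss_factor_series z) as [b [Hb HH]].
  apply (inf_prod_neq_0 (fun n => gauss_seq z (S n)) _ b _ (gauss_seq_step z) HH Hb).
  - intros n. unfold gauss_seq. apply Cmult_neq_0. apply poch_neq_0; auto.
    intros E. pose proof (Rcpow_neq_0 (INR (S n)) z). pose proof (INR_fact_C_neq (S n)).
    assert (Hne : INR (fact (S n)) * Rcpow (INR (S n)) z <> 0) by (apply Cmult_neq_0; auto).
    apply (C1_nz). rewrite <- (Cinv_r _ Hne), E. ring.
  - exact (proj1 (Flim_shift (gauss_seq z) (rGamma z) 1) (rGamma_lim z)).
Qed.

(** [z] times the Gauss sequence at [z + 1] is the sequence at [z] times [1 + (z + 1) / n]. *)
Lemma rGamma_S (z : C) : rGamma z = z * rGamma (z + 1).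
Proof.
  assert (H1 : Flim eventually (fun n => z * gauss_seq (z + 1) n) (z * rGamma (z + 1))).
  { apply (Flim_mult eventually). apply (Flim_const eventually). apply rGamma_lim. }
  assert (H2 : Flim eventually (fun n => gauss_seq z n * (1 + (z + 1) * RtoC (/ INR n))) (rGamma z * (1 + (z + 1) * 0))).
  { apply (Flim_mult eventually). apply rGamma_lim. apply (Flim_plus eventually). apply (Flim_const eventually).
    apply (Flim_mult eventually). apply (Flim_const eventually).
    apply Flim_inv_INR. }
  replace (rGamma z * (1 + (z + 1) * 0)) with (rGamma z) in H2 by ring.
  apply (Flim_unique _ _ _ H2). apply (Flim_ext_ev eventually (fun n => z * gauss_seq (z + 1) n)); auto.
  exists 1%nat. intros n Hn. destruct n. lia.
  unfold gauss_seq. rewrite Rcpow_S by apply INR_SS_pos.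
  assert (E : z * pochhammer (z + 1) (S (S n)) = pochhammer z (S (S n)) * (z + INR (S (S n)))).
  { rewrite <- poch_S_l. reflexivity. }
  unfold Cdiv. rewrite Cmult_assoc, E, INR_S_C. pose proof (INR_SS_pos n).
  rewrite RtoC_inv by lra.
  pose proof (Rcpow_neq_0 (INR (S n)) z). pose proof (INR_fact_C_neq (S n)). pose proof (INR_S_C_neq n).
  field. auto.
Qed.

Lemma Gamma_S (z : C) : (0 < Re z)%R -> Gamma (z + 1) = z * Gamma z.
Proof.
  intros Hz. unfold Gamma. rewrite (rGamma_S z).
  assert (rGamma (z + 1) <> 0) by (apply rGamma_neq_0; re_lra).
  assert (z <> 0) by (apply Re_pos_neq_0; auto). field. auto.
Qed.

Lemma Gamma_neq_0 (z : C) : (0 < Re z)%R -> Gamma z <> 0.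
Proof.
  intros Hz E. pose proof (rGamma_neq_0 z Hz) as Hn. unfold Gamma in E.
  apply C1_nz. rewrite <- (Cinv_r _ Hn), E. ring.
Qed.

(** * Power series on [0, 1) *)

Definition HS (h : nat -> C) (y : R) : C := CSeries (fun N => h N * RtoC y ^ N).

Definition abs1 (h : nat -> C) : Prop :=
  forall y : R, (0 <= y < 1)%R -> ex_series (fun N => Cmod (h N) * y ^ N)%R.

Definition der (h : nat -> C) (N : nat) : C := INR (S N) * h (S N).

Lemma HS_series h (y : R) : abs1 h -> (Rabs y < 1)%R -> is_Cseries (fun N => h N * RtoC y ^ N) (HS h y).
Proof.
  intros Hh Hy.
  assert (Hy' : (0 <= Rabs y < 1)%R) by (split; auto using Rabs_pos).
  destruct (is_series_dominated (fun N => h N * RtoC y ^ N) (fun N => Cmod (h N) * Rabs y ^ N)%R) as [l Hl]; auto.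
  - intros n. rewrite Cmod_mult, Cmod_pow, Cmod_R. lra.
  - unfold HS. rewrite (CSeries_unique _ _ Hl). exact Hl.
Qed.

(** The terms are bounded at the midpoint between [|y|] and [1]. This opens the way to termwise
    differentiation of the real and imaginary parts. *)
Lemma abs1_CV_radius (a : nat -> R) h (y : R) : abs1 h -> (forall n, (Rabs (a n) <= Cmod (h n))%R) ->
  (Rabs y < 1)%R -> Rbar_lt (Rabs y) (CV_radius a).
Proof.
  intros Hh Ha Hy.
  set (r := ((Rabs y + 1) / 2)%R). pose proof (Rabs_pos y).
  apply Rbar_lt_le_trans with r. simpl. unfold r. lra.
  apply (proj1 (CV_radius_bounded a)).
  assert (Hr : (0 <= r < 1)%R) by (unfold r; lra).
  exists (Series (fun N => Cmod (h N) * r ^ N)%R). intros n.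
  rewrite Rabs_mult, <- RPow_abs, (Rabs_pos_eq r) by lra.
  assert (Hpos : forall N, (0 <= Cmod (h N) * r ^ N)%R).
  { intros. apply Rmult_le_pos. apply Cmod_ge_0. apply pow_le; lra. }
  apply Rle_trans with (Cmod (h n) * r ^ n)%R. apply Rmult_le_compat_r; auto. apply pow_le; lra.
  eapply Rle_trans; [|apply (sum_le_Series _ n Hpos (Hh r Hr))].
  destruct n. rewrite Rsum_O; lra. rewrite Rsum_Sn. pose proof (Rsum_nonneg _ n Hpos). lra.
Qed.

Lemma HS_Re h (y : R) : abs1 h -> (Rabs y < 1)%R -> Re (HS h y) = PSeries (fun n => Re (h n)) y.
Proof.
  intros Hh Hy. symmetry. apply is_series_unique.
  eapply is_series_ext; [|apply (is_series_Re _ _ (HS_series h y Hh Hy))].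
  intros n. simpl. rewrite <- RtoC_pow. unfold Re; simpl. ring.
Qed.

Lemma HS_Im h (y : R) : abs1 h -> (Rabs y < 1)%R -> Im (HS h y) = PSeries (fun n => Im (h n)) y.
Proof.
  intros Hh Hy. symmetry. apply is_series_unique.
  eapply is_series_ext; [|apply (is_series_Im _ _ (HS_series h y Hh Hy))].
  intros n. simpl. rewrite <- RtoC_pow. unfold Im; simpl. ring.
Qed.

Lemma abs1_der h : abs1 h -> abs1 (der h).
Proof.
  intros Hh y Hy.
  set (a := fun n => Cmod (h n)).
  assert (Hr : Rbar_lt (Rabs y) (CV_radius (PS_derive a))).
  { rewrite CV_radius_derive. apply abs1_CV_radius with h; auto.
    intros n. unfold a. rewrite Rabs_pos_eq; [lra|apply Cmod_ge_0]. rewrite Rabs_pos_eq; lra. }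
  apply CV_disk_inside in Hr. eapply ex_series_ext; [|exact Hr].
  intros n. unfold PS_derive, a, der. simpl Rabs.
  change (Rabs (INR (S n) * Cmod (h (S n)) * y ^ n) = (Cmod (INR (S n) * h (S n)) * y ^ n)%R)%R.
  rewrite Cmod_mult, Cmod_INR, Rabs_pos_eq; auto.
  apply Rmult_le_pos. apply Rmult_le_pos. apply pos_INR. apply Cmod_ge_0. apply pow_le; lra.
Qed.

Lemma cderiv_HS h (y : R) : abs1 h -> (Rabs y < 1)%R -> cderiv (HS h) y (HS (der h) y).
Proof.
  intros Hh Hy.
  assert (Hloc : locally y (fun z => Rabs z < 1)%R).
  { assert (He : (0 < 1 - Rabs y)%R) by lra. exists (mkposreal _ He). intros z Hz.
    assert (Hz' : (Rabs (z - y) < 1 - Rabs y)%R) by exact Hz.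
    replace z with ((z - y) + y)%R by ring. eapply Rle_lt_trans. apply Rabs_triang. lra. }
  split.
  - rewrite HS_Re by (auto using abs1_der).
    apply is_derive_ext_loc with (PSeries (fun n => Re (h n))).
    + generalize Hloc. apply filter_imp. intros z Hz. symmetry. apply HS_Re; auto.
    + rewrite (PSeries_ext (fun n => Re (der h n)) (PS_derive (fun n => Re (h n)))).
      * apply is_derive_PSeries. apply abs1_CV_radius with h; auto. intros; apply Rabs_Re_le.
      * intros n. unfold PS_derive, der, Re. simpl. ring.
  - rewrite HS_Im by (auto using abs1_der).
    apply is_derive_ext_loc with (PSeries (fun n => Im (h n))).
    + generalize Hloc. apply filter_imp. intros z Hz. symmetry. apply HS_Im; auto.
    + rewrite (PSeries_ext (fun n => Im (der h n)) (PS_derive (fun n => Im (h n)))).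
      * apply is_derive_PSeries. apply abs1_CV_radius with h; auto. intros; apply Rabs_Im_le.
      * intros n. unfold PS_derive, der, Im. simpl. ring.
Qed.

Lemma abs1_bin a : abs1 (bin a).
Proof.
  intros y Hy. eapply ex_series_ext; [|apply (bin_ex_series a (RtoC y))].
  - intros n. simpl. rewrite Cmod_mult, Cmod_pow, Cmod_R, Rabs_pos_eq by lra. reflexivity.
  - rewrite Cmod_R, Rabs_pos_eq; lra.
Qed.

(** [(1 - s)^a] times the binomial series has derivative [0] and equals [1] at [s = 0]. *)
Lemma Bf_real a (y : R) : (0 <= y < 1)%R -> Bf a y = Rcpow (1 - y) (- a).
Proof.
  intros Hy.
  set (f := fun s : R => Rcpow (1 - s) a * HS (bin a) s).
  assert (Hf : forall t, (0 <= t <= y)%R -> cderiv f t 0).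
  { intros t Ht. assert (Ht1 : (0 < 1 - t)%R) by lra.
    assert (Hta : (Rabs t < 1)%R) by (rewrite Rabs_pos_eq; lra).
    assert (Htc : (Cmod t < 1)%R) by (rewrite Cmod_R; auto).
    assert (Hd : is_derive (fun s => 1 - s)%R t (-1)%R) by (auto_derive; auto; ring).
    pose proof (cderiv_comp (fun s => Rcpow s a) (fun s => 1 - s)%R t _ _ (cderiv_Rcpow (1 - t) a Ht1) Hd) as H1.
    pose proof (cderiv_mult _ _ _ _ _ H1 (cderiv_HS _ t (abs1_bin a) Hta)) as H2.
    eapply cderiv_eq; [|exact H2]. simpl.
    assert (E1 : HS (der (bin a)) t = a * Bf (a + 1) t).
    { apply CSeries_unique. eapply is_series_C_ext; [|apply (is_series_C_scal a _ _ (Bf_series (a + 1) t Htc))].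
      intros n. unfold der. cbv beta. rewrite Cmult_assoc. f_equal. unfold bin. rewrite poch_S_l, fact_S_C. field; nz. }
    rewrite E1.
    replace (HS (bin a) t) with (Bf a t) by reflexivity.
    assert (E2 : Bf a t = Bf (a + 1) t * (1 - t)).
    { rewrite <- Bf_neg1, Bf_mult by auto. f_equal. ring. }
    replace (Rcpow (1 - t) a) with (RtoC (1 - t) * Rcpow (1 - t) (a - 1)).
    rewrite E2, RtoC_minus. ring. rewrite <- Rcpow_S by auto. f_equal. ring. }
  assert (H0 : f y = f 0%R).
  { pose proof (mean_value_bound f (fun _ => 0) 0 y 0 (proj1 Hy) Hf) as H.
    assert (H' : (Cmod (f y - f 0%R) <= 2 * 0 * (y - 0))%R) by (apply H; intros; rewrite Cmod_0; lra).
    assert (E : f y - f 0%R = 0).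
    { apply Cmod_eq_0. apply Rle_antisym. lra. apply Cmod_ge_0. }
    replace (f y) with (f y - f 0%R + f 0%R) by ring. rewrite E. ring. }
  assert (E0 : f 0%R = 1).
  { unfold f. rewrite Rminus_0_r, Rcpow_base_1.
    replace (HS (bin a) 0) with (RtoC 1). ring. symmetry. apply CSeries_unique.
    replace (RtoC 1) with (sum_n (fun N => bin a N * 0 ^ N) 0).
    apply is_series_finite. intros n Hn. destruct n. lia. simpl. ring.
    rewrite Csum_O, bin_0. simpl. cring. }
  rewrite E0 in H0. unfold f in H0. replace (HS (bin a) y) with (Bf a y) in H0 by reflexivity.
  rewrite Rcpow_opp. pose proof (Rcpow_neq_0 (1 - y) a).
  replace (Bf a y) with (Rcpow (1 - y) a * Bf a y / Rcpow (1 - y) a) by (field; auto).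
  rewrite H0. field. auto.
Qed.

(** * Improper integrals over (0, 1) *)

Definition cont01 (f : R -> C) : Prop := forall t, (0 < t < 1)%R -> ccont f t.

Definition IntC (f : R -> C) (a b : R) : C :=
  (RInt (fun t => Re (f t)) a b, RInt (fun t => Im (f t)) a b).

Definition F01 : (R * R -> Prop) -> Prop := filter_prod (at_right 0) (at_left 1).

Global Instance F01_proper : ProperFilter F01.
Proof. apply filter_prod_proper. Qed.

(** Both endpoints move independently. Continuity is included so that all proper integrals exist and
    linearity has no side conditions. *)
Definition II (f : R -> C) (l : C) : Prop :=
  cont01 f /\ Flim F01 (fun ab => IntC f (fst ab) (snd ab)) l.

Lemma F01_intro (P : R * R -> Prop) a0 b0 : (0 < a0)%R -> (b0 < 1)%R ->
  (forall a b, (0 < a < a0)%R -> (b0 < b < 1)%R -> P (a, b)) -> F01 P.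
Proof.
  intros Ha Hb H.
  apply (Filter_prod _ _ _ (fun a => 0 < a < a0)%R (fun b => b0 < b < 1)%R).
  - exists (mkposreal _ Ha). intros y Hy Hy0. split; auto.
    assert (Hy' : (Rabs (y - 0) < a0)%R) by exact Hy. apply Rabs_def2 in Hy'. lra.
  - assert (Hb' : (0 < 1 - b0)%R) by lra. exists (mkposreal _ Hb'). intros y Hy Hy0. split; auto.
    assert (Hy' : (Rabs (y - 1) < 1 - b0)%R) by exact Hy. apply Rabs_def2 in Hy'. lra.
  - intros; auto.
Qed.

Lemma F01_lt : F01 (fun ab => (0 < fst ab /\ fst ab <= snd ab /\ snd ab < 1)%R).
Proof.
  apply F01_intro with (1/2)%R (1/2)%R; try lra. intros; simpl; lra.
Qed.

Lemma ex_RInt_cont (g : R -> R) a b : (a <= b)%R ->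
  (forall t, (a <= t <= b)%R -> continuous g t) -> ex_RInt g a b.
Proof.
  intros Hab H. apply (ex_RInt_continuous (V := R_CompleteNormedModule)).
  intros z. rewrite Rmin_left, Rmax_right by auto. auto.
Qed.

Lemma IntC_ext f g a b : (a <= b)%R -> (forall t, (a < t < b)%R -> f t = g t) -> IntC f a b = IntC g a b.
Proof.
  intros Hab H. unfold IntC. f_equal; apply RInt_ext; intros x;
  rewrite Rmin_left, Rmax_right by auto; intros Hx; rewrite H; auto.
Qed.

Lemma IntC_plus f g a b : (a <= b)%R -> (forall t, (a <= t <= b)%R -> ccont f t) ->
  (forall t, (a <= t <= b)%R -> ccont g t) -> IntC (fun t => f t + g t) a b = IntC f a b + IntC g a b.
Proof.
  intros Hab Hf Hg. apply C_ext.
  - exact (RInt_plus (V := R_CompleteNormedModule) (fun t => Re (f t)) (fun t => Re (g t)) a b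
     (ex_RInt_cont _ _ _ Hab (fun t Ht => proj1 (Hf t Ht))) (ex_RInt_cont _ _ _ Hab (fun t Ht => proj1 (Hg t Ht)))).
  - exact (RInt_plus (V := R_CompleteNormedModule) (fun t => Im (f t)) (fun t => Im (g t)) a b
     (ex_RInt_cont _ _ _ Hab (fun t Ht => proj2 (Hf t Ht))) (ex_RInt_cont _ _ _ Hab (fun t Ht => proj2 (Hg t Ht)))).
Qed.

Lemma IntC_scal (z : C) f a b : (a <= b)%R -> (forall t, (a <= t <= b)%R -> ccont f t) ->
  IntC (fun t => z * f t) a b = z * IntC f a b.
Proof.
  intros Hab Hf.
  pose proof (ex_RInt_cont _ _ _ Hab (fun t Ht => proj1 (Hf t Ht))) as H1.
  pose proof (ex_RInt_cont _ _ _ Hab (fun t Ht => proj2 (Hf t Ht))) as H2.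
  apply C_ext.
  - transitivity (Re z * RInt (fun t => Re (f t)) a b - Im z * RInt (fun t => Im (f t)) a b)%R; [|reflexivity].
    transitivity (RInt (fun t => minus (scal (Re z) (Re (f t))) (scal (Im z) (Im (f t)))) a b).
    reflexivity.
    rewrite (RInt_minus (V := R_CompleteNormedModule)), !(RInt_scal (V := R_CompleteNormedModule)); auto;
    apply (ex_RInt_scal (V := R_NormedModule)); auto.
  - transitivity (Re z * RInt (fun t => Im (f t)) a b + Im z * RInt (fun t => Re (f t)) a b)%R; [|reflexivity].
    transitivity (RInt (fun t => plus (scal (Re z) (Im (f t))) (scal (Im z) (Re (f t)))) a b).
    reflexivity.
    rewrite (RInt_plus (V := R_CompleteNormedModule)), !(RInt_scal (V := R_CompleteNormedModule)); auto;
    apply (ex_RInt_scal (V := R_NormedModule)); auto.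
Qed.

Lemma IntC_Chasles f a b c : (a <= b)%R -> (b <= c)%R -> (forall t, (a <= t <= c)%R -> ccont f t) ->
  IntC f a b + IntC f b c = IntC f a c.
Proof.
  intros Hab Hbc Hf. apply C_ext.
  - apply (RInt_Chasles (V := R_CompleteNormedModule) (fun t => Re (f t)) a b c);
    apply ex_RInt_cont; auto; intros t Ht; apply Hf; lra.
  - apply (RInt_Chasles (V := R_CompleteNormedModule) (fun t => Im (f t)) a b c);
    apply ex_RInt_cont; auto; intros t Ht; apply Hf; lra.
Qed.

(* The constant [2] comes from bounding the real and imaginary parts separately. *)
Lemma IntC_bound f (g : R -> R) a b : (a <= b)%R -> (forall t, (a <= t <= b)%R -> ccont f t) ->
  (forall t, (a <= t <= b)%R -> continuous g t) ->
  (forall t, (a < t < b)%R -> (Cmod (f t) <= g t)%R) ->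
  (Cmod (IntC f a b) <= 2 * RInt g a b)%R.
Proof.
  intros Hab Hf Hg H.
  eapply Rle_trans. apply Cmod_le_Re_Im.
  assert (Hr : forall u : R -> R, (forall t, (a <= t <= b)%R -> continuous u t) ->
    (forall t, (a < t < b)%R -> (Rabs (u t) <= g t)%R) -> (Rabs (RInt u a b) <= RInt g a b)%R).
  { intros u Hu Hug. pose proof (ex_RInt_cont _ _ _ Hab Hu) as H1. pose proof (ex_RInt_cont _ _ _ Hab Hg) as H2.
    apply Rabs_le. split.
    - rewrite <- (RInt_opp (V := R_CompleteNormedModule)) by auto.
      apply RInt_le; auto. apply (ex_RInt_opp (V := R_NormedModule)); auto.
      intros t Ht. specialize (Hug t Ht). apply Rabs_le_between in Hug. change (- g t <= u t)%R. lra.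
    - apply RInt_le; auto. intros t Ht. specialize (Hug t Ht). apply Rabs_le_between in Hug. lra. }
  pose proof (Hr (fun t => Re (f t)) (fun t Ht => proj1 (Hf t Ht)) (fun t Ht => Rle_trans _ _ _ (Rabs_Re_le _) (H t Ht))).
  pose proof (Hr (fun t => Im (f t)) (fun t Ht => proj2 (Hf t Ht)) (fun t Ht => Rle_trans _ _ _ (Rabs_Im_le _) (H t Ht))).
  unfold IntC at 1 2. simpl. unfold Re, Im in *. simpl in *. lra.
Qed.

Lemma II_unique f l1 l2 : II f l1 -> II f l2 -> l1 = l2.
Proof.
  intros [_ H1] [_ H2]. apply (Flim_iff F01) in H1. apply (Flim_iff F01) in H2.
  exact (filterlim_locally_unique (V := C_NormedModule) (F := F01) _ l1 l2 H1 H2).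
Qed.

Lemma ccont_ext_loc f g t : locally t (fun s => f s = g s) -> ccont f t -> ccont g t.
Proof.
  intros H [H1 H2]. split.
  - apply continuous_ext_loc with (fun s => Re (f s)); auto.
    generalize H. apply filter_imp. intros x ->. reflexivity.
  - apply continuous_ext_loc with (fun s => Im (f s)); auto.
    generalize H. apply filter_imp. intros x ->. reflexivity.
Qed.

Lemma locally_01 t : (0 < t < 1)%R -> locally t (fun s => 0 < s < 1)%R.
Proof.
  intros Ht. apply (locally_interval _ t 0 1); simpl; try lra. intros; auto.
Qed.

Lemma II_ext f g l : (forall t, (0 < t < 1)%R -> f t = g t) -> II f l -> II g l.
Proof.
  intros H [Hc Hl]. split.
  - intros t Ht. apply ccont_ext_loc with f; auto.
    generalize (locally_01 t Ht). apply filter_imp. auto.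
  - apply (Flim_ext_ev F01 (fun ab => IntC f (fst ab) (snd ab))); auto.
    generalize F01_lt. apply filter_imp. intros [a b]; simpl. intros. apply IntC_ext. lra. intros; apply H; lra.
Qed.

Lemma II_plus f g lf lg : II f lf -> II g lg -> II (fun t => f t + g t) (lf + lg).
Proof.
  intros [Hc Hl] [Hc' Hl']. split.
  - intros t Ht. apply ccont_plus; auto.
  - apply (Flim_ext_ev F01 (fun ab => IntC f (fst ab) (snd ab) + IntC g (fst ab) (snd ab))).
    + generalize F01_lt. apply filter_imp. intros [a b]; simpl. intros. symmetry.
      apply IntC_plus. lra. intros; apply Hc; lra. intros; apply Hc'; lra.
    + apply (Flim_plus F01); auto.
Qed.

Lemma II_scal (z : C) f l : II f l -> II (fun t => z * f t) (z * l).
Proof.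
  intros [Hc Hl]. split.
  - intros t Ht. apply ccont_mult; auto. apply ccont_const.
  - apply (Flim_ext_ev F01 (fun ab => z * IntC f (fst ab) (snd ab))).
    + generalize F01_lt. apply filter_imp. intros [a b]; simpl. intros. symmetry.
      apply IntC_scal. lra. intros; apply Hc; lra.
    + apply (Flim_mult F01); auto. apply (Flim_const F01).
Qed.

Lemma II_sum (f : nat -> R -> C) (l : nat -> C) N : (forall n, II (f n) (l n)) ->
  II (fun t => sum_n (fun n => f n t) N) (sum_n l N).
Proof.
  intros H. induction N.
  - rewrite Csum_O. apply II_ext with (f 0%nat); auto. intros; now rewrite Csum_O.
  - rewrite Csum_Sn. apply II_ext with (fun t => sum_n (fun n => f n t) N + f (S N) t).
    intros; now rewrite Csum_Sn. apply II_plus; auto.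
Qed.

(** Cauchy's criterion: once the integral of [g] over [[a0, b0]] is close to the supremum of all of
    them, enlarging the interval adds little to the integral of [g], hence little to that of [f]. *)
Lemma II_dominated f (g : R -> R) M : cont01 f -> (forall t, (0 < t < 1)%R -> continuous g t) ->
  (forall t, (0 < t < 1)%R -> (Cmod (f t) <= g t)%R) ->
  (forall a b, (0 < a)%R -> (a <= b)%R -> (b < 1)%R -> (RInt g a b <= M)%R) ->
  exists l, II f l.
Proof.
  intros Hf Hg Hfg HM.
  set (E := fun r => exists a b, (0 < a)%R /\ (a <= b)%R /\ (b < 1)%R /\ r = RInt g a b).
  destruct (completeness E) as [m [Hub Hlub]].
  { exists M. intros r [a [b [H1 [H2 [H3 ->]]]]]. auto. }
  { exists (RInt g (1/2) (1/2)). exists (1/2)%R, (1/2)%R. repeat split; lra. }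
  assert (Hc : exists y : C, filterlim (fun ab => IntC f (fst ab) (snd ab)) F01 (locally y)).
  { apply (proj1 (filterlim_locally_cauchy (U := C_CompleteNormedModule) (F := F01) (fun ab => IntC f (fst ab) (snd ab)))).
    intros eps.
    (* Two intervals are compared with [[a0, b0]], each at a cost of [2 * (eps / 8)], so together
       [eps / 2]. *)
    assert (He : (0 < eps / 8)%R) by (pose proof (cond_pos eps); lra).
    assert (Hex : exists a0 b0, (0 < a0)%R /\ (a0 <= b0)%R /\ (b0 < 1)%R /\ (m - eps / 8 < RInt g a0 b0)%R).
    { destruct (Classical_Prop.classic (exists a0 b0, (0 < a0)%R /\ (a0 <= b0)%R /\ (b0 < 1)%R /\ (m - eps / 8 < RInt g a0 b0)%R)) as [|Hn]; auto.
      exfalso. assert (m <= m - eps / 8)%R; [|lra]. apply Hlub. intros r [a [b [H1 [H2 [H3 ->]]]]].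
      destruct (Rle_lt_dec (RInt g a b) (m - eps / 8)); auto. exfalso. apply Hn. exists a, b. auto. }
    destruct Hex as [a0 [b0 [Ha0 [Hab0 [Hb0 Hm0]]]]].
    assert (Hclose : forall a b, (0 < a < a0)%R -> (b0 < b < 1)%R ->
      (Cmod (IntC f a b - IntC f a0 b0) <= 2 * (eps / 8))%R).
    { intros a b Ha Hb.
      assert (E1 : IntC f a b - IntC f a0 b0 = IntC f a a0 + IntC f b0 b).
      { rewrite <- (IntC_Chasles f a a0 b), <- (IntC_Chasles f a0 b0 b); try lra; try (intros; apply Hf; lra). ring. }
      rewrite E1. eapply Rle_trans. apply Cmod_triangle.
      assert (E2 : (RInt g a b = RInt g a a0 + (RInt g a0 b0 + RInt g b0 b))%R).
      { rewrite <- (RInt_Chasles (V := R_CompleteNormedModule) g a a0 b), <- (RInt_Chasles (V := R_CompleteNormedModule) g a0 b0 b).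
        reflexivity. all: apply ex_RInt_cont; [lra|intros; apply Hg; lra]. }
      assert (H2 : (RInt g a b <= m)%R) by (apply Hub; exists a, b; repeat split; lra).
      pose proof (IntC_bound f g a a0 ltac:(lra) ltac:(intros; apply Hf; lra) ltac:(intros; apply Hg; lra) ltac:(intros; apply Hfg; lra)).
      pose proof (IntC_bound f g b0 b ltac:(lra) ltac:(intros; apply Hf; lra) ltac:(intros; apply Hg; lra) ltac:(intros; apply Hfg; lra)).
      lra. }
    exists (fun ab => (0 < fst ab < a0)%R /\ (b0 < snd ab < 1)%R). split.
    - apply F01_intro with a0 b0; auto.
    - intros [a b] [a' b'] [H1 H2] [H3 H4]. simpl in *.
      apply C_NormedModule_mixin_compat1.
      change (Cmod (IntC f a' b' - IntC f a b) < eps)%R.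
      replace (IntC f a' b' - IntC f a b) with ((IntC f a' b' - IntC f a0 b0) + - (IntC f a b - IntC f a0 b0)) by ring.
      eapply Rle_lt_trans. apply Cmod_triangle. rewrite Cmod_opp.
      pose proof (Hclose a b H1 H2). pose proof (Hclose a' b' H3 H4). pose proof (cond_pos eps). lra. }
  destruct Hc as [l Hl]. exists l. split; auto. apply (Flim_iff F01). exact Hl.
Qed.

Lemma II_FTC F f (l0 l1 : C) : (forall t, (0 < t < 1)%R -> cderiv F t (f t)) -> cont01 f ->
  Flim (at_right 0) F l0 -> Flim (at_left 1) F l1 -> II f (l1 - l0).
Proof.
  intros HF Hf H0 H1. split; auto.
  apply (Flim_ext_ev F01 (fun ab => F (snd ab) + - 1 * F (fst ab))).
  - generalize F01_lt. apply filter_imp. intros [a b]. simpl. intros Hab.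
    assert (Hr : forall u du : R -> R, (forall t, (0 < t < 1)%R -> is_derive u t (du t)) ->
      (forall t, (0 < t < 1)%R -> continuous du t) -> RInt du a b = (u b - u a)%R).
    { intros u du Hu Hdu. apply is_RInt_unique. apply (is_RInt_derive (V := R_CompleteNormedModule) u du).
      - intros x. rewrite Rmin_left, Rmax_right by lra. intros; apply Hu; lra.
      - intros x. rewrite Rmin_left, Rmax_right by lra. intros; apply Hdu; lra. }
    unfold IntC. rewrite (Hr (fun t => Re (F t)) (fun t => Re (f t))), (Hr (fun t => Im (F t)) (fun t => Im (f t))).
    + apply C_ext; unfold Re, Im; simpl; ring.
    + intros t Ht; apply HF; auto.
    + intros t Ht; apply Hf; auto.
    + intros t Ht; apply HF; auto.
    + intros t Ht; apply Hf; auto.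
  - replace (l1 - l0) with (l1 + - 1 * l0) by ring.
    apply (Flim_plus F01).
    + intros eps He. specialize (H1 eps He).
      apply (Filter_prod _ _ _ (fun _ => True) _ (filter_true) H1). intros; auto.
    + apply (Flim_mult F01). apply (Flim_const F01). intros eps He. specialize (H0 eps He).
      apply (Filter_prod _ _ _ _ (fun _ => True) H0 (filter_true)). intros; auto.
Qed.

Lemma ccont_iff f (t : R) : ccont f t <-> Flim (locally t) f (f t).
Proof.
  split.
  - intros [H1 H2] eps He. assert (He2 : (0 < eps / 2)%R) by lra.
    assert (H1' : locally t (fun s => Rabs (Re (f s) - Re (f t)) < eps / 2)%R)
      by exact (H1 _ (locally_ball (Re (f t)) (mkposreal _ He2))).
    assert (H2' : locally t (fun s => Rabs (Im (f s) - Im (f t)) < eps / 2)%R)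
      by exact (H2 _ (locally_ball (Im (f t)) (mkposreal _ He2))).
    generalize (filter_and _ _ H1' H2'). apply filter_imp. intros s [Hs1 Hs2].
    eapply Rle_lt_trans. apply Cmod_le_Re_Im.
    assert (E1 : (Rabs (Re (f s) - Re (f t)) < eps / 2)%R) by exact Hs1.
    assert (E2 : (Rabs (Im (f s) - Im (f t)) < eps / 2)%R) by exact Hs2.
    replace (Re (f s - f t)) with (Re (f s) - Re (f t))%R by reflexivity.
    replace (Im (f s - f t)) with (Im (f s) - Im (f t))%R by reflexivity. lra.
  - intros H. split; intros P [eps HP]; unfold filtermap; generalize (H eps (cond_pos eps)); apply filter_imp; intros s Hs; apply HP.
    + eapply Rle_lt_trans; [|exact Hs]. apply (Rabs_Re_le (f s - f t)).
    + eapply Rle_lt_trans; [|exact Hs]. apply (Rabs_Im_le (f s - f t)).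
Qed.

Lemma ccont_sum (f : nat -> R -> C) N t : (forall n, ccont (f n) t) -> ccont (fun s => sum_n (fun n => f n s) N) t.
Proof.
  intros H. induction N.
  - apply ccont_ext_loc with (f 0%nat); auto. apply filter_forall. intros; now rewrite Csum_O.
  - apply ccont_ext_loc with (fun s => sum_n (fun n => f n s) N + f (S N) s).
    apply filter_forall. intros; now rewrite Csum_Sn. apply ccont_plus; auto.
Qed.

Lemma IntC_sum (f : nat -> R -> C) N a b : (a <= b)%R ->
  (forall n t, (a <= t <= b)%R -> ccont (f n) t) ->
  IntC (fun t => sum_n (fun n => f n t) N) a b = sum_n (fun n => IntC (f n) a b) N.
Proof.
  intros Hab H. induction N.
  - rewrite Csum_O. apply IntC_ext; auto. intros; now rewrite Csum_O.
  - rewrite Csum_Sn, <- IHN, <- IntC_plus; auto.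
    apply IntC_ext; auto. intros; now rewrite Csum_Sn. intros; apply ccont_sum; auto.
Qed.

(** [M] gives uniform convergence on compact subintervals, hence continuity of the sum and termwise
    proper integration. [J] bounds the proper integrals independently of the endpoints, so dominated
    convergence moves the endpoints to [0] and [1]. *)
Lemma II_series (phi : nat -> R -> C) (J : nat -> R) (I : nat -> C) (F : R -> C) :
  (forall n, II (phi n) (I n)) ->
  (forall n a b, (0 < a)%R -> (a <= b)%R -> (b < 1)%R -> (Cmod (IntC (phi n) a b) <= J n)%R) ->
  ex_series J ->
  (forall a b, (0 < a)%R -> (a <= b)%R -> (b < 1)%R -> exists M, ex_series M /\
    forall n t, (a <= t <= b)%R -> (Cmod (phi n t) <= M n)%R) ->
  (forall t, (0 < t < 1)%R -> is_Cseries (fun n => phi n t) (F t)) ->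
  exists S, is_Cseries I S /\ II F S.
Proof.
  intros HI HJ HJs HM HF.
  assert (Hunif : forall a b, (0 < a)%R -> (a <= b)%R -> (b < 1)%R -> forall eps, (0 < eps)%R ->
    exists N, forall K t, (N <= K)%nat -> (a <= t <= b)%R -> (Cmod (F t - sum_n (fun n => phi n t) K) < eps)%R).
  { intros a b Ha Hab Hb eps He. destruct (HM a b Ha Hab Hb) as [M [HMs HMb]].
    assert (HMp : forall n, (0 <= M n)%R).
    { intros n. eapply Rle_trans. apply Cmod_ge_0. apply (HMb n a). lra. }
    destruct (Series_tail_small M eps He HMp HMs) as [N HN]. exists N. intros K t HK Ht.
    eapply Rle_lt_trans. apply (is_series_tail _ M). intros; apply HMb; auto. auto. apply HF; lra.
    pose proof (Rsum_incr M N K HMp HK). lra. }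
  assert (HcF : cont01 F).
  { intros t Ht. apply ccont_iff. intros eps He.
    assert (He3 : (0 < eps / 3)%R) by lra.
    assert (Ha : (0 < t / 2)%R) by lra. assert (Hb : ((1 + t) / 2 < 1)%R) by lra.
    assert (Hab : (t / 2 <= (1 + t) / 2)%R) by lra.
    destruct (Hunif (t / 2)%R ((1 + t) / 2)%R Ha Hab Hb (eps / 3)%R He3) as [N HN].
    assert (Hs : ccont (fun s => sum_n (fun n => phi n s) N) t).
    { apply ccont_sum. intros n. apply (proj1 (HI n)). auto. }
    apply ccont_iff in Hs. specialize (Hs _ He3).
    assert (Hloc : locally t (fun s => t / 2 <= s <= (1 + t) / 2)%R).
    { apply (locally_interval _ t (t/2)%R ((1+t)/2)%R); simpl; try lra. intros; lra. }
    generalize (filter_and _ _ Hs Hloc). apply filter_imp. intros s [Hs1 Hs2].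
    pose proof (HN N s (Nat.le_refl N) Hs2). assert (Ht2 : (t / 2 <= t <= (1 + t) / 2)%R) by lra.
    pose proof (HN N t (Nat.le_refl N) Ht2).
    replace (F s - F t) with ((F s - sum_n (fun n => phi n s) N) + ((sum_n (fun n => phi n s) N - sum_n (fun n => phi n t) N) + - (F t - sum_n (fun n => phi n t) N))) by ring.
    eapply Rle_lt_trans. apply Cmod_triangle. eapply Rle_lt_trans. apply Rplus_le_compat_l, Cmod_triangle.
    rewrite Cmod_opp. lra. }
  assert (HIJ : forall n, (Cmod (I n) <= J n)%R).
  { intros n. apply (Flim_Cmod_le F01 _ _ _ (proj2 (HI n))).
    generalize F01_lt. apply filter_imp. intros [a b]; simpl. intros. apply HJ; lra. }
  destruct (is_series_dominated I J HIJ HJs) as [S HS]. exists S. split; auto. split; auto.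
  apply (tannery F01 (fun ab n => IntC (phi n) (fst ab) (snd ab)) J I); auto.
  - generalize F01_lt. apply filter_imp. intros [a b]; simpl. intros. apply HJ; lra.
  - intros n. apply (proj2 (HI n)).
  - generalize F01_lt. apply filter_imp. intros [a b]; simpl. intros [Ha [Hab Hb]].
    apply is_series_C_iff. intros eps He.
    (* The integral bound doubles [eps / 4], and the interval is shorter than [1]. *)
    assert (He2 : (0 < eps / 4)%R) by lra.
    destruct (Hunif a b Ha Hab Hb _ He2) as [N HN]. exists N. intros K HK.
    rewrite <- IntC_sum; auto. 2:{ intros; apply (proj1 (HI n)); lra. }
    assert (Hcs : forall t, (a <= t <= b)%R -> ccont (fun s => sum_n (fun n => phi n s) K) t).
    { intros t Ht. apply ccont_sum. intros n; apply (proj1 (HI n)); lra. }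
    assert (HcF' : forall t, (a <= t <= b)%R -> ccont F t) by (intros; apply HcF; lra).
    replace (IntC (fun t => sum_n (fun n => phi n t) K) a b - IntC F a b) with
      (IntC (fun t => sum_n (fun n => phi n t) K + (- 1) * F t) a b).
    2:{ rewrite IntC_plus, IntC_scal; auto. ring. intros; apply ccont_mult; auto. apply ccont_const. }
    eapply Rle_lt_trans. apply (IntC_bound _ (fun _ => eps / 4)%R); auto.
    + intros t Ht. apply ccont_plus; auto. apply ccont_mult; auto. apply ccont_const.
    + intros; apply continuous_const.
    + intros t Ht. assert (Ht' : (a <= t <= b)%R) by lra. left.
      replace (sum_n (fun n => phi n t) K + - 1 * F t) with (- (F t - sum_n (fun n => phi n t) K)) by cring.
      rewrite Cmod_opp. auto.
    + rewrite RInt_const. change (2 * ((b - a) * (eps / 4)) < eps)%R. nra.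
Qed.

(** * The Beta integral *)

(** The Beta kernel, with [p] attached to [1 - t] and [q] to [t]. It is later used with [p = c] and
    [q = rho]. *)
Definition bk (p q : C) (t : R) : C := Rcpow t (q - 1) * Rcpow (1 - t) (p - 1).

Definition rbk (P Q t : R) : R := (Rpower t (Q - 1) * Rpower (1 - t) (P - 1))%R.

Lemma Cmod_bk p q t : Cmod (bk p q t) = rbk (Re p) (Re q) t.
Proof.
  unfold bk, rbk. rewrite Cmod_mult, !Cmod_Rcpow.
  replace (Re (q - 1)) with (Re q - 1)%R by (unfold Re; simpl; ring).
  replace (Re (p - 1)) with (Re p - 1)%R by (unfold Re; simpl; ring). reflexivity.
Qed.

Lemma RtoC_rbk P Q t : RtoC (rbk P Q t) = bk P Q t.
Proof.
  unfold bk, rbk. rewrite RtoC_mult, <- !Rcpow_R, !RtoC_minus. reflexivity.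
Qed.

Lemma rbk_pos P Q t : (0 < rbk P Q t)%R.
Proof. apply Rmult_lt_0_compat; apply exp_pos. Qed.

Lemma cderiv_Rcpow_1m t z : (t < 1)%R -> cderiv (fun s => Rcpow (1 - s) z) t (- (z * Rcpow (1 - t) (z - 1))).
Proof.
  intros Ht. assert (Ht1 : (0 < 1 - t)%R) by lra.
  assert (Hd : is_derive (fun s => 1 - s)%R t (-1)%R) by (auto_derive; auto; ring).
  eapply cderiv_eq; [|exact (cderiv_comp (fun s => Rcpow s z) (fun s => 1 - s)%R t _ _ (cderiv_Rcpow (1 - t) z Ht1) Hd)].
  ring.
Qed.

Lemma cont01_bk p q : cont01 (bk p q).
Proof.
  intros t Ht. apply ccont_mult.
  - eapply cderiv_ccont. apply cderiv_Rcpow. lra.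
  - eapply cderiv_ccont. apply cderiv_Rcpow_1m. lra.
Qed.

Lemma continuous_rbk P Q t : (0 < t < 1)%R -> continuous (rbk P Q) t.
Proof.
  intros Ht. destruct (cont01_bk P Q t Ht) as [H _].
  apply (continuous_ext (fun s => Re (bk P Q s))); auto.
  intros s. rewrite <- RtoC_rbk. reflexivity.
Qed.

Lemma Rpower_le_1 t e : (0 < t <= 1)%R -> (0 <= e)%R -> (Rpower t e <= 1)%R.
Proof.
  intros Ht He. unfold Rpower. rewrite <- exp_0.
  assert (H : (e * ln t <= 0)%R).
  { assert (ln t <= 0)%R by (rewrite <- ln_1; apply ln_le; lra). nra. }
  destruct H as [H|H]. left; apply exp_increasing; auto. rewrite H. lra.
Qed.

Lemma Rpower_half_bound s e : (1 / 2 <= s <= 1)%R -> (Rpower s e <= 1 + Rpower (1 / 2) e)%R.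
Proof.
  intros Hs. pose proof (exp_pos (e * ln (1 / 2))) as H0. fold (Rpower (1 / 2) e) in H0.
  destruct (Rle_lt_dec 0 e) as [He|He].
  - pose proof (Rpower_le_1 s e). lra.
  - assert (Rpower s e <= Rpower (1 / 2) e)%R; [|lra].
    unfold Rpower. assert (ln (1 / 2) <= ln s)%R by (apply ln_le; lra).
    assert (H1 : (e * ln s <= e * ln (1 / 2))%R) by nra.
    destruct H1 as [H1|H1]. left; apply exp_increasing; auto. rewrite H1. lra.
Qed.

(** On either half of the interval one of the two powers is bounded, so the kernel is below a sum of
    two pure powers with an explicit antiderivative. *)
Lemma rbk_RInt_bounded P Q : (0 < P)%R -> (0 < Q)%R ->
  exists M, (0 <= M)%R /\ forall a b, (0 < a)%R -> (a <= b)%R -> (b < 1)%R -> (RInt (rbk P Q) a b <= M)%R.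
Proof.
  intros HP HQ.
  (* [K1] bounds [(1 - t)^(P - 1)] for [t <= 1/2] and [K2] bounds [t^(Q - 1)] for [t >= 1/2]; the
     [1 +] covers exponents of either sign. *)
  set (K1 := (1 + Rpower (1 / 2) (P - 1))%R). set (K2 := (1 + Rpower (1 / 2) (Q - 1))%R).
  assert (HK1 : (0 < K1)%R) by (unfold K1; pose proof (exp_pos ((P - 1) * ln (1 / 2))); unfold Rpower; lra).
  assert (HK2 : (0 < K2)%R) by (unfold K2; pose proof (exp_pos ((Q - 1) * ln (1 / 2))); unfold Rpower; lra).
  exists (K1 / Q + K2 / P)%R. split. { assert (0 < K1 / Q)%R by (apply Rdiv_lt_0_compat; auto). assert (0 < K2 / P)%R by (apply Rdiv_lt_0_compat; auto). lra. }
  intros a b Ha Hab Hb.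
  set (F := fun t => (K1 / Q * Rpower t Q - K2 / P * Rpower (1 - t) P)%R).
  set (f := fun t => (K1 * Rpower t (Q - 1) + K2 * Rpower (1 - t) (P - 1))%R).
  assert (HF : forall t, (0 < t < 1)%R -> is_derive F t (f t)).
  { intros t Ht.
    assert (H1 : is_derive (fun s => Rpower s Q) t (Q * Rpower t (Q - 1))%R).
    { pose proof (proj1 (cderiv_Rcpow t Q (proj1 Ht))) as H.
      apply (is_derive_ext (fun s => Re (Rcpow s Q))). intros s; rewrite Rcpow_R; reflexivity.
      rewrite <- RtoC_minus, Rcpow_R in H. replace (Q * Rpower t (Q - 1))%R with (Re (Q * Rpower t (Q - 1))%C) by (unfold Re; simpl; ring). exact H. }
    assert (H2 : is_derive (fun s => Rpower (1 - s) P) t (- (P * Rpower (1 - t) (P - 1)))%R).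
    { pose proof (proj1 (cderiv_Rcpow_1m t P (proj2 Ht))) as H.
      apply (is_derive_ext (fun s => Re (Rcpow (1 - s) P))). intros s; rewrite Rcpow_R; reflexivity.
      rewrite <- RtoC_minus, Rcpow_R in H. replace (- (P * Rpower (1 - t) (P - 1)))%R with (Re (- (P * Rpower (1 - t) (P - 1)))%C) by (unfold Re; simpl; ring). exact H. }
    unfold F, f.
    pose proof (is_derive_minus (K := R_AbsRing) (V := R_NormedModule) _ _ t _ _
      (is_derive_scal _ t (K1 / Q)%R _ H1) (is_derive_scal _ t (K2 / P)%R _ H2)) as H.
    eapply is_derive_ext; [|eapply eq_ind; [exact H|]].
    - intros s. reflexivity.
    - unfold minus, plus, opp, scal; simpl. unfold mult; simpl. field. lra. }
  assert (Hf : forall t, (0 < t < 1)%R -> continuous f t).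
  { intros t Ht. unfold f. apply (continuous_plus (V := R_NormedModule)).
    - apply (continuous_ext (fun s => K1 * rbk 1 Q s)%R).
      { intros s. unfold rbk. rewrite Rminus_diag. unfold Rpower at 2. rewrite Rmult_0_l, exp_0. rring. }
      apply (continuous_scal_r (K := R_AbsRing) (V := R_NormedModule)). apply continuous_rbk; auto.
    - apply (continuous_ext (fun s => K2 * rbk P 1 s)%R).
      { intros s. unfold rbk. rewrite Rminus_diag. unfold Rpower at 1. rewrite Rmult_0_l, exp_0. rring. }
      apply (continuous_scal_r (K := R_AbsRing) (V := R_NormedModule)). apply continuous_rbk; auto. }
  apply Rle_trans with (RInt f a b).
  - apply RInt_le; auto.
    + apply ex_RInt_cont; auto. intros; apply continuous_rbk; lra.
    + apply ex_RInt_cont; auto. intros; apply Hf; lra.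
    + intros t Ht. unfold f, rbk.
      pose proof (exp_pos ((Q - 1) * ln t)) as E1. fold (Rpower t (Q - 1)) in E1.
      pose proof (exp_pos ((P - 1) * ln (1 - t))) as E2. fold (Rpower (1 - t) (P - 1)) in E2.
      destruct (Rle_lt_dec t (1 / 2)) as [Hh|Hh].
      * pose proof (Rpower_half_bound (1 - t) (P - 1) ltac:(lra)) as Hb1. fold K1 in Hb1. nra.
      * pose proof (Rpower_half_bound t (Q - 1) ltac:(lra)) as Hb1. fold K2 in Hb1. nra.
  - rewrite (is_RInt_unique f a b (minus (F b) (F a))).
    + change (F b - F a <= K1 / Q + K2 / P)%R. unfold F.
      pose proof (exp_pos (Q * ln a)) as E1. fold (Rpower a Q) in E1.
      pose proof (exp_pos (P * ln (1 - b))) as E2. fold (Rpower (1 - b) P) in E2.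
      pose proof (Rpower_le_1 b Q ltac:(lra) ltac:(lra)).
      pose proof (Rpower_le_1 (1 - a) P ltac:(lra) ltac:(lra)).
      assert (0 < K1 / Q)%R by (apply Rdiv_lt_0_compat; auto).
      assert (0 < K2 / P)%R by (apply Rdiv_lt_0_compat; auto). nra.
    + apply (is_RInt_derive (V := R_CompleteNormedModule) F f).
      * intros x. rewrite Rmin_left, Rmax_right by lra. intros; apply HF; lra.
      * intros x. rewrite Rmin_left, Rmax_right by lra. intros; apply Hf; lra.
Qed.

Lemma II_bk_dominated f K P Q : (0 < P)%R -> (0 < Q)%R -> (0 <= K)%R -> cont01 f ->
  (forall t, (0 < t < 1)%R -> (Cmod (f t) <= K * rbk P Q t)%R) -> exists l, II f l.
Proof.
  intros HP HQ HK Hf Hb. destruct (rbk_RInt_bounded P Q HP HQ) as [M [HM0 HM]].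
  apply (II_dominated f (fun t => K * rbk P Q t)%R (K * M)%R); auto.
  - intros t Ht. apply (continuous_scal_r (K := R_AbsRing) (V := R_NormedModule)). apply continuous_rbk; auto.
  - intros a b Ha Hab Hb1. rewrite (RInt_scal (V := R_CompleteNormedModule) (rbk P Q)).
    + apply Rmult_le_compat_l; auto.
    + apply ex_RInt_cont; auto. intros; apply continuous_rbk; lra.
Qed.

Definition Bv (p q : C) : C := iota (T := C_CompleteNormedModule) (II (bk p q)).

Lemma Bv_unique p q l : II (bk p q) l -> Bv p q = l.
Proof.
  intros H. apply (iota_unique (K := C_AbsRing) (V := C_CompleteNormedModule)); auto.
  intros y Hy. eapply II_unique; eauto.
Qed.

Lemma II_bk p q : (0 < Re p)%R -> (0 < Re q)%R -> II (bk p q) (Bv p q).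
Proof.
  intros Hp Hq. destruct (II_bk_dominated (bk p q) 1 (Re p) (Re q)) as [l Hl]; auto.
  lra. apply cont01_bk. intros. rewrite Cmod_bk. lra.
  rewrite (Bv_unique _ _ _ Hl). exact Hl.
Qed.

Lemma II_Re_nonneg f l : II f l -> (forall t, (0 < t < 1)%R -> (0 <= Re (f t))%R) -> (0 <= Re l)%R.
Proof.
  intros [Hc Hl] Hf. apply Rnot_lt_le. intros Hneg.
  assert (He : (0 < - Re l)%R) by lra.
  destruct (filter_ex (F := F01) _ (filter_and _ _ (Hl _ He) F01_lt)) as [[a b] [H1 H2]]. simpl in *.
  assert (0 <= Re (IntC f a b))%R.
  { apply (RInt_ge_0 (fun t => Re (f t)) a b). lra. apply ex_RInt_cont. lra. intros; apply Hc; lra. intros; apply Hf; lra. }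
  pose proof (Rabs_Re_le (IntC f a b - l)) as H3.
  replace (Re (IntC f a b - l)) with (Re (IntC f a b) - Re l)%R in H3 by reflexivity.
  rewrite Rabs_pos_eq in H3 by lra. lra.
Qed.

Lemma II_Re_le f1 f2 l1 l2 : II f1 l1 -> II f2 l2 ->
  (forall t, (0 < t < 1)%R -> (Re (f1 t) <= Re (f2 t))%R) -> (Re l1 <= Re l2)%R.
Proof.
  intros H1 H2 H.
  assert (Hd : (0 <= Re (l2 + (-1) * l1))%R).
  { apply (II_Re_nonneg (fun t => f2 t + (-1) * f1 t)). apply II_plus; auto. apply II_scal; auto.
    intros t Ht. specialize (H t Ht). unfold Re in *. simpl. lra. }
  unfold Re in *. simpl in Hd. lra.
Qed.

(** As [g] is nonnegative, its integral over [[a, b]] does not exceed the improper one. The bound is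
    independent of the endpoints, as termwise integration requires. *)
Lemma II_IntC_bound f (g : R -> R) G a b : cont01 f -> II (fun t => RtoC (g t)) G ->
  (forall t, (0 < t < 1)%R -> (Cmod (f t) <= g t)%R) ->
  (0 < a)%R -> (a <= b)%R -> (b < 1)%R -> (Cmod (IntC f a b) <= 2 * Re G)%R.
Proof.
  intros Hf [Hgc HG] Hfg Ha Hab Hb.
  assert (Hg : forall t, (0 < t < 1)%R -> continuous g t) by (intros t Ht; apply (proj1 (Hgc t Ht))).
  assert (Hg0 : forall t, (0 < t < 1)%R -> (0 <= g t)%R).
  { intros t Ht. eapply Rle_trans. apply Cmod_ge_0. auto. }
  apply Rle_trans with (2 * RInt g a b)%R.
  - apply IntC_bound; auto. intros; apply Hf; lra. intros; apply Hg; lra. intros; apply Hfg; lra.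
  - apply Rmult_le_compat_l. lra. apply Rnot_lt_le. intros Hneg.
    assert (He : (0 < RInt g a b - Re G)%R) by lra.
    assert (Hab' : F01 (fun ab => 0 < fst ab < a /\ b < snd ab < 1)%R).
    { apply F01_intro with a b; auto. }
    destruct (filter_ex (F := F01) _ (filter_and _ _ (HG _ He) Hab')) as [[a' b'] [H1 [H2 H3]]]. simpl in *.
    assert (RInt g a b <= Re (IntC (fun t => g t) a' b'))%R.
    { change (RInt g a b <= RInt g a' b')%R.
      rewrite <- (RInt_Chasles (V := R_CompleteNormedModule) g a' a b'), <- (RInt_Chasles (V := R_CompleteNormedModule) g a b b').
      2-5: apply ex_RInt_cont; [lra|intros; apply Hg; lra].
      assert (0 <= RInt g a' a)%R by (apply RInt_ge_0; [lra|apply ex_RInt_cont; [lra|intros; apply Hg; lra]|intros; apply Hg0; lra]).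
      assert (0 <= RInt g b b')%R by (apply RInt_ge_0; [lra|apply ex_RInt_cont; [lra|intros; apply Hg; lra]|intros; apply Hg0; lra]).
      change (RInt g a b <= RInt g a' a + (RInt g a b + RInt g b b'))%R. lra. }
    pose proof (Rabs_Re_le (IntC (fun t => g t) a' b' - G)) as H4.
    replace (Re (IntC (fun t => g t) a' b' - G)) with (Re (IntC (fun t => g t) a' b') - Re G)%R in H4 by reflexivity.
    rewrite Rabs_pos_eq in H4 by lra. lra.
Qed.

Lemma II_Cmod_le f (g : R -> R) l G : II f l -> II (fun t => RtoC (g t)) G ->
  (forall t, (0 < t < 1)%R -> (Cmod (f t) <= g t)%R) -> (Cmod l <= 2 * Re G)%R.
Proof.
  intros Hf HG Hfg. apply (Flim_Cmod_le F01 _ _ _ (proj2 Hf)).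
  generalize F01_lt. apply filter_imp. intros [a b]. simpl. intros.
  apply II_IntC_bound with g; auto. apply Hf. all: lra.
Qed.

Lemma Rpower_small Q eps : (0 < Q)%R -> (0 < eps)%R -> exists d, (0 < d)%R /\
  forall t, (0 < t < d)%R -> (Rpower t Q < eps)%R.
Proof.
  intros HQ He. exists (Rpower eps (/ Q)). split. apply exp_pos.
  intros t Ht. replace eps with (Rpower (Rpower eps (/ Q)) Q).
  - unfold Rpower at 1. unfold Rpower at 1. apply exp_increasing. apply Rmult_lt_compat_l; auto.
    apply ln_increasing; lra.
  - rewrite Rpower_mult, Rinv_l, Rpower_1; auto. lra.
Qed.

Lemma Flim_at_right_0 (F : R -> C) K Q : (0 < Q)%R ->
  (forall t, (0 < t < 1)%R -> (Cmod (F t) <= K * Rpower t Q)%R) -> Flim (at_right 0) F 0.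
Proof.
  intros HQ H eps He.
  assert (HK : (0 < Rabs K + 1)%R) by (pose proof (Rabs_pos K); lra).
  destruct (Rpower_small Q (eps / (Rabs K + 1)) HQ) as [d [Hd Hs]]. apply Rdiv_lt_0_compat; auto.
  assert (Hm : (0 < Rmin d 1)%R) by (apply Rmin_pos; lra).
  exists (mkposreal _ Hm). intros t Ht Ht0.
  assert (Ht' : (Rabs (t - 0) < Rmin d 1)%R) by exact Ht. rewrite Rminus_0_r, Rabs_pos_eq in Ht' by lra.
  pose proof (Rmin_l d 1). pose proof (Rmin_r d 1).
  replace (F t - 0) with (F t) by ring.
  eapply Rle_lt_trans. apply H. lra.
  assert (Htd : (0 < t < d)%R) by lra.
  specialize (Hs t Htd). pose proof (exp_pos (Q * ln t)) as E. fold (Rpower t Q) in E.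
  apply Rle_lt_trans with ((Rabs K + 1) * Rpower t Q)%R.
  - apply Rmult_le_compat_r. lra. pose proof (Rle_abs K). lra.
  - apply Rmult_lt_compat_l with (r := (Rabs K + 1)%R) in Hs; auto.
    replace ((Rabs K + 1) * (eps / (Rabs K + 1)))%R with eps in Hs by (field; lra). exact Hs.
Qed.

Lemma Flim_at_left_1 (F : R -> C) K P : (0 < P)%R ->
  (forall t, (0 < t < 1)%R -> (Cmod (F t) <= K * Rpower (1 - t) P)%R) -> Flim (at_left 1) F 0.
Proof.
  intros HP H eps He.
  assert (H0 : Flim (at_right 0) (fun t => F (1 - t)%R) 0).
  { apply Flim_at_right_0 with K P; auto. intros t Ht.
    assert (Ht1 : (0 < 1 - t < 1)%R) by lra. specialize (H _ Ht1).
    replace (1 - (1 - t))%R with t in H by ring. exact H. }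
  destruct (H0 eps He) as [d Hd]. exists d. intros t Ht Ht1.
  replace t with (1 - (1 - t))%R by ring. apply Hd.
  - assert (Ht' : (Rabs (t - 1) < d)%R) by exact Ht. change (Rabs (1 - t - 0) < d)%R.
    rewrite Rminus_0_r, <- Rabs_Ropp. replace (- (1 - t))%R with (t - 1)%R by ring. exact Ht'.
  - lra.
Qed.

(** Integration of the derivative of [t^q (1 - t)^p], which vanishes at both ends. *)
Lemma Bv_S p q : (0 < Re p)%R -> (0 < Re q)%R -> q * Bv p q = (p + q) * Bv p (q + 1).
Proof.
  intros Hp Hq.
  assert (Hq1 : (0 < Re (q + 1))%R) by re_lra.
  pose proof (II_plus _ _ _ _ (II_scal q _ _ (II_bk p q Hp Hq)) (II_scal (- (p + q)) _ _ (II_bk p (q + 1) Hp Hq1))) as H.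
  set (F := fun t => Rcpow t q * Rcpow (1 - t) p).
  assert (HF : forall t, (0 < t < 1)%R -> cderiv F t (q * bk p q t + - (p + q) * bk p (q + 1) t)).
  { intros t Ht. eapply cderiv_eq; [|exact (cderiv_mult _ _ _ _ _ (cderiv_Rcpow t q (proj1 Ht)) (cderiv_Rcpow_1m t p (proj2 Ht)))].
    unfold bk. replace (q + 1 - 1) with (q - 1 + 1) by ring.
    replace (Rcpow t q) with (Rcpow t (q - 1 + 1)) by (f_equal; ring).
    replace (Rcpow (1 - t) p) with (Rcpow (1 - t) (p - 1 + 1)) by (f_equal; ring).
    rewrite !Rcpow_S by lra. rewrite RtoC_minus. ring. }
  assert (HC : forall t, Cmod (F t) = (Rpower t (Re q) * Rpower (1 - t) (Re p))%R).
  { intros t. unfold F. rewrite Cmod_mult, !Cmod_Rcpow. reflexivity. }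
  assert (H' : II (fun t => q * bk p q t + - (p + q) * bk p (q + 1) t) (0 - 0)).
  { apply II_FTC with F; auto. apply (proj1 H).
    - apply (Flim_at_right_0 _ 1 (Re q)); auto. intros t Ht. rewrite HC, Rmult_1_l.
      rewrite <- (Rmult_1_r (Rpower t (Re q))) at 2. apply Rmult_le_compat_l. left; apply exp_pos.
      apply Rpower_le_1; lra.
    - apply (Flim_at_left_1 _ 1 (Re p)); auto. intros t Ht. rewrite HC.
      apply Rmult_le_compat_r. left; apply exp_pos. apply Rpower_le_1; lra. }
  pose proof (II_unique _ _ _ H H') as E.
  replace (q * Bv p q) with (q * Bv p q + - (p + q) * Bv p (q + 1) + (p + q) * Bv p (q + 1)) by ring.
  rewrite E. ring.
Qed.

Lemma Bv_1 p : (0 < Re p)%R -> Bv p 1 = / p.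
Proof.
  intros Hp. assert (Hpn : p <> 0) by (apply Re_pos_neq_0; auto).
  apply Bv_unique.
  set (F := fun t => - / p * Rcpow (1 - t) p).
  replace (/ p) with (0 - - / p) by ring.
  apply II_FTC with F.
  - intros t Ht. eapply cderiv_eq; [|exact (cderiv_mult _ _ _ _ _ (cderiv_const (- / p) t) (cderiv_Rcpow_1m t p (proj2 Ht)))].
    unfold bk. replace (1 - 1) with (RtoC 0) by ring. rewrite Rcpow_0. field. auto.
  - apply cont01_bk.
  - assert (H01 : (0 < 1)%R) by lra.
    pose proof (cderiv_ccont _ _ _ (cderiv_mult _ _ _ _ _ (cderiv_const (- / p) 0) (cderiv_Rcpow_1m 0 p H01))) as H.
    apply ccont_iff in H. fold F in H. rewrite Rminus_0_r, Rcpow_base_1, Cmult_1_r in H.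
    intros eps He. apply filter_le_within. exact (H eps He).
  - apply (Flim_at_left_1 _ (Cmod (/ p)) (Re p)); auto. intros t Ht. unfold F.
    rewrite Cmod_mult, Cmod_opp, Cmod_Rcpow. lra.
Qed.

Lemma Bv_nat p n : (0 < Re p)%R -> Bv p (INR n + 1) = INR (fact n) / pochhammer p (S n).
Proof.
  intros Hp. induction n.
  - simpl INR. replace (0 + 1) with (RtoC 1) by ring. rewrite Bv_1 by auto. simpl.
    replace (p + 0) with p by ring. field. apply Re_pos_neq_0; auto.
  - assert (Hn : (0 < Re (INR n + 1))%R) by (rewrite <- INR_S_C; apply INR_SS_pos).
    pose proof (Bv_S p (INR n + 1) Hp Hn) as E. rewrite IHn in E.
    rewrite INR_S_C, poch_S, fact_S_C, INR_S_C.
    assert (Hpn : p + (INR n + 1) <> 0) by (apply Re_pos_neq_0; rewrite <- INR_S_C, Re_plus_INR; pose proof (INR_SS_pos n); lra).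
    pose proof (poch_neq_0 p (S n) Hp).
    replace (Bv p (INR n + 1 + 1)) with ((p + (INR n + 1)) * Bv p (INR n + 1 + 1) / (p + (INR n + 1))) by (field; auto).
    rewrite <- E. field. auto.
Qed.

Lemma Bv_poch p q n : (0 < Re p)%R -> (0 < Re q)%R ->
  pochhammer q n * Bv p q = pochhammer (p + q) n * Bv p (q + INR n).
Proof.
  intros Hp Hq. induction n.
  - simpl. replace (q + 0) with q by ring. ring.
  - rewrite !poch_S.
    transitivity ((q + INR n) * (pochhammer q n * Bv p q)). ring.
    rewrite IHn.
    assert (Hqn : (0 < Re (q + INR n))%R) by (rewrite Re_plus_INR; pose proof (pos_INR n); lra).
    transitivity (pochhammer (p + q) n * ((q + INR n) * Bv p (q + INR n))). ring.
    rewrite Bv_S by auto. rewrite INR_S_C. replace (q + (INR n + 1)) with (q + INR n + 1) by ring. ring.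
Qed.

(** At integers the Beta integral is a quotient of a factorial and a Pochhammer symbol, so this
    sequence is the reciprocal of Gauss' product. *)
Lemma Bv_nat_lim p : (0 < Re p)%R -> Flim eventually (fun n => Rcpow (INR n) p * Bv p (INR n + 1)) (Gamma p).
Proof.
  intros Hp. apply (Flim_ext_ev eventually (fun n => / gauss_seq p n)).
  - apply filter_forall. intros n. rewrite Bv_nat by auto. unfold gauss_seq.
    pose proof (poch_neq_0 p (S n) Hp). pose proof (INR_fact_C_neq n). pose proof (Rcpow_neq_0 (INR n) p).
    field. auto.
  - apply (Flim_inv eventually). apply rGamma_neq_0; auto. apply rGamma_lim.
Qed.

Lemma Rcpow_minus_1_bound q t : (0 < Re q)%R -> (0 < t < 1)%R ->
  (Cmod (Rcpow t q - 1) <= 2 * Cmod q * ((1 - t) / t))%R.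
Proof.
  intros Hq Ht.
  assert (Ht1 : (t <= 1)%R) by lra.
  pose proof (mean_value_bound (fun s => Rcpow s q) _ t 1 (Cmod q / t)%R Ht1
    (fun s Hs => cderiv_Rcpow s q ltac:(lra))) as H.
  cbv beta in H. rewrite Rcpow_base_1 in H. rewrite <- Cmod_opp.
  replace (- (Rcpow t q - 1)) with (1 - Rcpow t q) by ring.
  replace (2 * Cmod q * ((1 - t) / t))%R with (2 * (Cmod q / t) * (1 - t))%R by (field; lra).
  apply H. intros s Hs. rewrite Cmod_mult, Cmod_Rcpow. unfold Rdiv. apply Rmult_le_compat_l. apply Cmod_ge_0.
  replace (Re (q - 1)) with (Re q + - (1))%R by (unfold Re; simpl; ring).
  rewrite Rpower_plus, Rpower_Ropp, Rpower_1 by lra.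
  apply Rle_trans with (1 * / s)%R.
  - apply Rmult_le_compat_r. left; apply Rinv_0_lt_compat; lra. apply Rpower_le_1; lra.
  - rewrite Rmult_1_l. apply Rinv_le_contravar; lra.
Qed.

(** Replacing [n + 1] by [q + n + 1] inserts [t^q] under the integral. As [|t^q - 1|] is at most
    [2 |q| (1 - t) / t], the difference is controlled by [B(Re p + 1, n)], which is smaller by one
    order in [n]. *)
Lemma Bv_shift_lim p q : (0 < Re p)%R -> (0 < Re q)%R ->
  Flim eventually (fun n => Rcpow (INR n) p * Bv p (q + INR n + 1)) (Gamma p).
Proof.
  intros Hp Hq. set (P := Re p).
  assert (HP1 : (0 < Re (RtoC P + 1))%R) by (unfold P; re_lra).
  assert (HP : (0 < Re (RtoC P))%R) by exact Hp.
  (* [B(P + 1, n) = (1 + (P + 1) / n) B(P + 1, n + 1)], and [n^(P + 1) B(P + 1, n + 1)] converges,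
     so a factor [1 / n] is left over. *)
  assert (HZ : Flim eventually (fun n => Rcpow (INR n) P * Bv (P + 1) (INR n)) 0).
  { apply (Flim_ext_ev eventually (fun n => (Rcpow (INR n) (P + 1) * Bv (P + 1) (INR n + 1)) * ((1 + (P + 1) * RtoC (/ INR n)) * RtoC (/ INR n)))).
    - exists 1%nat. intros n Hn.
      assert (Hn0 : (0 < INR n)%R) by (apply lt_0_INR; lia).
      assert (HnC : RtoC (INR n) <> 0) by (intros E; apply RtoC_inj in E; lra).
      pose proof (Bv_S (P + 1) (INR n) HP1 Hn0) as E.
      replace (Bv (P + 1) (INR n)) with (INR n * Bv (P + 1) (INR n) / INR n) by (field; auto).
      rewrite E, Rcpow_S, RtoC_inv by lra. field. auto.
    - replace (RtoC 0) with (Gamma (P + 1) * ((1 + (P + 1) * 0) * 0)) by ring.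
      apply (Flim_mult eventually). apply Bv_nat_lim; auto.
      apply (Flim_mult eventually); [|apply Flim_inv_INR].
      apply (Flim_plus eventually). apply (Flim_const eventually).
      apply (Flim_mult eventually). apply (Flim_const eventually). apply Flim_inv_INR. }
  assert (HD : Flim eventually (fun n => Rcpow (INR n) p * (Bv p (q + INR n + 1) + (-1) * Bv p (INR n + 1))) 0).
  { intros eps He.
    assert (HK : (0 < 4 * Cmod q + 1)%R) by (pose proof (Cmod_ge_0 q); lra).
    assert (He2 : (0 < eps / (4 * Cmod q + 1))%R) by (apply Rdiv_lt_0_compat; auto).
    destruct (HZ _ He2) as [N HN]. exists (S N). intros n Hn. assert (HnN : (N <= n)%nat) by lia.
    specialize (HN n HnN).
    assert (Hn0 : (0 < INR n)%R) by (apply lt_0_INR; lia).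
    assert (Hq1 : (0 < Re (q + INR n + 1))%R) by (unfold Re in *; simpl in *; lra).
    assert (Hq2 : (0 < Re (INR n + 1))%R) by (unfold Re in *; simpl in *; lra).
    pose proof (II_plus _ _ _ _ (II_bk p (q + INR n + 1) Hp Hq1) (II_scal (-1) _ _ (II_bk p (INR n + 1) Hp Hq2))) as H.
    pose proof (II_scal (2 * Cmod q)%R _ _ (II_bk (P + 1) (INR n) HP1 Hn0)) as HG.
    assert (HG' : II (fun t => RtoC (2 * Cmod q * rbk (P + 1) (INR n) t)) ((2 * Cmod q)%R * Bv (P + 1) (INR n))).
    { eapply II_ext; [|exact HG]. intros t Ht. cbv beta. rewrite (RtoC_mult (2 * Cmod q)), RtoC_rbk, RtoC_plus. reflexivity. }
    assert (Hbd : (Cmod (Bv p (q + INR n + 1) + -1 * Bv p (INR n + 1)) <= 2 * (2 * Cmod q * Re (Bv (P + 1) (INR n))))%R).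
    { replace (2 * Cmod q * Re (Bv (P + 1) (INR n)))%R with (Re ((2 * Cmod q)%R * Bv (P + 1) (INR n))) by (unfold Re; simpl; ring).
      apply (II_Cmod_le _ _ _ _ H HG'). intros t Ht.
      assert (E : bk p (q + INR n + 1) t + -1 * bk p (INR n + 1) t = bk p (INR n + 1) t * (Rcpow t q - 1)).
      { unfold bk. replace (q + INR n + 1 - 1) with ((INR n + 1 - 1) + q) by ring. rewrite (Rcpow_plus t (INR n + 1 - 1) q). ring. }
      rewrite E, Cmod_mult, Cmod_bk.
      apply Rle_trans with (rbk (Re p) (Re (INR n + 1)) t * (2 * Cmod q * ((1 - t) / t)))%R.
      apply Rmult_le_compat_l. left; apply rbk_pos. apply Rcpow_minus_1_bound; auto.
      right. unfold rbk. fold P.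
      replace (Re (INR n + 1)%C - 1)%R with ((INR n - 1) + 1)%R by (unfold Re; simpl; ring).
      replace (P + 1 - 1)%R with ((P - 1) + 1)%R by ring.
      rewrite !Rpower_plus, !Rpower_1 by lra. field. lra. }
    replace (Rcpow (INR n) p * (Bv p (q + INR n + 1) + -1 * Bv p (INR n + 1)) - 0) with
      (Rcpow (INR n) p * (Bv p (q + INR n + 1) + -1 * Bv p (INR n + 1))) by ring.
    replace (Rcpow (INR n) P * Bv (P + 1) (INR n) - 0) with (Rcpow (INR n) P * Bv (P + 1) (INR n)) in HN by ring.
    rewrite Cmod_mult, Cmod_Rcpow in HN. rewrite Cmod_mult, Cmod_Rcpow.
    replace (Re (RtoC P)) with P in HN by reflexivity. fold P.
    pose proof (exp_pos (P * ln (INR n))) as E1. fold (Rpower (INR n) P) in E1.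
    pose proof (Re_le_Cmod (Bv (P + 1) (INR n))) as E2.
    pose proof (Cmod_ge_0 (Bv (P + 1) (INR n))) as E3. pose proof (Cmod_ge_0 q) as E4.
    apply Rle_lt_trans with (Rpower (INR n) P * (4 * Cmod q * Cmod (Bv (P + 1) (INR n))))%R.
    - apply Rmult_le_compat_l. lra. eapply Rle_trans. exact Hbd. nra.
    - apply Rle_lt_trans with ((4 * Cmod q + 1) * (Rpower (INR n) P * Cmod (Bv (P + 1) (INR n))))%R. nra.
      apply Rmult_lt_compat_l with (r := (4 * Cmod q + 1)%R) in HN; auto.
      replace ((4 * Cmod q + 1) * (eps / (4 * Cmod q + 1)))%R with eps in HN by (field; lra). exact HN. }
  pose proof (Flim_plus eventually _ _ _ _ HD (Bv_nat_lim p Hp)) as H.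
  rewrite Cplus_0_l in H. eapply Flim_ext_ev; [apply eventually_filter| |exact H].
  apply filter_forall. intros n. ring.
Qed.

(** The recursion, used [n + 1] times, says that the Gauss sequence at [q] times [B(p, q)] is the
    one at [p + q] times [n^p B(p, q + n + 1)]. The limit is the formula. *)
Lemma Bv_value p q : (0 < Re p)%R -> (0 < Re q)%R -> Bv p q = Gamma p * Gamma q * rGamma (p + q).
Proof.
  intros Hp Hq.
  assert (H1 : Flim eventually (fun n => gauss_seq q n * Bv p q) (rGamma q * Bv p q)).
  { apply (Flim_mult eventually). apply rGamma_lim. apply (Flim_const eventually). }
  assert (H2 : Flim eventually (fun n => gauss_seq (p + q) n * (Rcpow (INR n) p * Bv p (q + INR n + 1))) (rGamma (p + q) * Gamma p)).
  { apply (Flim_mult eventually). apply rGamma_lim. apply Bv_shift_lim; auto. }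
  assert (E : rGamma q * Bv p q = rGamma (p + q) * Gamma p).
  { apply (Flim_unique _ _ _ H1). eapply Flim_ext_ev; [apply eventually_filter| |exact H2].
    apply filter_forall. intros n. unfold gauss_seq. rewrite Rcpow_plus.
    pose proof (Bv_poch p q (S n) Hp Hq) as E. rewrite INR_S_C, Cplus_assoc in E.
    pose proof (INR_fact_C_neq n). pose proof (Rcpow_neq_0 (INR n) p). pose proof (Rcpow_neq_0 (INR n) q).
    transitivity (pochhammer (p + q) (S n) * Bv p (q + INR n + 1) / (INR (fact n) * Rcpow (INR n) q)).
    field; auto. rewrite <- E. field; auto. }
  pose proof (rGamma_neq_0 q Hq).
  replace (Bv p q) with (rGamma q * Bv p q / rGamma q) by (field; auto).
  rewrite E. unfold Gamma. field. split; auto. apply rGamma_neq_0; auto.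
Qed.

Lemma rbk_bounded P Q a b : (0 < a)%R -> (a <= b)%R -> (b < 1)%R ->
  exists K, (0 <= K)%R /\ forall t, (a <= t <= b)%R -> (rbk P Q t <= K)%R.
Proof.
  intros Ha Hab Hb.
  destruct (continuity_ab_maj (rbk P Q) a b Hab) as [x [Hx _]].
  - intros t Ht. apply continuity_pt_filterlim. apply continuous_rbk. lra.
  - exists (rbk P Q x). split. left; apply rbk_pos. auto.
Qed.

Lemma bk_add p q n t : (0 < t < 1)%R -> bk (p + INR n) q t = RtoC (1 - t) ^ n * bk p q t.
Proof.
  intros Ht. unfold bk. replace (p + INR n - 1) with ((p - 1) + INR n) by ring.
  rewrite Rcpow_plus, Rcpow_INR by lra. ring.
Qed.

Lemma rbk_add P Q n t : (0 < t < 1)%R -> rbk (P + INR n) Q t = ((1 - t) ^ n * rbk P Q t)%R.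
Proof.
  intros Ht. apply RtoC_inj. rewrite RtoC_rbk, RtoC_plus, bk_add, RtoC_mult, RtoC_rbk, RtoC_pow by auto. reflexivity.
Qed.

(** Termwise integration in powers of [1 - t]. The majorant [HR] is integrated against the kernel
    with real parameters [Re p] and [Re q], which dominates the complex one. *)
Lemma II_power_bk (h : nat -> C) (HR : nat -> R) (p q : C) :
  (0 < Re p)%R -> (0 < Re q)%R -> (forall n, (Cmod (h n) <= HR n)%R) ->
  (forall y, (0 <= y < 1)%R -> ex_series (fun n => HR n * y ^ n)%R) ->
  ex_series (fun n => HR n * Re (Bv (RtoC (Re p + INR n)) (RtoC (Re q))))%R ->
  exists S, is_Cseries (fun n => h n * Bv (p + INR n) q) S /\
    II (fun t => HS h (1 - t) * bk p q t) S.
Proof.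
  intros Hp Hq Hh HRs HJ.
  assert (Hpn : forall n, (0 < Re (p + INR n))%R) by (intros; rewrite Re_plus_INR; pose proof (pos_INR n); lra).
  assert (Habs : abs1 h).
  { intros y Hy. apply ex_series_R_le with (fun n => HR n * y ^ n)%R; auto. intros n.
    assert (0 <= y ^ n)%R by (apply pow_le; lra). pose proof (Cmod_ge_0 (h n)). specialize (Hh n). split; nra. }
  apply (II_series (fun n t => h n * bk (p + INR n) q t)
    (fun n => 2 * (HR n * Re (Bv (RtoC (Re p + INR n)) (RtoC (Re q)))))%R).
  - intros n. apply II_scal. apply II_bk; auto.
  - intros n a b Ha Hab Hb.
    replace (HR n * Re (Bv (RtoC (Re p + INR n)) (RtoC (Re q))))%R with (Re (HR n * Bv (RtoC (Re p + INR n)) (RtoC (Re q)))) by (unfold Re; simpl; ring).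
    apply (II_IntC_bound _ (fun t => HR n * rbk (Re p + INR n) (Re q) t)%R); auto.
    + intros t Ht. apply ccont_mult. apply ccont_const. apply cont01_bk; auto.
    + apply II_ext with (fun t => HR n * bk (RtoC (Re p + INR n)) (RtoC (Re q)) t).
      intros t Ht. rewrite RtoC_mult, RtoC_rbk. reflexivity.
      apply II_scal, II_bk; auto. pose proof (pos_INR n). unfold Re; simpl. unfold Re in Hp. lra.
    + intros t Ht. rewrite Cmod_mult, Cmod_bk, Re_plus_INR. apply Rmult_le_compat_r; auto. left; apply rbk_pos.
  - apply ex_series_R_scal; auto.
  - intros a b Ha Hab Hb. destruct (rbk_bounded (Re p) (Re q) a b Ha Hab Hb) as [K [HK0 HK]].
    exists (fun n => K * (HR n * (1 - a) ^ n))%R. split.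
    + apply ex_series_R_scal. apply HRs. lra.
    + intros n t Ht. rewrite Cmod_mult, bk_add, Cmod_mult, Cmod_pow, Cmod_R, Cmod_bk, Rabs_pos_eq by lra.
      pose proof (Cmod_ge_0 (h n)).
      assert (0 <= (1 - t) ^ n <= (1 - a) ^ n)%R by (split; [apply pow_le; lra|apply pow_incr; lra]).
      replace (K * (HR n * (1 - a) ^ n))%R with (HR n * ((1 - a) ^ n * K))%R by ring.
      pose proof (rbk_pos (Re p) (Re q) t). specialize (HK t Ht). specialize (Hh n).
      apply Rmult_le_compat; auto. apply Rmult_le_pos; lra. apply Rmult_le_compat; lra.
  - intros t Ht. assert (Hy : (Rabs (1 - t) < 1)%R) by (rewrite Rabs_pos_eq; lra).
    rewrite Cmult_comm. eapply is_series_C_ext; [|apply (is_series_C_scal (bk p q t) _ _ (HS_series h (1 - t) Habs Hy))].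
    intros n. cbv beta. rewrite bk_add by auto. ring.
Qed.

(** * Gauss' summation theorem *)

Fixpoint rpoch (a : R) (n : nat) : R :=
  match n with O => 1%R | S m => (rpoch a m * (a + INR m))%R end.

Lemma RtoC_rpoch a n : pochhammer (RtoC a) n = RtoC (rpoch a n).
Proof.
  induction n. reflexivity. rewrite poch_S, IHn. simpl rpoch. rewrite RtoC_mult, RtoC_plus. reflexivity.
Qed.

Lemma rpoch_pos a n : (0 < a)%R -> (0 < rpoch a n)%R.
Proof.
  intros Ha. induction n; simpl. lra. pose proof (pos_INR n). apply Rmult_lt_0_compat; lra.
Qed.

Lemma rpoch_le_Cmod a n : (0 < Re a)%R -> (rpoch (Re a) n <= Cmod (pochhammer a n))%R.
Proof.
  intros Ha. induction n.
  - simpl. rewrite Cmod_1. lra.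
  - rewrite poch_S, Cmod_mult. simpl rpoch. pose proof (rpoch_pos (Re a) n Ha). pose proof (pos_INR n).
    apply Rmult_le_compat; try lra. rewrite <- Re_plus_INR. apply Re_le_Cmod.
Qed.

Lemma rpoch_add a m n : rpoch a (m + n) = (rpoch a m * rpoch (a + INR m) n)%R.
Proof.
  apply RtoC_inj. rewrite RtoC_mult, <- !RtoC_rpoch, RtoC_plus. apply poch_add.
Qed.

Lemma Flim_bounded (s : nat -> C) l : Flim eventually s l ->
  exists M, (0 < M)%R /\ forall n, (Cmod (s n) <= M)%R.
Proof.
  intros H.
  destruct (filterlim_bounded (K := C_AbsRing) (V := C_NormedModule) s) as [M HM].
  { exists l. apply (Flim_iff eventually). exact H. }
  assert (HM' : forall n, (Cmod (s n) <= M)%R) by exact HM.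
  exists (M + 1)%R. split.
  - pose proof (HM' 0%nat). pose proof (Cmod_ge_0 (s 0%nat)). lra.
  - intros n. specialize (HM' n). lra.
Qed.

(** In the quotient of the Gauss sequences at [a] and [Re a] the factorials cancel and the powers of
    [n] have equal modulus. What remains is the quotient of the symbols, and it converges. *)
Lemma poch_abs (a : C) : (0 < Re a)%R ->
  exists K, (1 <= K)%R /\ forall n, (Cmod (pochhammer a n) <= K * rpoch (Re a) n)%R.
Proof.
  intros Ha. set (A := RtoC (Re a)).
  assert (HA : (0 < Re A)%R) by exact Ha.
  pose proof (Flim_mult eventually _ _ _ _ (rGamma_lim a) (Flim_inv eventually _ _ (rGamma_neq_0 A HA) (rGamma_lim A))) as H.
  destruct (Flim_bounded _ _ H) as [M [HM HMb]].
  set (K := Rmax 1 (Rmax M (Cmod a / Re a))).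
  assert (HK1 : (1 <= K)%R) by apply Rmax_l.
  assert (HK2 : (M <= K)%R) by (eapply Rle_trans; [apply Rmax_l|apply Rmax_r]).
  assert (HK3 : (Cmod a / Re a <= K)%R) by (eapply Rle_trans; [apply Rmax_r|apply Rmax_r]).
  exists K. split; auto.
  intros n. destruct n.
  - simpl. rewrite Cmod_1. lra.
  - specialize (HMb n). rewrite Cmod_mult, Cmod_inv in HMb.
    2:{ intros E. unfold gauss_seq in E.
        pose proof (poch_neq_0 A (S n) HA). pose proof (INR_fact_C_neq n). pose proof (Rcpow_neq_0 (INR n) A).
        assert (Hne : INR (fact n) * Rcpow (INR n) A <> 0) by (apply Cmult_neq_0; auto).
        apply H0. replace (pochhammer A (S n)) with (pochhammer A (S n) / (INR (fact n) * Rcpow (INR n) A) * (INR (fact n) * Rcpow (INR n) A)) by (field; auto).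
        rewrite E. ring. }
    assert (Hc : forall z, Cmod (gauss_seq z n) = (Cmod (pochhammer z (S n)) / (INR (fact n) * Rpower (INR n) (Re z)))%R).
    { intros z. unfold gauss_seq. rewrite Cmod_div, Cmod_mult, Cmod_Rcpow, Cmod_INR. reflexivity.
      apply Cmult_neq_0. apply INR_fact_C_neq. apply Rcpow_neq_0. }
    rewrite !Hc in HMb. replace (Re A) with (Re a) in HMb by reflexivity.
    unfold A in HMb. rewrite RtoC_rpoch, Cmod_R, (Rabs_pos_eq (rpoch _ _)) in HMb by (left; apply rpoch_pos; auto).
    pose proof (rpoch_pos (Re a) (S n) Ha) as Hrp.
    pose proof (exp_pos (Re a * ln (INR n))) as E1. fold (Rpower (INR n) (Re a)) in E1.
    pose proof (INR_fact_lt_0 n) as E2.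
    replace (Cmod (pochhammer a (S n)) / (INR (fact n) * Rpower (INR n) (Re a)) * / (rpoch (Re a) (S n) / (INR (fact n) * Rpower (INR n) (Re a))))%R
      with (Cmod (pochhammer a (S n)) / rpoch (Re a) (S n))%R in HMb by (field; lra).
    apply Rmult_le_compat_r with (r := rpoch (Re a) (S n)) in HMb; [|lra].
    replace (Cmod (pochhammer a (S n)) / rpoch (Re a) (S n) * rpoch (Re a) (S n))%R with (Cmod (pochhammer a (S n))) in HMb by (field; lra).
    eapply Rle_trans. exact HMb. apply Rmult_le_compat_r; lra.
Qed.

Lemma rbin_sum A y N : (0 < A)%R -> (0 <= y < 1)%R ->
  (sum_n (fun n => rpoch A n / INR (fact n) * y ^ n)%R N <= Rpower (1 - y) (- A))%R.
Proof.
  intros HA Hy.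
  assert (Hyc : (Cmod y < 1)%R) by (rewrite Cmod_R, Rabs_pos_eq; lra).
  pose proof (is_series_Re _ _ (Bf_series A y Hyc)) as H.
  rewrite Bf_real, <- RtoC_opp, Rcpow_R in H by auto.
  assert (E : forall n, Re (bin A n * RtoC y ^ n) = (rpoch A n / INR (fact n) * y ^ n)%R).
  { intros n. unfold bin. rewrite RtoC_rpoch, <- RtoC_pow, <- RtoC_div, <- RtoC_mult by apply INR_fact_neq_0. reflexivity. }
  assert (H' : is_series (fun n => rpoch A n / INR (fact n) * y ^ n)%R (Rpower (1 - y) (- A))).
  { eapply is_series_ext; [|exact H]. intros n. apply E. }
  rewrite <- (is_series_unique _ _ H'). apply sum_le_Series.
  - intros n. apply Rmult_le_pos; [|apply pow_le; lra]. apply Rlt_le, Rdiv_lt_0_compat. apply rpoch_pos; auto. apply INR_fact_lt_0.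
  - eexists; exact H'.
Qed.

Lemma Gamma_poch z n : (0 < Re z)%R -> Gamma (z + INR n) = pochhammer z n * Gamma z.
Proof.
  intros Hz. induction n.
  - simpl. replace (z + 0) with z by ring. ring.
  - rewrite INR_S_C. replace (z + (INR n + 1)) with (z + INR n + 1) by ring.
    rewrite Gamma_S, IHn, poch_S. ring. rewrite Re_plus_INR. pose proof (pos_INR n). lra.
Qed.

Lemma rGamma_poch z n : rGamma z = pochhammer z n * rGamma (z + INR n).
Proof.
  induction n.
  - simpl. replace (z + 0) with z by ring. ring.
  - rewrite IHn, (rGamma_S (z + INR n)), poch_S, INR_S_C.
    replace (z + (INR n + 1)) with (z + INR n + 1) by ring. ring.
Qed.

(** The series of [(1 - y)^(-a)] at [y = 1 - t] sums to [t^(-a)]. Integrating it against the Beta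
    kernel of [(b, c - b)] gives [B(b, c - a - b)] as a whole and the values [B(b + n, c - b)]
    termwise. *)
Lemma gauss_sum a b c : (0 < Re a)%R -> (0 < Re b)%R -> (0 < Re (c - a - b))%R ->
  is_Cseries (fun n => bin a n * (pochhammer b n / pochhammer c n))
    (Gamma c * Gamma (c - a - b) * (rGamma (c - a) * rGamma (c - b))).
Proof.
  intros Ha Hb Hcab.
  assert (Ecab : Re (c - a - b) = (Re c - Re a - Re b)%R) by (unfold Re; simpl; ring).
  assert (Ecb : Re (c - b) = (Re c - Re b)%R) by (unfold Re; simpl; ring).
  assert (Eca : Re (c - a) = (Re c - Re a)%R) by (unfold Re; simpl; ring).
  assert (Hc : (0 < Re c)%R) by lra. assert (Hcb : (0 < Re (c - b))%R) by lra. assert (Hca : (0 < Re (c - a))%R) by lra.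
  destruct (poch_abs a Ha) as [K [HK1 HK]].
  set (HR := fun n => (K * (rpoch (Re a) n / INR (fact n)))%R).
  assert (HR0 : forall n, (0 <= HR n)%R).
  { intros n. apply Rmult_le_pos. lra. apply Rlt_le, Rdiv_lt_0_compat. apply rpoch_pos; auto. apply INR_fact_lt_0. }
  assert (HRs : forall y N, (0 <= y < 1)%R -> (sum_n (fun n => HR n * y ^ n)%R N <= K * Rpower (1 - y) (- Re a))%R).
  { intros y N Hy. unfold HR.
    rewrite (sum_n_ext _ (fun n => K * (rpoch (Re a) n / INR (fact n) * y ^ n))%R) by (intros; rring).
    rewrite Rsum_mult_l. apply Rmult_le_compat_l. lra. apply rbin_sum; auto. }
  destruct (II_power_bk (bin a) HR b (c - b)) as [S [HS1 HS2]]; auto.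
  - intros n. unfold bin. rewrite Cmod_div, Cmod_INR by apply INR_fact_C_neq. unfold HR, Rdiv. rewrite <- Rmult_assoc.
    apply Rmult_le_compat_r. left; apply Rinv_0_lt_compat, INR_fact_lt_0. auto.
  - intros y Hy. apply ex_series_nonneg with (K * Rpower (1 - y) (- Re a))%R; auto.
    intros n. apply Rmult_le_pos; auto. apply pow_le; lra.
  - assert (HrB : forall n, II (fun t => RtoC (HR n * rbk (Re b + INR n) (Re (c - b)) t)) (HR n * Bv (RtoC (Re b + INR n)) (RtoC (Re (c - b))))).
    { intros n. apply II_ext with (fun t => HR n * bk (RtoC (Re b + INR n)) (RtoC (Re (c - b))) t).
      intros t Ht. rewrite RtoC_mult, RtoC_rbk. reflexivity.
      apply II_scal, II_bk; auto. pose proof (pos_INR n). change (0 < Re b + INR n)%R. lra. }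
    (* The partial sums of the positive majorant stay below [K t^(-Re a)], so their integrals stay
       below a Beta value that is finite because [Re (c - a - b) > 0]. *)
    apply ex_series_nonneg with (Re (K * Bv (RtoC (Re b)) (RtoC (Re (c - a - b)%C)))).
    + intros n. pose proof (II_Re_nonneg _ _ (HrB n)) as H.
      replace (HR n * Re (Bv (RtoC (Re b + INR n)) (RtoC (Re (c - b)%C))))%R with (Re (HR n * Bv (RtoC (Re b + INR n)) (RtoC (Re (c - b)%C)))) by (unfold Re; simpl; ring).
      apply H. intros t Ht. change (0 <= HR n * rbk (Re b + INR n) (Re (c - b)%C) t)%R.
      apply Rmult_le_pos; auto. left; apply rbk_pos.
    + intros N. pose proof (II_sum _ _ N HrB) as H.
      assert (HD : II (fun t => K * bk (RtoC (Re b)) (RtoC (Re (c - a - b)%C)) t) (K * Bv (RtoC (Re b)) (RtoC (Re (c - a - b)%C)))).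
      { apply II_scal, II_bk; auto. }
      pose proof (II_Re_le _ _ _ _ H HD) as H1.
      rewrite Re_sum in H1.
      rewrite (sum_n_ext _ (fun n => Re (HR n * Bv (RtoC (Re b + INR n)) (RtoC (Re (c - b)%C))))) by (intros; unfold Re; simpl; rring).
      apply H1. intros t Ht. rewrite Re_sum. rewrite <- RtoC_rbk.
      change (sum_n (fun n => HR n * rbk (Re b + INR n) (Re (c - b)%C) t)%R N <= Re (K * rbk (Re b) (Re (c - a - b)%C) t)%C)%R.
      replace (Re (K * rbk (Re b) (Re (c - a - b)%C) t)%C) with (K * rbk (Re b) (Re (c - a - b)%C) t)%R by (unfold Re; simpl; ring).
      rewrite (sum_n_ext _ (fun n => HR n * (1 - t) ^ n * rbk (Re b) (Re (c - b)%C) t)%R) by (intros n; rewrite rbk_add by auto; rring).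
      rewrite Rsum_mult_r.
      assert (Ht1 : (0 <= 1 - t < 1)%R) by lra.
      pose proof (HRs (1 - t)%R N Ht1) as H2. replace (1 - (1 - t))%R with t in H2 by ring.
      eapply Rle_trans. apply Rmult_le_compat_r; [left; apply rbk_pos|exact H2].
      right. unfold rbk. rewrite Ecab, Ecb. replace (Re c - Re a - Re b - 1)%R with (- Re a + (Re c - Re b - 1))%R by ring.
      rewrite Rpower_plus. ring.
  - assert (HS3 : II (bk b (c - a - b)) S).
    { apply II_ext with (fun t => HS (bin a) (1 - t) * bk b (c - b) t); auto.
      intros t Ht. assert (Ht1 : (0 <= 1 - t < 1)%R) by lra.
      replace (HS (bin a) (1 - t)) with (Bf a (RtoC (1 - t))) by reflexivity.
      rewrite Bf_real by auto. replace (1 - (1 - t))%R with t by ring.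
      unfold bk. replace (c - a - b - 1) with (- a + (c - b - 1)) by ring. rewrite (Rcpow_plus t (- a)). ring. }
    apply Bv_unique in HS3. rewrite Bv_value in HS3 by auto.
    replace (b + (c - a - b)) with (c - a) in HS3 by ring.
    pose proof (Gamma_neq_0 b Hb) as Gb. pose proof (Gamma_neq_0 (c - b) Hcb) as Gcb.
    pose proof (rGamma_neq_0 (c - b) Hcb) as Rcb. pose proof (rGamma_neq_0 c Hc) as Rc.
    pose proof (is_series_C_scal (/ (Gamma b * Gamma (c - b) * rGamma c)) _ _ HS1) as H.
    rewrite <- HS3 in H.
    replace (/ (Gamma b * Gamma (c - b) * rGamma c) * (Gamma b * Gamma (c - a - b) * rGamma (c - a))) with
      (Gamma c * Gamma (c - a - b) * (rGamma (c - a) * rGamma (c - b))) in H.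
    2:{ change (Gamma c) with (/ rGamma c). change (Gamma (c - b)) with (/ rGamma (c - b)). field. auto. }
    eapply is_series_C_ext; [|exact H]. intros n. cbv beta.
    assert (Hbn : (0 < Re (b + INR n))%R) by (rewrite Re_plus_INR; pose proof (pos_INR n); lra).
    rewrite Bv_value, Gamma_poch by auto.
    replace (b + INR n + (c - b)) with (c + INR n) by ring.
    pose proof (poch_neq_0 c n Hc). rewrite (rGamma_poch c n) in Rc |- *.
    assert (rGamma (c + INR n) <> 0) by (apply rGamma_neq_0; rewrite Re_plus_INR; pose proof (pos_INR n); lra).
    field. auto.
Qed.

(** * Growth at 1 of power series on [0, 1) *)

Definition yshift (h : nat -> C) (n : nat) : C := match n with O => 0 | S m => h m end.

(* [InD s h] bounds [HS h y] by a multiple of [(1 - y)^(-s)].  [InD_1my] keeps this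
   stable under [(1 - y) d/dy], which a majorant of the coefficients would not be. *)
Inductive InD : R -> (nat -> C) -> Prop :=
| InD_base s h K :
    (forall y N, (0 <= y < 1)%R -> (sum_n (fun n => Cmod (h n) * y ^ n)%R N <= K * Rpower (1 - y) (- s))%R) ->
    InD s h
| InD_plus s h1 h2 : InD s h1 -> InD s h2 -> InD s (fun n => h1 n + h2 n)
| InD_scal s z h : InD s h -> InD s (fun n => z * h n)
| InD_shift s h : InD s h -> InD s (yshift h)
| InD_1my s h : InD (s + 1) h -> InD s (fun n => h n - yshift h n)
| InD_ext s h1 h2 : (forall n, h1 n = h2 n) -> InD s h1 -> InD s h2.

Lemma abs1_plus h1 h2 : abs1 h1 -> abs1 h2 -> abs1 (fun n => h1 n + h2 n).
Proof.
  intros H1 H2 y Hy.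
  apply ex_series_R_le with (fun n => Cmod (h1 n) * y ^ n + Cmod (h2 n) * y ^ n)%R.
  - intros n. assert (0 <= y ^ n)%R by (apply pow_le; lra).
    pose proof (Cmod_triangle (h1 n) (h2 n)). pose proof (Cmod_ge_0 (h1 n + h2 n)). split; nra.
  - apply (ex_series_plus (K := R_AbsRing) (V := R_NormedModule)); auto.
Qed.

Lemma abs1_scal z h : abs1 h -> abs1 (fun n => z * h n).
Proof.
  intros H y Hy. eapply ex_series_ext; [|exact (ex_series_R_scal (Cmod z) _ (H y Hy))].
  intros n. simpl. rewrite Cmod_mult. ring.
Qed.

Lemma abs1_shift h : abs1 h -> abs1 (yshift h).
Proof.
  intros H y Hy. apply ex_series_incr_1.
  eapply ex_series_ext; [|exact (ex_series_R_scal y _ (H y Hy))].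
  intros n. simpl. ring.
Qed.

Lemma abs1_ext h1 h2 : (forall n, h1 n = h2 n) -> abs1 h1 -> abs1 h2.
Proof. intros E H y Hy. eapply ex_series_ext; [|exact (H y Hy)]. intros n. simpl. rewrite E. reflexivity. Qed.

Lemma abs1_1my h : abs1 h -> abs1 (fun n => h n - yshift h n).
Proof.
  intros H. apply abs1_ext with (fun n => h n + (-1) * yshift h n). intros; ring.
  apply abs1_plus; auto. apply abs1_scal, abs1_shift; auto.
Qed.

Lemma InD_abs1 s h : InD s h -> abs1 h.
Proof.
  induction 1.
  - intros y Hy. apply ex_series_nonneg with (K * Rpower (1 - y) (- s))%R; auto.
    intros n. apply Rmult_le_pos. apply Cmod_ge_0. apply pow_le; lra.
  - apply abs1_plus; auto.
  - apply abs1_scal; auto.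
  - apply abs1_shift; auto.
  - apply abs1_1my; auto.
  - apply abs1_ext with h1; auto.
Qed.

Lemma HS_plus h1 h2 (y : R) : abs1 h1 -> abs1 h2 -> (Rabs y < 1)%R ->
  HS (fun n => h1 n + h2 n) y = HS h1 y + HS h2 y.
Proof.
  intros H1 H2 Hy. apply CSeries_unique.
  eapply is_series_C_ext; [|exact (is_series_C_plus _ _ _ _ (HS_series h1 y H1 Hy) (HS_series h2 y H2 Hy))].
  intros n. simpl. ring.
Qed.

Lemma HS_scal z h (y : R) : abs1 h -> (Rabs y < 1)%R -> HS (fun n => z * h n) y = z * HS h y.
Proof.
  intros H Hy. apply CSeries_unique.
  eapply is_series_C_ext; [|exact (is_series_C_scal z _ _ (HS_series h y H Hy))].
  intros n. simpl. ring.
Qed.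

Lemma HS_ext h1 h2 (y : R) : (forall n, h1 n = h2 n) -> abs1 h1 -> (Rabs y < 1)%R -> HS h1 y = HS h2 y.
Proof.
  intros E H Hy. symmetry. apply CSeries_unique.
  eapply is_series_C_ext; [|exact (HS_series h1 y H Hy)]. intros n. simpl. rewrite E. reflexivity.
Qed.

Lemma HS_shift h (y : R) : abs1 h -> (Rabs y < 1)%R -> HS (yshift h) y = y * HS h y.
Proof.
  intros H Hy. apply CSeries_unique.
  eapply is_series_C_ext; [|exact (is_series_shifted (RtoC y) _ _ 1 (HS_series h y H Hy))].
  intros n. destruct n; simpl. ring. rewrite Nat.sub_0_r. ring.
Qed.

Lemma HS_1my h (y : R) : abs1 h -> (Rabs y < 1)%R -> HS (fun n => h n - yshift h n) y = (1 - y) * HS h y.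
Proof.
  intros H Hy. rewrite <- (HS_ext (fun n => h n + (-1) * yshift h n)); auto.
  - rewrite HS_plus, HS_scal, HS_shift; auto using abs1_shift. ring. apply abs1_scal, abs1_shift; auto.
  - intros; ring.
  - apply abs1_plus; auto. apply abs1_scal, abs1_shift; auto.
Qed.

Lemma InD_bound s h : InD s h -> exists K, (0 <= K)%R /\ forall y, (0 <= y < 1)%R ->
  (Cmod (HS h y) <= K * Rpower (1 - y) (- s))%R.
Proof.
  assert (Hy1 : forall y, (0 <= y < 1)%R -> (Rabs y < 1)%R) by (intros; rewrite Rabs_pos_eq; lra).
  assert (Hpp : forall y e, (0 < Rpower (1 - y) e)%R) by (intros; apply exp_pos).
  induction 1 as [s h K H|s h1 h2 H1 [K1 [HK1 IH1]] H2 [K2 [HK2 IH2]]|s z h H [K [HK IH]]|s h H [K [HK IH]]|s h H [K [HK IH]]|s h1 h2 E H [K [HK IH]]].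
  - assert (HK : (0 <= K)%R).
    { assert (H0 : (0 <= 0 < 1)%R) by lra. specialize (H 0%R 0%nat H0). rewrite Rsum_O in H. simpl in H.
      pose proof (Cmod_ge_0 (h 0%nat)). specialize (Hpp 0%R (- s)%R). apply Rnot_lt_le. intros Hn. nra. }
    exists K. split; auto. intros y Hy.
    assert (Ha : abs1 h) by (eapply InD_abs1; eapply InD_base; exact H).
    eapply Rle_trans. apply (is_series_Cmod_le (fun n => h n * RtoC y ^ n) (fun n => Cmod (h n) * y ^ n)%R); [|apply Ha; auto|apply HS_series; auto].
    intros n. rewrite Cmod_mult, Cmod_pow, Cmod_R, Rabs_pos_eq by lra. lra.
    apply Series_le_bound. apply Ha; auto. intros; auto.
  - exists (K1 + K2)%R. split. lra. intros y Hy. rewrite HS_plus by (auto; eapply InD_abs1; eauto).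
    eapply Rle_trans. apply Cmod_triangle. specialize (IH1 y Hy). specialize (IH2 y Hy). lra.
  - exists (Cmod z * K)%R. split. apply Rmult_le_pos; auto. apply Cmod_ge_0. intros y Hy.
    rewrite HS_scal, Cmod_mult by (auto; eapply InD_abs1; eauto). rewrite Rmult_assoc.
    apply Rmult_le_compat_l; auto. apply Cmod_ge_0.
  - exists K. split; auto. intros y Hy. rewrite HS_shift, Cmod_mult by (auto; eapply InD_abs1; eauto).
    rewrite Cmod_R, Rabs_pos_eq by lra. specialize (IH y Hy). pose proof (Cmod_ge_0 (HS h y)). nra.
  - exists K. split; auto. intros y Hy. rewrite HS_1my, Cmod_mult by (auto; eapply InD_abs1; eauto).
    rewrite <- RtoC_minus, Cmod_R, Rabs_pos_eq by lra. specialize (IH y Hy).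
    replace (Rpower (1 - y) (- s)) with ((1 - y) * Rpower (1 - y) (- (s + 1)))%R.
    apply Rmult_le_compat_l with (r := (1 - y)%R) in IH; lra.
    replace (- s)%R with (1 + - (s + 1))%R by ring. rewrite (Rpower_plus 1), Rpower_1 by lra. reflexivity.
  - exists K. split; auto. intros y Hy. rewrite <- (HS_ext h1 h2) by (auto; eapply InD_abs1; eauto). auto.
Qed.

Lemma InD_weak s h : InD s h -> InD (s + 1) h.
Proof.
  induction 1.
  - apply InD_base with K. intros y N Hy. eapply Rle_trans. apply H; auto.
    assert (HK : (0 <= K)%R).
    { assert (H0 : (0 <= 0 < 1)%R) by lra. specialize (H 0%R 0%nat H0). rewrite Rsum_O in H. simpl in H.
      pose proof (Cmod_ge_0 (h 0%nat)). pose proof (exp_pos (- s * ln (1 - 0))) as Hp. unfold Rpower in H.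
      apply Rnot_lt_le. intros Hn. nra. }
    apply Rmult_le_compat_l; auto.
    replace (- s)%R with (1 + - (s + 1))%R by ring. rewrite (Rpower_plus 1), Rpower_1 by lra.
    pose proof (exp_pos (- (s + 1) * ln (1 - y))) as Hp. fold (Rpower (1 - y) (- (s + 1))) in Hp. nra.
  - apply InD_plus; auto.
  - apply InD_scal; auto.
  - apply InD_shift; auto.
  - apply InD_1my; auto.
  - apply InD_ext with h1; auto.
Qed.

Lemma yshift_der h n : yshift (der h) n = INR n * h n.
Proof. destruct n; simpl yshift. simpl. ring. reflexivity. Qed.

(** Differentiation costs one power of [1 - y]. In the base case the sums at [y] are compared with
    those at the midpoint [y + d] of [[y, 1]], whence [2] and the power of [1/2] in the constant.
    The other cases follow the rules for derivatives. *)
Lemma InD_der s h : InD s h -> InD (s + 1) (der h).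
Proof.
  induction 1.
  - assert (Hpp : forall y e, (0 < Rpower y e)%R) by (intros; apply exp_pos).
    assert (HK : (0 <= K)%R).
    { assert (H0 : (0 <= 0 < 1)%R) by lra. specialize (H 0%R 0%nat H0). rewrite Rsum_O in H. simpl in H.
      pose proof (Cmod_ge_0 (h 0%nat)). specialize (Hpp (1 - 0)%R (- s)%R).
      apply Rnot_lt_le. intros Hn. nra. }
    apply InD_base with (2 * K * Rpower (/ 2) (- s))%R. intros y N Hy.
    set (d := ((1 - y) / 2)%R). assert (Hd : (0 < d)%R) by (unfold d; lra).
    assert (Hy2 : (0 <= y + d < 1)%R) by (unfold d; lra).
    (* Bernoulli: [n y^(n-1) d <= (y + d)^n] *)
    assert (Hber : forall n, (INR (S n) * y ^ n * d <= (y + d) ^ S n)%R).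
    { induction n.
      - simpl. lra.
      - rewrite S_INR. pose proof (pos_INR (S n)).
        assert (Hyn : (y ^ S n <= (y + d) ^ S n)%R) by (apply pow_incr; lra).
        assert (0 <= y ^ n)%R by (apply pow_le; lra). simpl (y ^ S n)%R in *.
        replace ((y + d) ^ S (S n))%R with ((y + d) * (y + d) ^ S n)%R by (simpl; ring).
        nra. }
    apply Rle_trans with (/ d * sum_n (fun n => Cmod (h n) * (y + d) ^ n)%R (S N))%R.
    + apply Rmult_le_reg_l with d; auto. rewrite <- Rmult_assoc, Rinv_r, Rmult_1_l by lra.
      rewrite <- Rsum_mult_l.
      apply Rle_trans with (sum_n (fun n => Cmod (h (S n)) * (y + d) ^ S n)%R N).
      * apply Rsum_le. intros n _. unfold der. rewrite Cmod_mult, Cmod_INR. specialize (Hber n).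
        pose proof (Cmod_ge_0 (h (S n))).
        replace (d * (INR (S n) * Cmod (h (S n)) * y ^ n))%R with (Cmod (h (S n)) * (INR (S n) * y ^ n * d))%R by ring.
        apply Rmult_le_compat_l; auto.
      * assert (E : forall f : nat -> R, sum_n f (S N) = (f 0%nat + sum_n (fun k => f (S k)) N)%R).
        { intros f. apply RtoC_inj. rewrite RtoC_plus, !RtoC_sum. apply (Csum_shift (fun k => RtoC (f k))). }
        rewrite E. assert (0 <= Cmod (h 0%nat) * (y + d) ^ 0)%R by (apply Rmult_le_pos; [apply Cmod_ge_0|apply pow_le; lra]). lra.
    + eapply Rle_trans. apply Rmult_le_compat_l. left; apply Rinv_0_lt_compat; auto. apply H; auto.
      right. replace (1 - (y + d))%R with (/ 2 * (1 - y))%R by (unfold d; field).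
      rewrite <- Rpower_mult_distr by lra.
      replace (Rpower (1 - y) (- (s + 1))) with (Rpower (1 - y) (- s) * / (1 - y))%R.
      unfold d. field. lra.
      replace (- (s + 1))%R with (- s + - (1))%R by ring. rewrite Rpower_plus, (Rpower_Ropp _ 1), Rpower_1 by lra. reflexivity.
  - apply InD_ext with (fun n => der h1 n + der h2 n). intros; unfold der; ring. apply InD_plus; auto.
  - apply InD_ext with (fun n => z * der h n). intros; unfold der; ring. apply InD_scal; auto.
  - apply InD_ext with (fun n => h n + yshift (der h) n).
    + intros n. rewrite yshift_der. unfold der. simpl yshift. rewrite INR_S_C. ring.
    + apply InD_plus. apply InD_weak; auto. apply InD_shift; auto.
  - apply InD_ext with (fun n => (der h n - yshift (der h) n) + (-1) * h n).
    + intros n. rewrite yshift_der. unfold der. simpl yshift. rewrite INR_S_C. ring.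
    + apply InD_plus. apply InD_1my; auto. apply InD_scal; auto.
  - apply InD_ext with (der h1); auto. intros n. unfold der. rewrite H. reflexivity.
Qed.

(** * The raising step *)

Section Step.

Context (h hp : nat -> C) (c f : C).
Context (Hc : (0 < Re c)%R).
Context (Hrel : forall n, c * h n = (c + INR n) * hp n + (f + 1 - c - INR n) * yshift hp n).

Let Y := yshift (der hp).

(** Rewritten so that the derivative of the raised series enters only as [(1 - y) y] times it, the
    form under which the growth class is stable. *)
Lemma step_rel n : h n = / c * (c * hp n + (f - c) * yshift hp n + (Y n - yshift Y n)).
Proof.
  assert (Hcn : c <> 0) by (apply Re_pos_neq_0; auto).
  assert (E : c * h n = c * hp n + (f - c) * yshift hp n + (Y n - yshift Y n)).
  { rewrite Hrel. unfold Y. rewrite yshift_der. destruct n; simpl yshift. simpl. ring.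
    rewrite yshift_der, INR_S_C. ring. }
  rewrite <- E. field. auto.
Qed.

(** The derivative loses one power of [1 - y] and the factor [1 - y] in front of it wins it back. *)
Lemma step_InD s : InD s hp -> InD s h.
Proof.
  intros H. apply InD_ext with (fun n => / c * (c * hp n + (f - c) * yshift hp n + (Y n - yshift Y n))).
  intros; symmetry; apply step_rel.
  apply InD_scal, InD_plus. apply InD_plus. apply InD_scal; auto. apply InD_scal, InD_shift; auto.
  apply InD_1my. apply InD_shift, InD_der. auto.
Qed.

Lemma step_HS y : abs1 hp -> (Rabs y < 1)%R ->
  c * HS h y = (c + (f - c) * y) * HS hp y + (1 - y) * y * HS (der hp) y.
Proof.
  intros H Hy. assert (Hcn : c <> 0) by (apply Re_pos_neq_0; auto).
  pose proof (abs1_shift _ H) as H1. pose proof (abs1_der _ H) as H2. pose proof (abs1_shift _ H2) as H3.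
  assert (A1 : abs1 (fun n => c * hp n)) by (apply abs1_scal; auto).
  assert (A2 : abs1 (fun n => (f - c) * yshift hp n)) by (apply abs1_scal; auto).
  pose proof (abs1_plus _ _ A1 A2) as A12. cbv beta in A12.
  assert (A3 : abs1 (fun n => Y n - yshift Y n)) by (apply abs1_1my; auto).
  pose proof (abs1_plus _ _ A12 A3) as A4. cbv beta in A4.
  pose proof (abs1_scal (/ c) _ A4) as A5. cbv beta in A5.
  rewrite <- (HS_ext _ h y (fun n => eq_sym (step_rel n)) A5 Hy).
  rewrite (HS_scal (/ c) _ y A4 Hy), (HS_plus _ _ y A12 A3 Hy), (HS_plus _ _ y A1 A2 Hy),
    !HS_scal, HS_1my, !HS_shift; auto.
  unfold Y. rewrite HS_shift by auto. field. auto.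
Qed.

Lemma ccont_HS_1m g t : abs1 g -> (0 < t < 1)%R -> ccont (fun s => HS g (1 - s)) t.
Proof.
  intros Hg Ht. assert (Hy : (Rabs (1 - t) < 1)%R) by (rewrite Rabs_pos_eq; lra).
  apply (ccont_comp (HS g) (fun s => 1 - s)%R).
  - eapply cderiv_ccont. apply cderiv_HS; auto.
  - apply (ex_derive_continuous (K := R_AbsRing) (V := R_NormedModule)). auto_derive. auto.
Qed.

(** The derivative of [t^rho (1 - t)^c H+(1 - t)] is [f + rho] times the raised integrand minus [c]
    times the original one. The boundary values vanish: the growth bound leaves [t^(Re rho - s)] at
    [0], and [(1 - t)^(Re c)] remains at [1]. *)
Lemma step_II s rho Phi : InD s hp -> (s < Re rho)%R ->
  II (fun t => HS hp (1 - t) * bk (c + 1) rho t) Phi ->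
  II (fun t => HS h (1 - t) * bk c rho t) ((f + rho) / c * Phi).
Proof.
  intros HD Hs HP.
  assert (Hcn : c <> 0) by (apply Re_pos_neq_0; auto).
  pose proof (InD_abs1 _ _ HD) as Ha. pose proof (abs1_der _ Ha) as Ha'.
  pose proof (InD_abs1 _ _ (step_InD _ HD)) as Hah.
  destruct (InD_bound _ _ HD) as [K [HK HKb]].
  set (F := fun t => Rcpow t rho * Rcpow (1 - t) c * HS hp (1 - t)).
  set (dF := fun t => (f + rho) * (HS hp (1 - t) * bk (c + 1) rho t) + - c * (HS h (1 - t) * bk c rho t)).
  assert (HF : forall t, (0 < t < 1)%R -> cderiv F t (dF t)).
  { intros t Ht. assert (Hy : (Rabs (1 - t) < 1)%R) by (rewrite Rabs_pos_eq; lra).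
    assert (Hd : is_derive (fun s => 1 - s)%R t (-1)%R) by (auto_derive; auto; ring).
    pose proof (cderiv_comp (HS hp) (fun s => 1 - s)%R t _ _ (cderiv_HS hp (1 - t) Ha Hy) Hd) as H1.
    pose proof (cderiv_mult _ _ _ _ _ (cderiv_mult _ _ _ _ _ (cderiv_Rcpow t rho (proj1 Ht)) (cderiv_Rcpow_1m t c (proj2 Ht))) H1) as H2.
    eapply cderiv_eq; [|exact H2]. unfold dF.
    replace (- c * (HS h (1 - t) * bk c rho t)) with (- (c * HS h (1 - t)) * bk c rho t) by ring.
    rewrite step_HS by auto. unfold bk.
    replace (c + 1 - 1) with (c - 1 + 1) by ring.
    replace (Rcpow t rho) with (Rcpow t (rho - 1 + 1)) by (f_equal; ring).
    replace (Rcpow (1 - t) c) with (Rcpow (1 - t) (c - 1 + 1)) by (f_equal; ring).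
    rewrite !Rcpow_S by lra. rewrite RtoC_minus. ring. }
  assert (HC : forall t, (0 < t < 1)%R -> (Cmod (F t) <= K * (Rpower t (Re rho - s) * Rpower (1 - t) (Re c)))%R).
  { intros t Ht. unfold F. rewrite !Cmod_mult, !Cmod_Rcpow.
    assert (Hy : (0 <= 1 - t < 1)%R) by lra. specialize (HKb _ Hy). replace (1 - (1 - t))%R with t in HKb by ring.
    replace (Re rho - s)%R with (Re rho + - s)%R by ring. rewrite Rpower_plus.
    replace (K * (Rpower t (Re rho) * Rpower t (- s) * Rpower (1 - t) (Re c)))%R with
      (Rpower t (Re rho) * Rpower (1 - t) (Re c) * (K * Rpower t (- s)))%R by ring.
    apply Rmult_le_compat_l; auto. left. apply Rmult_lt_0_compat; apply exp_pos. }
  assert (HcF : cont01 dF).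
  { intros t Ht. apply ccont_plus; (apply ccont_mult; [apply ccont_const|]);
    (apply ccont_mult; [apply ccont_HS_1m; auto|apply cont01_bk; auto]). }
  assert (H0 : II dF (0 - 0)).
  { apply II_FTC with F; auto.
    - apply (Flim_at_right_0 _ K (Re rho - s)); [lra|]. intros t Ht. eapply Rle_trans. apply HC; auto.
      apply Rmult_le_compat_l; auto. rewrite <- (Rmult_1_r (Rpower t (Re rho - s))) at 2.
      apply Rmult_le_compat_l. left; apply exp_pos. apply Rpower_le_1; lra.
    - apply (Flim_at_left_1 _ K (Re c)); [auto|]. intros t Ht. eapply Rle_trans. apply HC; auto.
      apply Rmult_le_compat_l; auto. rewrite <- (Rmult_1_l (Rpower (1 - t) (Re c))) at 2.
      apply Rmult_le_compat_r. left; apply exp_pos. apply Rpower_le_1; lra. }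
  replace ((f + rho) / c * Phi) with (- / c * (0 - 0) + (f + rho) / c * Phi) by (field; auto).
  apply II_ext with (fun t => - / c * dF t + (f + rho) / c * (HS hp (1 - t) * bk (c + 1) rho t)).
  - intros t Ht. unfold dF. field. auto.
  - apply II_plus; apply II_scal; auto.
Qed.

End Step.

(** * The kernel of the operator *)

(** On the path both variables of the transformed series equal [y]; these are its coefficients as a
    single power series. *)
Definition hN (a a' b b' c : C) (N : nat) : C :=
  sum_n (fun m => dcoef a a' b b' c m (N - m)) N.

(** The denominator [(c)_(m+n)] is constant for given degree. Without it, [c] and [b'] enter only
    through [e = c - b']. *)
Definition gterm (a a' b e : C) (m n : nat) : C :=
  bin a m * pochhammer b m * (bin a' n * pochhammer (e + INR m) n).

Definition gN (a a' b e : C) (N : nat) : C := sum_n (fun m => gterm a a' b e m (N - m)) N.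

Lemma hN_gN a a' b b' c N : (0 < Re c)%R -> hN a a' b b' c N = gN a a' b (c - b') N / pochhammer c N.
Proof.
  intros Hc. unfold hN, gN, Cdiv. rewrite <- Csum_mult_r. apply Csum_ext_le. intros m Hm.
  unfold dcoef, gterm, bin. replace (m + (N - m))%nat with N by lia. cfield; nz.
Qed.

Lemma hN_sym a a' b b' c N : hN a a' b b' c N = hN b a' a b' c N.
Proof. apply Csum_ext_le. intros m Hm. unfold dcoef, Cdiv. cring. Qed.

(** * Contiguous relations between the coefficients *)

Lemma Csum_conv_shift (U V : nat -> nat -> C) N :
  (forall n, U 0%nat n = 0) -> (forall m, V m 0%nat = 0) ->
  sum_n (fun m => U (S m) (N - m)%nat + V m (S (N - m))) N =
  sum_n (fun m => U m (S N - m)%nat + V m (S N - m)%nat) (S N).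
Proof.
  intros HU HV. rewrite !Csum_plus. f_equal.
  - rewrite Csum_shift, HU, Cplus_0_l. reflexivity.
  - rewrite Csum_Sn, Nat.sub_diag, HV, Cplus_0_r. apply Csum_ext_le. intros m Hm.
    replace (S N - m)%nat with (S (N - m)) by lia. reflexivity.
Qed.

(** Both [(x)_n] and [(x + 1)_n] contain [(x + 1)_(n-1)], and their remaining factors differ by [n].
    At [n = 0] the factor [INR n] makes the value of [pred] irrelevant. *)
Lemma poch_diff x n : pochhammer (x + 1) n - INR n * pochhammer (x + 1) (pred n) = pochhammer x n.
Proof.
  destruct n. simpl. ring. rewrite (poch_S_l x). simpl pred. rewrite poch_S, INR_S_C. ring.
Qed.

(** Lowering [b + 1] and [e + 1] produces the terms [U] and [V], with weights [m] and [n]. After a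
    shift of the index the recurrence of [bin] turns these weights into [a + m] and [a' + n], with
    sum [a + a' + N]. *)
Lemma gN_step_b a a' b e N :
  gN a a' b e (S N) = gN a a' (b + 1) (e + 1) (S N) - (a + a' + INR N) * gN a a' (b + 1) (e + 1) N.
Proof.
  set (U := fun m n : nat => INR m * bin a m * bin a' n * pochhammer (b + 1) (pred m) * pochhammer (e + INR m) n).
  set (V := fun m n : nat => INR n * bin a m * bin a' n * pochhammer (b + 1) m * pochhammer (e + INR m + 1) (pred n)).
  assert (E1 : (a + a' + INR N) * gN a a' (b + 1) (e + 1) N = sum_n (fun m => U m (S N - m)%nat + V m (S N - m)%nat) (S N)).
  { rewrite <- Csum_conv_shift.
    - unfold gN. rewrite <- Csum_mult_l. apply Csum_ext_le. intros m Hm.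
      replace (RtoC (INR N)) with (INR m + INR (N - m)) by (rewrite <- INR_add_C; f_equal; f_equal; lia).
      unfold U, V, gterm. simpl pred. rewrite bin_S, INR_S_C.
      replace (INR (S (N - m)) * bin a m * bin a' (S (N - m))) with (bin a m * (INR (S (N - m)) * bin a' (S (N - m)))) by ring.
      rewrite bin_S. replace (e + (INR m + 1)) with (e + 1 + INR m) by ring. replace (e + INR m + 1) with (e + 1 + INR m) by ring. cring.
    - intros n. unfold U. simpl. ring.
    - intros m. unfold V. simpl. ring. }
  rewrite E1. unfold gN, Cminus. rewrite <- (Cmult_1_l (sum_n (fun m => U m _ + _) _)).
  replace (- (1 * sum_n (fun m => U m (S N - m)%nat + V m (S N - m)%nat) (S N))) with
    (- (1) * sum_n (fun m => U m (S N - m)%nat + V m (S N - m)%nat) (S N)) by cring.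
  rewrite <- Csum_mult_l, <- Csum_plus. apply Csum_ext_le. intros m Hm. generalize (S N - m)%nat. intros n.
  unfold U, V, gterm. replace (e + 1 + INR m) with (e + INR m + 1) by ring.
  rewrite <- (poch_diff b m) at 1. 
  transitivity (bin a m * bin a' n * ((pochhammer (b + 1) m - INR m * pochhammer (b + 1) (pred m)) * pochhammer (e + INR m) n)). cring.
  transitivity (bin a m * bin a' n * (pochhammer (b + 1) m * (pochhammer (e + INR m + 1) n - INR n * pochhammer (e + INR m + 1) (pred n)) - INR m * pochhammer (b + 1) (pred m) * pochhammer (e + INR m) n)).
  rewrite (poch_diff (e + INR m) n). cring. cring.
Qed.

(** Only the symbol of [a'] is lowered. After the shift of the index the last factor of
    [(e + m)_(n+1)] is [e + m + n], which depends on the degree alone. *)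
Lemma gN_step_a' a a' b e N :
  gN a a' b e (S N) = gN a (a' + 1) b e (S N) - (e + INR N) * gN a (a' + 1) b e N.
Proof.
  set (V := fun m n : nat => bin a m * pochhammer b m * (INR n * pochhammer (a' + 1) (pred n) / INR (fact n)) * pochhammer (e + INR m) n).
  assert (E1 : (e + INR N) * gN a (a' + 1) b e N = sum_n (fun m => 0 + V m (S N - m)%nat) (S N)).
  { rewrite <- (Csum_conv_shift (fun _ _ => 0)).
    - unfold gN. rewrite <- Csum_mult_l. apply Csum_ext_le. intros m Hm.
      replace (RtoC (INR N)) with (INR m + INR (N - m)) by (rewrite <- INR_add_C; f_equal; f_equal; lia).
      unfold V, gterm. simpl pred. rewrite (poch_S (e + INR m)), fact_S_C. unfold bin.
      cfield; nz.
    - reflexivity.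
    - intros m. unfold V. simpl. unfold Cdiv. ring. }
  rewrite E1. unfold gN, Cminus.
  replace (- sum_n (fun m => 0 + V m (S N - m)%nat) (S N)) with
    (- (1) * sum_n (fun m => 0 + V m (S N - m)%nat) (S N)) by cring.
  rewrite <- Csum_mult_l, <- Csum_plus. apply Csum_ext_le. intros m Hm. generalize (S N - m)%nat. intros n.
  unfold V, gterm, bin. rewrite <- (poch_diff a' n). cfield; nz.
Qed.

Lemma gN_0 a a' b e : gN a a' b e 0 = 1.
Proof. unfold gN. rewrite Csum_O. unfold gterm. simpl. rewrite !bin_0. cring. Qed.

(** Division by [(c)_N] and [(c + 1)_N] brings the recurrences of the numerators to the form of the
    raising step. The value of [f] is [b'], [c - a - a'] or [c - a' - b], according to whether [a'],
    [b] or [a] is raised. *)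
Lemma hN_rel_of_gN (h hp g gp : nat -> C) c f : (0 < Re c)%R ->
  (forall N, h N = g N / pochhammer c N) -> (forall N, hp N = gp N / pochhammer (c + 1) N) ->
  g 0%nat = gp 0%nat -> (forall N, g (S N) = gp (S N) + (f - c - INR N) * gp N) ->
  forall n, c * h n = (c + INR n) * hp n + (f + 1 - c - INR n) * yshift hp n.
Proof.
  intros Hc Hh Hhp H0 HS n.
  assert (Hc1 : (0 < Re (c + 1))%R) by re_lra.
  assert (Hcn : c <> 0) by (apply Re_pos_neq_0; auto).
  assert (E : forall N, pochhammer (c + 1) N = pochhammer c N * (c + INR N) / c).
  { intros N. rewrite <- poch_S, poch_S_l. field. auto. }
  assert (Hcp : forall N, c + INR N <> 0).
  { intros N. apply Re_pos_neq_0. rewrite Re_plus_INR. pose proof (pos_INR N). lra. }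
  destruct n.
  - simpl yshift. rewrite Hh, Hhp, H0. simpl. field.
  - simpl yshift. rewrite Hh, !Hhp, HS, (poch_S c), (E (S n)), (E n), poch_S.
    pose proof (poch_neq_0 c n Hc). pose proof (Hcp n). pose proof (Hcp (S n)).
    rewrite INR_S_C in *. field. auto.
Qed.

(** * Parameters with positive real parts *)

Definition rd (A A' B E C : R) (m n : nat) : R :=
  (rpoch A m * rpoch B m * rpoch A' n * rpoch (E + INR m) n
   / (rpoch C (m + n) * INR (fact m) * INR (fact n)))%R.

Lemma rd_pos A A' B E C m n : (0 < A)%R -> (0 < A')%R -> (0 < B)%R -> (0 < E)%R -> (0 < C)%R ->
  (0 < rd A A' B E C m n)%R.
Proof.
  intros. pose proof (pos_INR m). unfold rd. apply Rdiv_lt_0_compat.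
  - repeat apply Rmult_lt_0_compat; apply rpoch_pos; lra.
  - repeat apply Rmult_lt_0_compat; try apply INR_fact_lt_0. apply rpoch_pos; auto.
Qed.

Lemma RtoC_rd (A A' B E C : R) m n : (0 < C)%R ->
  dcoef A A' B (C - E) C m n = RtoC (rd A A' B E C m n).
Proof.
  intros HC. unfold dcoef, rd.
  replace (C - (C - E) + INR m) with (RtoC (E + INR m)) by (rewrite RtoC_plus; ring).
  rewrite !RtoC_rpoch, <- !RtoC_mult, <- RtoC_div. reflexivity.
  pose proof (rpoch_pos C (m + n) HC). pose proof (INR_fact_lt_0 m). pose proof (INR_fact_lt_0 n).
  apply Rgt_not_eq. repeat apply Rmult_lt_0_compat; auto.
Qed.

Lemma dcoef_bound a a' b b' c : (0 < Re a)%R -> (0 < Re a')%R -> (0 < Re b)%R ->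
  (0 < Re (c - b'))%R -> (0 < Re c)%R ->
  exists K, (0 <= K)%R /\ forall m n,
    (Cmod (dcoef a a' b b' c m n) <= K * rd (Re a) (Re a') (Re b) (Re (c - b')) (Re c) m n)%R.
Proof.
  intros Ha Ha' Hb He Hc.
  destruct (poch_abs a Ha) as [K1 [HK1 H1]]. destruct (poch_abs a' Ha') as [K2 [HK2 H2]].
  destruct (poch_abs b Hb) as [K3 [HK3 H3]]. destruct (poch_abs _ He) as [K4 [HK4 H4]].
  exists (K1 * K3 * K2 * K4)%R. split. repeat apply Rmult_le_pos; lra. intros m n.
  (* The constant must not depend on [m]: the symbol is the quotient of those of length [m + n] and
     [m] at [c - b'], the first bounded above and the second below by its real counterpart. *)
  assert (H5 : (Cmod (pochhammer (c - b' + INR m) n) <= K4 * rpoch (Re (c - b')%C + INR m) n)%R).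
  { specialize (H4 (m + n)%nat). rewrite poch_add, Cmod_mult, rpoch_add in H4.
    pose proof (rpoch_le_Cmod _ m He). pose proof (rpoch_pos _ m He).
    pose proof (pos_INR m).
    assert (0 < rpoch (Re (c - b')%C + INR m) n)%R by (apply rpoch_pos; lra).
    pose proof (Cmod_ge_0 (pochhammer (c - b' + INR m) n)).
    apply Rmult_le_reg_l with (rpoch (Re (c - b')%C) m); auto. nra. }
  unfold dcoef, rd. rewrite Cmod_div, !Cmod_mult, !Cmod_INR.
  2:{ repeat apply Cmult_neq_0; try apply INR_fact_C_neq. apply poch_neq_0; auto. }
  pose proof (rpoch_pos _ (m + n) Hc) as Hp. pose proof (rpoch_le_Cmod c (m + n) Hc) as Hq.
  pose proof (INR_fact_lt_0 m) as F1. pose proof (INR_fact_lt_0 n) as F2.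
  pose proof (rpoch_pos _ m Ha) as P1. pose proof (rpoch_pos _ m Hb) as P2. pose proof (rpoch_pos _ n Ha') as P3.
  unfold Rdiv.
  replace (K1 * K3 * K2 * K4 * (rpoch (Re a) m * rpoch (Re b) m * rpoch (Re a') n * rpoch (Re (c - b')%C + INR m) n * / (rpoch (Re c) (m + n) * INR (fact m) * INR (fact n))))%R
    with (((K1 * rpoch (Re a) m) * (K3 * rpoch (Re b) m) * (K2 * rpoch (Re a') n) * (K4 * rpoch (Re (c - b')%C + INR m) n)) * / (rpoch (Re c) (m + n) * INR (fact m) * INR (fact n)))%R by ring.
  apply Rmult_le_compat.
  - repeat apply Rmult_le_pos; apply Cmod_ge_0.
  - left. apply Rinv_0_lt_compat. repeat apply Rmult_lt_0_compat; auto. lra.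
  - repeat apply Rmult_le_compat; auto using Cmod_ge_0; repeat apply Rmult_le_pos; apply Cmod_ge_0.
  - apply Rinv_le_contravar. repeat apply Rmult_lt_0_compat; auto.
    repeat apply Rmult_le_compat_r; auto; lra.
Qed.

(** Gauss' theorem in [n], with parameters [a'], [c - b' + m] and [c + m], replaces [(c)_m] by
    [(c - a')_m]. The remaining sum over [m] is again a Gauss sum, with parameters [a], [b] and
    [c - a']. *)
Lemma dcoef_rows a a' b b' c : (0 < Re a)%R -> (0 < Re a')%R -> (0 < Re b)%R ->
  (0 < Re (c - b'))%R -> (0 < Re (b' - a'))%R -> (0 < Re (c - a' - a - b))%R ->
  exists r, (forall m, is_Cseries (dcoef a a' b b' c m) (r m)) /\
    is_Cseries r (Gamma c * Gamma (b' - a') * Gamma (c - a' - a - b) *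
      (rGamma b' * rGamma (c - a' - a) * rGamma (c - a' - b))).
Proof.
  intros Ha Ha' Hb He Hba Hcab.
  assert (Hca : (0 < Re (c - a'))%R) by re_lra.
  assert (Hc : (0 < Re c)%R) by re_lra.
  set (X := Gamma c * Gamma (b' - a') * rGamma (c - a') * rGamma b').
  exists (fun m => X * (bin a m * (pochhammer b m / pochhammer (c - a') m))). split.
  - intros m. pose proof (pos_INR m) as Hm.
    assert (Hbm : (0 < Re (c - b' + INR m))%R) by (rewrite Re_plus_INR; lra).
    assert (Hd : (0 < Re (c + INR m - a' - (c - b' + INR m)))%R).
    { replace (c + INR m - a' - (c - b' + INR m)) with (b' - a') by ring. auto. }
    pose proof (is_series_C_scal (bin a m * (pochhammer b m / pochhammer c m)) _ _
      (gauss_sum a' (c - b' + INR m) (c + INR m) Ha' Hbm Hd)) as H.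
    replace (c + INR m - a' - (c - b' + INR m)) with (b' - a') in H by ring.
    replace (c + INR m - (c - b' + INR m)) with b' in H by ring.
    replace (c + INR m - a') with (c - a' + INR m) in H by ring.
    rewrite Gamma_poch in H by auto.
    pose proof (poch_neq_0 c m Hc). pose proof (poch_neq_0 _ m Hca).
    replace (X * (bin a m * (pochhammer b m / pochhammer (c - a') m))) with
     (bin a m * (pochhammer b m / pochhammer c m) * (pochhammer c m * Gamma c * Gamma (b' - a') * (rGamma (c - a' + INR m) * rGamma b'))).
    + eapply is_series_C_ext; [|exact H]. intros n. cbv beta. rewrite dcoef_factor by auto. ring.
    + unfold X. rewrite (rGamma_poch (c - a') m). field. auto.
  - pose proof (is_series_C_scal X _ _ (gauss_sum a b (c - a') Ha Hb Hcab)) as H.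
    replace (Gamma c * Gamma (b' - a') * Gamma (c - a' - a - b) *
      (rGamma b' * rGamma (c - a' - a) * rGamma (c - a' - b))) with
      (X * (Gamma (c - a') * Gamma (c - a' - a - b) * (rGamma (c - a' - a) * rGamma (c - a' - b)))).
    exact H. unfold X. unfold Gamma at 3. field. apply rGamma_neq_0; auto.
Qed.

(** All terms are positive, so the convergence of the iterated sum is already absolute convergence
    of the double series. *)
Lemma rd_dbounded A A' B E C : (0 < A)%R -> (0 < A')%R -> (0 < B)%R -> (0 < E)%R ->
  (0 < C - E - A')%R -> (0 < C - A' - A - B)%R -> dbounded (rd A A' B E C).
Proof.
  intros HA HA' HB HE H1 H2.
  assert (HC : (0 < C)%R) by lra.
  destruct (dcoef_rows A A' B (C - E) C) as [r [Hr Hl]]; try (unfold Re; simpl; lra).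
  assert (Hr' : forall m, is_series (rd A A' B E C m) (Re (r m))).
  { intros m. eapply is_series_ext; [|exact (is_series_Re _ _ (Hr m))].
    intros n. cbv beta. rewrite RtoC_rd by auto. reflexivity. }
  apply dbounded_of_rows.
  - intros; left; apply rd_pos; auto.
  - intros m. eexists; apply Hr'.
  - eexists. eapply is_series_ext; [|exact (is_series_Re _ _ Hl)].
    intros m. symmetry. apply is_series_unique. apply Hr'.
Qed.

(** Serves to convert summability against Beta values into a growth bound. Only the part of the
    integral over [[t / 4, t / 2]] with [t = 1 - y] is kept; there [(1 - u)^n >= y^n]. *)
Lemma Bv_lower C s : (0 < C)%R -> (0 < s)%R -> exists k, (0 < k)%R /\
  forall n y, (0 <= y < 1)%R -> (k * (y ^ n * Rpower (1 - y) s) <= Re (Bv (RtoC (C + INR n)) (RtoC s)))%R.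
Proof.
  intros HC Hs.
  (* A lower bound for [(1 - u)^(C - 1)] when [u <= 1/2], as the reciprocal of an upper bound for
     the opposite exponent. *)
  set (k0 := (/ (1 + Rpower (1 / 2) (- (C - 1))))%R).
  assert (Hk0 : (0 < k0)%R).
  { apply Rinv_0_lt_compat. pose proof (exp_pos (- (C - 1) * ln (1 / 2))). unfold Rpower. lra. }
  exists (k0 * Rpower (/ 4) s / 4)%R. split.
  { apply Rdiv_lt_0_compat; [|lra]. apply Rmult_lt_0_compat; auto. apply exp_pos. }
  intros n y Hy. pose proof (pos_INR n).
  set (t := (1 - y)%R). assert (Ht : (0 < t <= 1)%R) by (unfold t; lra).
  assert (HCn : (0 < Re (RtoC (C + INR n)))%R) by (unfold Re; simpl; lra).
  assert (Hss : (0 < Re (RtoC s))%R) by exact Hs.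
  assert (HG : II (fun u => RtoC (rbk (C + INR n) s u)) (Bv (RtoC (C + INR n)) (RtoC s))).
  { apply II_ext with (bk (RtoC (C + INR n)) (RtoC s)). intros; symmetry; apply RtoC_rbk. apply II_bk; auto. }
  assert (Hab : (t / 4 <= t / 2)%R) by lra.
  assert (Ht4 : (0 < t / 4)%R) by lra. assert (Ht2 : (t / 2 < 1)%R) by lra.
  pose proof (II_IntC_bound _ _ _ (t / 4) (t / 2) (proj1 HG) HG
    (fun u Hu => eq_ind_r (fun z => (z <= _)%R) (Rle_refl _) (eq_trans (Cmod_R _) (Rabs_pos_eq _ (Rlt_le _ _ (rbk_pos _ _ _))))) Ht4 Hab Ht2) as HB.
  assert (HR : (RInt (rbk (C + INR n) s) (t / 4) (t / 2) <= 2 * Re (Bv (RtoC (C + INR n)) (RtoC s)))%R).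
  { eapply Rle_trans; [|exact HB]. eapply Rle_trans; [|apply Re_le_Cmod]. apply Rle_refl. }
  (* A pointwise lower bound of the kernel, from [u^(s - 1) = u^s / u >= (t / 4)^s / (t / 2)]; the
     interval has length [t / 4]. *)
  set (lo := (k0 * (y ^ n * Rpower (t / 4) s) / (t / 2))%R).
  assert (Hlo : (lo * (t / 4) <= RInt (rbk (C + INR n) s) (t / 4) (t / 2))%R).
  { replace (lo * (t / 4))%R with (RInt (fun _ : R => lo) (t / 4) (t / 2)).
    2:{ rewrite RInt_const. unfold scal; simpl; unfold mult; simpl. field. }
    apply RInt_le; auto.
    - apply ex_RInt_const.
    - apply ex_RInt_cont; auto. intros u Hu. apply continuous_rbk. lra.
    - intros u Hu. rewrite rbk_add by lra. unfold lo, rbk.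
      assert (E1 : (k0 <= Rpower (1 - u) (C - 1))%R).
      { unfold k0. pose proof (Rpower_half_bound (1 - u) (- (C - 1)) ltac:(lra)) as Hh.
        rewrite Rpower_Ropp in Hh at 1.
        pose proof (exp_pos ((C - 1) * ln (1 - u))) as Hp. fold (Rpower (1 - u) (C - 1)) in Hp.
        replace (Rpower (1 - u) (C - 1)) with (/ / Rpower (1 - u) (C - 1))%R by (rewrite Rinv_inv; reflexivity).
        apply Rinv_le_contravar; auto. apply Rinv_0_lt_compat; auto. }
      assert (E2 : (y ^ n <= (1 - u) ^ n)%R) by (apply pow_incr; unfold t in *; lra).
      assert (E3 : (Rpower (t / 4) s / (t / 2) <= Rpower u (s - 1))%R).
      { replace (s - 1)%R with (s + - (1))%R by ring. rewrite Rpower_plus, Rpower_Ropp, Rpower_1 by lra.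
        apply Rmult_le_compat. left; apply exp_pos. left; apply Rinv_0_lt_compat; lra.
        apply Rle_Rpower_l; lra. apply Rinv_le_contravar; lra. }
      assert (E4 : (0 <= y ^ n)%R) by (apply pow_le; lra).
      assert (E5 : (0 < Rpower (t / 4) s / (t / 2))%R) by (apply Rdiv_lt_0_compat; [apply exp_pos|lra]).
      replace (k0 * (y ^ n * Rpower (t / 4) s) / (t / 2))%R with (y ^ n * ((Rpower (t / 4) s / (t / 2)) * k0))%R by (field; lra).
      apply Rmult_le_compat; auto. apply Rmult_le_pos; lra. apply Rmult_le_compat; lra. }
  replace (k0 * Rpower (/ 4) s / 4 * (y ^ n * Rpower t s))%R with (/ 2 * (lo * (t / 4)))%R.
  lra. unfold lo. replace (t / 4)%R with (/ 4 * t)%R by field. rewrite <- Rpower_mult_distr by lra. field. lra.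
Qed.

(** The value of the operator at [t^(rho - 1)] up to a power of [x]. At [rho + k] it supplies six of
    the eight Gamma factors in the [k]-th Wright term. *)
Definition MG (a a' b b' c rho : C) : C :=
  Gamma rho * Gamma (rho + c - a - a' - b) * Gamma (rho + b' - a') *
  (rGamma (rho + b') * rGamma (rho + c - a - a') * rGamma (rho + c - a' - b)).

(** The second part descends by integration by parts, whose boundary terms need the first one; hence
    the conjunction. The conditions contain only [c - a - a' - b] and [b' - a'], so they transfer
    unchanged. *)
Definition Good (a a' b b' c : C) : Prop :=
  (forall s : R, (0 < s)%R -> (0 < s + Re (c - a - a' - b))%R -> (0 < s + Re (b' - a'))%R ->
     InD s (hN a a' b b' c)) /\
  (forall rho, (0 < Re rho)%R -> (0 < Re (rho + c - a - a' - b))%R -> (0 < Re (rho + b' - a'))%R ->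
     II (fun t => HS (hN a a' b b' c) (1 - t) * bk c rho t) (Gamma c * MG a a' b b' c rho)).

Section Base.

Context (a a' b b' c : C).
Context (Ha : (0 < Re a)%R).
Context (Ha' : (0 < Re a')%R).
Context (Hb : (0 < Re b)%R).
Context (He : (0 < Re (c - b'))%R).
Context (Hc : (0 < Re c)%R).

Let D (C : R) := rd (Re a) (Re a') (Re b) (Re (c - b')) C.

(** Multiplication by [B(Re c + N, s)] replaces the denominator [(Re c)_N] by [(Re c + s)_N], up to
    a constant. The convergence conditions of the positive double series at [Re c + s] are exactly
    the conditions on [s]. *)
Lemma base_majorant : exists HR : nat -> R,
  (forall n, (Cmod (hN a a' b b' c n) <= HR n)%R) /\
  (forall y, (0 <= y < 1)%R -> ex_series (fun n => HR n * y ^ n)%R) /\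
  (forall s : R, (0 < s)%R -> (0 < s + Re (c - a - a' - b))%R -> (0 < s + Re (b' - a'))%R ->
    ex_series (fun n => HR n * Re (Bv (RtoC (Re c + INR n)) (RtoC s)))%R).
Proof.
  destruct (dcoef_bound a a' b b' c Ha Ha' Hb He Hc) as [K [HK HKb]]. fold (D (Re c)) in HKb.
  assert (HDp : forall C m n, (0 < C)%R -> (0 < D C m n)%R) by (intros; apply rd_pos; auto).
  exists (fun N => K * sum_n (fun m => D (Re c) m (N - m)%nat) N)%R. split; [|split].
  - intros N. unfold hN. eapply Rle_trans. apply Cmod_sum_le. rewrite <- Rsum_mult_l. apply Rsum_le.
    intros m Hm. apply HKb.
  - intros y Hy.
    assert (Hs : subexp2 (fun m n => RtoC (D (Re c) m n))).
    { assert (Hrc : (0 < Re (RtoC (Re c)))%R) by exact Hc.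
      eapply subexp2_ext; [|exact (subexp2_dcoef (Re a) (Re a') (Re b) (Re c - Re (c - b')) (Re c) Hrc)].
      intros m n. apply RtoC_rd. auto. }
    pose proof (subexp2_dbounded _ y y Hs Hy Hy) as Hd.
    apply dbounded_diag in Hd.
    2:{ intros. apply Rmult_le_pos. apply Cmod_ge_0. apply Rmult_le_pos; apply pow_le; lra. }
    eapply ex_series_ext; [|exact (ex_series_R_scal K _ Hd)].
    intros N. simpl. rewrite Rmult_assoc, <- Rsum_mult_r. f_equal. apply sum_n_ext_loc. intros m Hm.
    rewrite Cmod_R, Rabs_pos_eq by (left; auto).
    replace (y ^ N)%R with (y ^ (m + (N - m)))%R by (f_equal; lia). rewrite pow_add. reflexivity.
  - intros s Hs1 Hs2 Hs3.
    assert (HCs : (0 < Re c + s)%R) by lra.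
    assert (Hd : dbounded (D (Re c + s)%R)).
    { apply rd_dbounded; auto; unfold Re in *; simpl in *; lra. }
    apply dbounded_diag in Hd; [|intros; left; auto].
    eapply ex_series_ext; [|exact (ex_series_R_scal (K * Re (Bv (RtoC (Re c)) (RtoC s))) _ Hd)].
    intros N. cbv beta.
    assert (EB : Re (Bv (RtoC (Re c + INR N)) (RtoC s)) = (rpoch (Re c) N / rpoch (Re c + s) N * Re (Bv (RtoC (Re c)) (RtoC s)))%R).
    { assert (Hrc : (0 < Re (RtoC (Re c)))%R) by exact Hc.
      assert (Hrs : (0 < Re (RtoC s))%R) by exact Hs1.
      rewrite RtoC_plus, !Bv_value; auto.
      2:{ rewrite Re_plus_INR. pose proof (pos_INR N). lra. }
      rewrite Gamma_poch by auto.
      replace (RtoC (Re c) + INR N + s) with (RtoC (Re c + s) + INR N) by (rewrite RtoC_plus; ring).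
      rewrite <- (RtoC_plus (Re c) s), (rGamma_poch (RtoC (Re c + s)) N).
      pose proof (rpoch_pos (Re c + s) N HCs).
      rewrite !RtoC_rpoch.
      generalize (Gamma (Re c)) (Gamma s) (rGamma (RtoC (Re c + s) + INR N)). intros x y z.
      unfold Re; simpl. field. unfold Re in *; lra. }
    rewrite EB. rewrite <- Rsum_mult_l.
    transitivity (K * (sum_n (fun m => D (Re c) m (N - m)%nat) N * (rpoch (Re c) N / rpoch (Re c + s) N * Re (Bv (RtoC (Re c)) (RtoC s)))))%R; [|rring].
    rewrite <- Rsum_mult_r, <- Rsum_mult_l. apply sum_n_ext_loc. intros m Hm.
    unfold D, rd. replace (m + (N - m))%nat with N by lia.
    pose proof (rpoch_pos (Re c + s) N HCs). pose proof (rpoch_pos (Re c) N Hc).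
    pose proof (INR_fact_lt_0 m). pose proof (INR_fact_lt_0 (N - m)). apply Rplus_0_inj. field. lra.
Qed.

Lemma base_good : Good a a' b b' c.
Proof.
  destruct base_majorant as [HR [HR1 [HR2 HR3]]].
  assert (HR0 : forall n, (0 <= HR n)%R) by (intros; eapply Rle_trans; [apply Cmod_ge_0|apply HR1]).
  split.
  - intros s Hs1 Hs2 Hs3. specialize (HR3 s Hs1 Hs2 Hs3).
    destruct (Bv_lower (Re c) s Hc Hs1) as [k [Hk Hkb]].
    set (W := Series (fun n => HR n * Re (Bv (RtoC (Re c + INR n)) (RtoC s)))%R).
    apply InD_base with (W / k)%R. intros y N Hy.
    assert (Hp : (0 < Rpower (1 - y) s)%R) by apply exp_pos.
    rewrite Rpower_Ropp.
    apply Rmult_le_reg_r with (k * Rpower (1 - y) s)%R. apply Rmult_lt_0_compat; auto.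
    replace (W / k * / Rpower (1 - y) s * (k * Rpower (1 - y) s))%R with W by (field; lra).
    rewrite <- Rsum_mult_r.
    assert (HBn : forall n, (0 <= Re (Bv (RtoC (Re c + INR n)) (RtoC s)))%R).
    { intros n. assert (H0 : (0 <= 0 < 1)%R) by lra. eapply Rle_trans; [|apply (Hkb n 0%R H0)].
      apply Rmult_le_pos. lra. apply Rmult_le_pos. apply pow_le; lra. left; apply exp_pos. }
    apply Rle_trans with (sum_n (fun n => HR n * Re (Bv (RtoC (Re c + INR n)) (RtoC s)))%R N).
    + apply Rsum_le. intros n _.
      replace (Cmod (hN a a' b b' c n) * y ^ n * (k * Rpower (1 - y) s))%R with (Cmod (hN a a' b b' c n) * (k * (y ^ n * Rpower (1 - y) s)))%R by ring.
      apply Rmult_le_compat; auto using Cmod_ge_0.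
      apply Rmult_le_pos. lra. apply Rmult_le_pos. apply pow_le; lra. left; apply exp_pos.
    + apply sum_le_Series; auto. intros n. apply Rmult_le_pos; auto.
  - intros rho Hr1 Hr2 Hr3.
    destruct (II_power_bk (hN a a' b b' c) HR c rho Hc Hr1 HR1 HR2) as [S [HS1 HS2]].
    { apply HR3; auto; unfold Re in *; simpl in *; lra. }
    replace (Gamma c * MG a a' b b' c rho) with S; auto.
    (* The factor [B(c + N, rho)] turns [1 / (c)_N] into [B(c, rho) / (c + rho)_N]. Shifting [b'] as
       well keeps [c - b'], so the termwise integrals form a double sum of the same kind. *)
    set (b1 := b' + rho). set (c1 := c + rho).
    assert (He1 : (0 < Re (c1 - b1))%R) by (unfold b1, c1; re_lra).
    assert (Hba1 : (0 < Re (b1 - a'))%R) by (unfold b1; re_lra).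
    assert (Hcab1 : (0 < Re (c1 - a' - a - b))%R) by (unfold c1; re_lra).
    assert (Hc1 : (0 < Re c1)%R) by (unfold c1; re_lra).
    destruct (dcoef_rows a a' b b1 c1 Ha Ha' Hb He1 Hba1 Hcab1) as [r [Hr Hl]].
    destruct (dcoef_bound a a' b b1 c1 Ha Ha' Hb He1 Hc1) as [K [HK HKb]].
    assert (Hd : dbounded (fun m n => Cmod (dcoef a a' b b1 c1 m n))).
    { eapply dbounded_le; [exact HKb|]. apply (dbounded_scal K); auto.
      apply rd_dbounded; auto; unfold b1, c1, Re in *; simpl in *; lra. }
    pose proof (is_series2_diag _ _ (is_series2_of_rows _ _ _ Hd Hr Hl)) as H.
    pose proof (is_series_C_scal (Bv c rho) _ _ H) as H2.
    assert (Heq : forall N, Bv c rho * sum_n (fun m => dcoef a a' b b1 c1 m (N - m)) N =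
      hN a a' b b' c N * Bv (c + INR N) rho).
    { intros N. unfold hN. rewrite <- Csum_mult_l, <- Csum_mult_r. apply Csum_ext_le. intros m Hm.
    pose proof (pos_INR N) as HN.
    assert (HcN : (0 < Re (c + INR N))%R) by (rewrite Re_plus_INR; lra).
    rewrite !Bv_value, Gamma_poch by auto.
    replace (c + INR N + rho) with (c1 + INR N) by (unfold c1; ring). fold c1.
    rewrite (rGamma_poch c1 N).
    unfold dcoef. replace (m + (N - m))%nat with N by lia.
    replace (c1 - b1) with (c - b') by (unfold b1, c1; ring).
    pose proof (poch_neq_0 c N Hc). pose proof (poch_neq_0 c1 N Hc1).
    cfield; nz. }
    rewrite (is_series_C_unique _ _ _ HS1 (is_series_C_ext _ _ _ Heq H2)).
    rewrite Bv_value by auto. unfold MG, b1, c1.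
    replace (b' + rho - a') with (rho + b' - a') by ring.
    replace (c + rho - a' - a - b) with (rho + c - a - a' - b) by ring.
    replace (b' + rho) with (rho + b') by ring.
    replace (c + rho - a' - a) with (rho + c - a - a') by ring.
    replace (c + rho - a' - b) with (rho + c - a' - b) by ring.
    change (Gamma (c + rho)) with (/ rGamma (c + rho)). cfield. apply rGamma_neq_0. exact Hc1.
Qed.

End Base.

(** * Lowering the parameters *)

Lemma below_three x y z : (0 < x)%R -> (0 < y)%R -> (0 < z)%R ->
  exists d, (0 < d /\ d <= x /\ d <= y /\ d <= z)%R.
Proof.
  intros Hx Hy Hz. exists (Rmin x (Rmin y z)).
  pose proof (Rmin_l x (Rmin y z)). pose proof (Rmin_r x (Rmin y z)).
  pose proof (Rmin_l y z). pose proof (Rmin_r y z).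
  split; [repeat apply Rmin_pos; auto|lra].
Qed.

Lemma Good_step a a' b b' c a1 a1' b1 b1' f : (0 < Re c)%R ->
  (forall n, c * hN a a' b b' c n = (c + INR n) * hN a1 a1' b1 b1' (c + 1) n + (f + 1 - c - INR n) * yshift (hN a1 a1' b1 b1' (c + 1)) n) ->
  c + 1 - a1 - a1' - b1 = c - a - a' - b -> b1' - a1' = b' - a' ->
  (forall rho, MG a a' b b' c rho = (f + rho) * MG a1 a1' b1 b1' (c + 1) rho) ->
  Good a1 a1' b1 b1' (c + 1) -> Good a a' b b' c.
Proof.
  intros Hc Hrel E1 E2 EM [HA HB].
  assert (Hcn : c <> 0) by (apply Re_pos_neq_0; auto).
  split.
  - intros s Hs1 Hs2 Hs3. apply (step_InD _ _ c f Hc Hrel). apply HA; auto.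
    rewrite E1; auto. rewrite E2; auto.
  - intros rho Hr1 Hr2 Hr3.
    set (e1 := Re (c - a - a' - b)). set (e2 := Re (b' - a')).
    assert (R2 : (0 < Re rho + e1)%R) by (unfold e1; unfold Re in *; simpl in *; lra).
    assert (R3 : (0 < Re rho + e2)%R) by (unfold e2; unfold Re in *; simpl in *; lra).
    destruct (below_three _ _ _ Hr1 R2 R3) as [d [Hd [D1 [D2 D3]]]].
    rewrite EM.
    replace (Gamma c * ((f + rho) * MG a1 a1' b1 b1' (c + 1) rho)) with
      ((f + rho) / c * (Gamma (c + 1) * MG a1 a1' b1 b1' (c + 1) rho)).
    2:{ rewrite Gamma_S by auto. field. auto. }
    (* An exponent strictly below [Re rho]. Since [d] is at most each of the three positive margins,
       it still meets the conditions of the growth bound. *)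
    apply (step_II _ _ c f Hc Hrel (Re rho - d / 2)).
    + apply HA. lra. rewrite E1. fold e1. lra. rewrite E2. fold e2. lra.
    + lra.
    + apply HB; auto.
      replace (rho + (c + 1) - a1 - a1' - b1) with (rho + (c + 1 - a1 - a1' - b1)) by ring. rewrite E1.
      replace (rho + (c - a - a' - b)) with (rho + c - a - a' - b) by ring. auto.
      replace (rho + b1' - a1') with (rho + (b1' - a1')) by ring. rewrite E2.
      replace (rho + (b' - a')) with (rho + b' - a') by ring. auto.
Qed.

(** In [MG] only [1 / Gamma(rho + b')] changes; its functional equation yields the factor
    [rho + b'], which fixes [f = b']. *)
Lemma Good_step_a' a a' b b' c : (0 < Re c)%R -> Good a (a' + 1) b (b' + 1) (c + 1) -> Good a a' b b' c.
Proof.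
  intros Hc. assert (Hc1 : (0 < Re (c + 1))%R) by re_lra.
  apply (Good_step _ _ _ _ _ _ _ _ _ b' Hc).
  - apply (hN_rel_of_gN _ _ (gN a a' b (c - b')) (gN a (a' + 1) b (c - b'))); auto; try (now rewrite !gN_0).
    + intros N. apply hN_gN; auto.
    + intros N. rewrite hN_gN by auto. do 2 f_equal. ring.
    + intros N. rewrite gN_step_a'. ring.
  - ring.
  - ring.
  - intros rho. unfold MG.
    replace (rho + (c + 1) - a - (a' + 1) - b) with (rho + c - a - a' - b) by ring.
    replace (rho + (b' + 1) - (a' + 1)) with (rho + b' - a') by ring.
    replace (rho + (c + 1) - a - (a' + 1)) with (rho + c - a - a') by ring.
    replace (rho + (c + 1) - (a' + 1) - b) with (rho + c - a' - b) by ring.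
    replace (rho + (b' + 1)) with (rho + b' + 1) by ring.
    rewrite (rGamma_S (rho + b')). ring.
Qed.

(** Here [1 / Gamma(rho + c - a - a')] is the only factor that changes, so [f = c - a - a']. *)
Lemma Good_step_b a a' b b' c : (0 < Re c)%R -> Good a a' (b + 1) b' (c + 1) -> Good a a' b b' c.
Proof.
  intros Hc. assert (Hc1 : (0 < Re (c + 1))%R) by re_lra.
  apply (Good_step _ _ _ _ _ _ _ _ _ (c - a - a') Hc).
  - apply (hN_rel_of_gN _ _ (gN a a' b (c - b')) (gN a a' (b + 1) (c - b' + 1))); auto; try (now rewrite !gN_0).
    + intros N. apply hN_gN; auto.
    + intros N. rewrite hN_gN by auto. do 2 f_equal. ring.
    + intros N. rewrite gN_step_b. ring.
  - ring.
  - ring.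
  - intros rho. unfold MG.
    replace (rho + (c + 1) - a - a' - (b + 1)) with (rho + c - a - a' - b) by ring.
    replace (rho + (c + 1) - a' - (b + 1)) with (rho + c - a' - b) by ring.
    replace (rho + (c + 1) - a - a') with (rho + c - a - a' + 1) by ring.
    rewrite (rGamma_S (rho + c - a - a')). ring.
Qed.

(** The coefficients are symmetric in [a] and [b], so the recurrence for [b] is reused with the two
    exchanged. *)
Lemma Good_step_a a a' b b' c : (0 < Re c)%R -> Good (a + 1) a' b b' (c + 1) -> Good a a' b b' c.
Proof.
  intros Hc. assert (Hc1 : (0 < Re (c + 1))%R) by re_lra.
  apply (Good_step _ _ _ _ _ _ _ _ _ (c - a' - b) Hc).
  - apply (hN_rel_of_gN _ _ (gN b a' a (c - b')) (gN b a' (a + 1) (c - b' + 1))); auto; try (now rewrite !gN_0).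
    + intros N. rewrite hN_sym. apply hN_gN; auto.
    + intros N. rewrite hN_sym, hN_gN by auto. do 2 f_equal. ring.
    + intros N. rewrite gN_step_b. ring.
  - ring.
  - ring.
  - intros rho. unfold MG.
    replace (rho + (c + 1) - (a + 1) - a' - b) with (rho + c - a - a' - b) by ring.
    replace (rho + (c + 1) - (a + 1) - a') with (rho + c - a - a') by ring.
    replace (rho + (c + 1) - a' - b) with (rho + c - a' - b + 1) by ring.
    rewrite (rGamma_S (rho + c - a' - b)). ring.
Qed.

Lemma Good_iter (P : C -> C -> C -> C -> C -> Prop) (da da' db db' : C) :
  (forall a a' b b' c, (0 < Re c)%R -> P (a + da) (a' + da') (b + db) (b' + db') (c + 1) -> P a a' b b' c) ->
  forall k a a' b b' c, (0 < Re c)%R ->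
  P (a + INR k * da) (a' + INR k * da') (b + INR k * db) (b' + INR k * db') (c + INR k) -> P a a' b b' c.
Proof.
  intros H. induction k; intros a a' b b' c Hc HP.
  - simpl INR in HP. rewrite !Cmult_0_l, !Cplus_0_r in HP. exact HP.
  - apply H; auto. apply IHk. re_lra. rewrite INR_S_C in HP.
    replace (a + (INR k + 1) * da) with (a + da + INR k * da) in HP by ring.
    replace (a' + (INR k + 1) * da') with (a' + da' + INR k * da') in HP by ring.
    replace (b + (INR k + 1) * db) with (b + db + INR k * db) in HP by ring.
    replace (b' + (INR k + 1) * db') with (b' + db' + INR k * db') in HP by ring.
    replace (c + (INR k + 1)) with (c + 1 + INR k) in HP by ring. exact HP.
Qed.

Lemma INR_above (x : R) : exists k, (x < INR k)%R.
Proof.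
  destruct (Rle_lt_dec x 0) as [H|H].
  - exists 1%nat. simpl. lra.
  - destruct (archimed_cor1 (/ x)) as [k [Hk Hk0]]. apply Rinv_0_lt_compat; auto.
    exists k. apply Rinv_lt_cancel; auto using lt_0_INR.
Qed.

Lemma Good_all a a' b b' c : (0 < Re c)%R -> Good a a' b b' c.
Proof.
  intros Hc.
  (* After [k] raisings of each kind [a], [a'], [b] and [b'] have grown by [k] and [c] by [3 k], so
     [c - b'] has grown by [2 k]. A [k] above all the real parts together makes every condition of
     the base case hold. *)
  destruct (INR_above (Rabs (Re a) + Rabs (Re a') + Rabs (Re b) + Rabs (Re c) + Rabs (Re b'))) as [k Hk].
  pose proof (Rle_abs (- Re a)) as A1. pose proof (Rle_abs (- Re a')) as A2. pose proof (Rle_abs (- Re b)) as A3.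
  pose proof (Rle_abs (- Re c)) as A4. pose proof (Rle_abs (Re b')) as A5.
  rewrite Rabs_Ropp in A1, A2, A3, A4.
  pose proof (Rabs_pos (Re a)). pose proof (Rabs_pos (Re a')). pose proof (Rabs_pos (Re b)).
  pose proof (Rabs_pos (Re c)). pose proof (Rabs_pos (Re b')). pose proof (pos_INR k) as Hk0.
  apply (Good_iter Good 0 1 0 1) with k; auto.
  { intros x x' y y' z Hz HG. rewrite !Cplus_0_r in HG. apply Good_step_a'; auto. }
  apply (Good_iter Good 0 0 1 0) with k.
  { intros x x' y y' z Hz HG. rewrite !Cplus_0_r in HG. apply Good_step_b; auto. }
  { unfold Re in *; simpl in *; lra. }
  apply (Good_iter Good 1 0 0 0) with k.
  { intros x x' y y' z Hz HG. rewrite !Cplus_0_r in HG. apply Good_step_a; auto. }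
  { unfold Re in *; simpl in *; lra. }
  apply base_good; unfold Re in *; simpl in *; lra.
Qed.

(** * The Bessel-Struve kernel *)

(* The coefficient of [z^k] in [BesselStruve nu z], without [Gamma (nu + 1) / sqrt PI]. *)
Definition bs (nu : C) (k : nat) : C :=
  Gamma ((INR k + 1) / 2) * rGamma (INR k / 2 + nu + 1) / INR (fact k).

Lemma two_step_bound (q : nat -> R) K : (forall k, (0 <= q k)%R) ->
  (forall k, (K <= k)%nat -> (q (S (S k)) <= 2 * q k)%R) ->
  exists M, (0 <= M)%R /\ forall k, (q k <= M * 2 ^ k)%R.
Proof.
  intros Hq H. exists (sum_n q (S K)). split. apply Rsum_nonneg; auto.
  assert (H2 : forall k, (1 <= 2 ^ k)%R) by (intros; apply pow_R1_Rle; lra).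
  assert (HM : forall k, (k <= S K)%nat -> (q k <= sum_n q (S K))%R).
  { intros k Hk. apply Rle_trans with (sum_n q k). destruct k. rewrite Rsum_O; lra.
    rewrite Rsum_Sn. pose proof (Rsum_nonneg q k Hq). lra. apply Rsum_incr; auto. }
  assert (HM0 : (0 <= sum_n q (S K))%R) by (apply Rsum_nonneg; auto).
  assert (Hall : forall k, (q k <= sum_n q (S K) * 2 ^ k)%R /\ (q (S k) <= sum_n q (S K) * 2 ^ S k)%R).
  { induction k.
    - split. specialize (HM 0%nat ltac:(lia)). simpl. lra.
      specialize (HM 1%nat ltac:(lia)). simpl. lra.
    - destruct IHk as [I1 I2]. split; auto.
      destruct (Nat.le_gt_cases K k) as [HK|HK].
      + specialize (H k HK). simpl in *. pose proof (H2 k). nra.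
      + specialize (HM (S (S k)) ltac:(lia)). pose proof (H2 (S (S k))). nra. }
  intros k. apply Hall.
Qed.

(** The Gamma arguments advance by [1/2] per index, so the functional equation compares indices two
    apart. The ratio is [((k + 1) / 2) / (k / 2 + nu + 1)], of modulus at most [2] for large [k]. *)
Lemma bs_bound nu : exists M, (0 <= M)%R /\ forall k, (Cmod (bs nu k) <= M * (2 ^ k / INR (fact k)))%R.
Proof.
  set (q := fun k => Cmod (Gamma ((INR k + 1) / 2) * rGamma (INR k / 2 + nu + 1))).
  (* For [k >= K] this gives [k / 2 + Re nu + 1 >= (k + 1) / 4]. *)
  destruct (INR_above (4 * Rabs (Re nu))) as [K HK].
  destruct (two_step_bound q K) as [M [HM HMb]].
  - intros; apply Cmod_ge_0.
  - intros k Hk. unfold q. pose proof (pos_INR k) as Hk0.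
    assert (HkK : (INR K <= INR k)%R) by (apply le_INR; auto).
    set (z := INR k / 2 + nu + 1).
    assert (H2 : RtoC 2 <> 0) by (intros E; apply RtoC_inj in E; lra).
    assert (Ehalf : forall r : R, Re (r / 2) = (r / 2)%R) by (intros; rewrite <- RtoC_div by lra; reflexivity).
    assert (Hz : ((INR k + 1) / 4 <= Cmod z)%R).
    { eapply Rle_trans; [|apply Re_le_Cmod]. unfold z.
      replace (Re (INR k / 2 + nu + 1)) with (INR k / 2 + Re nu + 1)%R.
      2:{ rewrite <- (Ehalf (INR k)). reflexivity. }
      pose proof (Rle_abs (- Re nu)). rewrite Rabs_Ropp in H. lra. }
    assert (Hzn : z <> 0) by (apply (proj2 (Cmod_gt_0 _)); lra).
    rewrite !INR_S_C.
    replace ((INR k + 1 + 1 + 1) / 2) with ((INR k + 1) / 2 + 1) by (field; auto).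
    replace ((INR k + 1 + 1) / 2 + nu + 1) with (z + 1) by (unfold z; field; auto).
    assert (Hg : (0 < Re ((INR k + 1) / 2))%R).
    { rewrite <- RtoC_plus, Ehalf. lra. }
    rewrite Gamma_S by auto. rewrite (rGamma_S z).
    rewrite !Cmod_mult.
    replace (Cmod ((INR k + 1) / 2)) with ((INR k + 1) / 2)%R.
    2:{ rewrite <- RtoC_plus, <- RtoC_div, Cmod_R, Rabs_pos_eq by lra. reflexivity. }
    pose proof (Cmod_ge_0 (Gamma ((INR k + 1) / 2))). pose proof (Cmod_ge_0 (rGamma (z + 1))).
    assert (0 <= Cmod (Gamma ((INR k + 1) / 2)%C) * Cmod (rGamma (z + 1)%C))%R by (apply Rmult_le_pos; auto).
    nra.
  - exists M. split; auto. intros k. unfold bs. rewrite Cmod_div, Cmod_INR by apply INR_fact_C_neq.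
    unfold Rdiv. rewrite <- Rmult_assoc. apply Rmult_le_compat_r. left; apply Rinv_0_lt_compat, INR_fact_lt_0.
    apply HMb.
Qed.

Lemma bs_ex_series nu (r : R) : (0 <= r)%R -> ex_series (fun k => Cmod (bs nu k) * r ^ k)%R.
Proof.
  intros Hr. destruct (bs_bound nu) as [M [HM HMb]].
  apply ex_series_R_le with (fun k => M * (/ INR (fact k) * (2 * r) ^ k))%R.
  - intros k. assert (0 <= r ^ k)%R by (apply pow_le; auto). split.
    + apply Rmult_le_pos; auto. apply Cmod_ge_0.
    + rewrite Rpow_mult_distr.
      replace (M * (/ INR (fact k) * (2 ^ k * r ^ k)))%R with (M * (2 ^ k / INR (fact k)) * r ^ k)%R by (unfold Rdiv; ring).
      apply Rmult_le_compat_r; auto.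
  - apply ex_series_R_scal. exists (exp (2 * r)). apply (proj1 (is_pseries_R _ _ _)). apply is_exp_Reals.
Qed.

Definition BS0 (nu z : C) : C := CSeries (fun k => bs nu k * z ^ k).

Lemma BS0_series nu z : is_Cseries (fun k => bs nu k * z ^ k) (BS0 nu z).
Proof.
  destruct (is_series_dominated (fun k => bs nu k * z ^ k) (fun k => Cmod (bs nu k) * Cmod z ^ k)%R) as [l Hl].
  - intros k. rewrite Cmod_mult, Cmod_pow. lra.
  - apply bs_ex_series, Cmod_ge_0.
  - unfold BS0. rewrite (CSeries_unique _ _ Hl). exact Hl.
Qed.

Lemma sqrt_PI_neq_0 : RtoC (sqrt PI) <> 0.
Proof. intros E. apply RtoC_inj in E. pose proof (sqrt_lt_R0 _ PI_RGT_0). lra. Qed.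

Lemma BesselStruve_BS0 nu z : BesselStruve nu z = Gamma (nu + 1) / sqrt PI * BS0 nu z.
Proof.
  apply CSeries_unique.
  eapply is_series_C_ext; [|exact (is_series_C_scal (Gamma (nu + 1) / sqrt PI) _ _ (BS0_series nu z))].
  intros k. unfold bs. pose proof sqrt_PI_neq_0. cbv beta. field. split; auto. apply INR_fact_C_neq.
Qed.

(** * The integral *)

Lemma bk_add_q p q n t : (0 < t)%R -> bk p (q + INR n) t = RtoC t ^ n * bk p q t.
Proof.
  intros Ht. unfold bk. replace (q + INR n - 1) with ((q - 1) + INR n) by ring.
  rewrite Rcpow_plus, Rcpow_INR by auto. ring.
Qed.

(** Since [t^k <= 1], one integrable majorant of the kernel serves every term, and the coefficients
    of the entire function [BS0] are summable at [z]. *)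
Lemma kernel_BS0 a a' b b' c rho nu (z : C) : (0 < Re c)%R ->
  (0 < Re rho)%R -> (0 < Re (rho + c - a - a' - b))%R -> (0 < Re (rho + b' - a'))%R ->
  exists S, is_Cseries (fun k => bs nu k * z ^ k * (Gamma c * MG a a' b b' c (rho + INR k))) S /\
    II (fun t => HS (hN a a' b b' c) (1 - t) * bk c rho t * BS0 nu (z * t)) S.
Proof.
  intros Hc Hr1 Hr2 Hr3.
  destruct (Good_all a a' b b' c Hc) as [HA HB].
  set (h := hN a a' b b' c) in *.
  set (e1 := Re (c - a - a' - b)). set (e2 := Re (b' - a')).
  assert (R2 : (0 < Re rho + e1)%R) by (unfold e1; unfold Re in *; simpl in *; lra).
  assert (R3 : (0 < Re rho + e2)%R) by (unfold e2; unfold Re in *; simpl in *; lra).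
  destruct (below_three _ _ _ Hr1 R2 R3) as [d [Hd [D1 [D2 D3]]]].
  (* The growth exponent is kept [d / 2] below [Re rho], so that the kernel is bounded by
     [K t^(d / 2 - 1) (1 - t)^(Re c - 1)], which is integrable. *)
  assert (HInD : InD (Re rho - d / 2) h).
  { apply HA; [lra| |]. fold e1. lra. fold e2. lra. }
  pose proof (InD_abs1 _ _ HInD) as Habs.
  destruct (InD_bound _ _ HInD) as [K [HK HKb]].
  assert (HKk : forall t, (0 < t < 1)%R -> (Cmod (HS h (1 - t) * bk c rho t) <= K * rbk (Re c) (d / 2) t)%R).
  { intros t Ht. rewrite Cmod_mult, Cmod_bk. assert (Hy : (0 <= 1 - t < 1)%R) by lra. specialize (HKb _ Hy).
    replace (1 - (1 - t))%R with t in HKb by ring.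
    replace (K * rbk (Re c) (d / 2) t)%R with (K * Rpower t (- (Re rho - d / 2)) * rbk (Re c) (Re rho) t)%R.
    apply Rmult_le_compat_r; auto. left; apply rbk_pos.
    unfold rbk. replace (d / 2 - 1)%R with (- (Re rho - d / 2) + (Re rho - 1))%R by ring. rewrite Rpower_plus. ring. }
  assert (Hkc : cont01 (fun t => HS h (1 - t) * bk c rho t)).
  { intros t Ht. apply ccont_mult. apply ccont_HS_1m; auto. apply cont01_bk; auto. }
  assert (Hrk : forall k, II (fun t => HS h (1 - t) * bk c (rho + INR k) t) (Gamma c * MG a a' b b' c (rho + INR k))).
  { intros k. pose proof (pos_INR k). apply HB; unfold Re in *; simpl in *; lra. }
  assert (Hd2 : (0 < d / 2)%R) by lra.
  assert (HG : II (fun t => RtoC (rbk (Re c) (d / 2) t)) (Bv (RtoC (Re c)) (RtoC (d / 2)))).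
  { apply II_ext with (bk (RtoC (Re c)) (RtoC (d / 2))). intros; symmetry; apply RtoC_rbk. apply II_bk; auto. }
  assert (Hphi : forall k t, (0 < t < 1)%R ->
    (Cmod (bs nu k * z ^ k * (HS h (1 - t) * bk c (rho + INR k) t)) <= Cmod (bs nu k) * Cmod z ^ k * (K * rbk (Re c) (d / 2) t))%R).
  { intros k t Ht. rewrite bk_add_q by lra.
    replace (bs nu k * z ^ k * (HS h (1 - t) * (RtoC t ^ k * bk c rho t))) with (bs nu k * z ^ k * (RtoC t ^ k * (HS h (1 - t) * bk c rho t))) by ring.
    rewrite (Cmod_mult (bs nu k * z ^ k)), (Cmod_mult (bs nu k)), Cmod_pow, (Cmod_mult (RtoC t ^ k)), Cmod_pow, Cmod_R, Rabs_pos_eq by lra.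
    apply Rmult_le_compat_l. apply Rmult_le_pos. apply Cmod_ge_0. apply pow_le, Cmod_ge_0.
    assert (Htk : (0 <= t ^ k <= 1)%R). { split. apply pow_le; lra. rewrite <- (pow1 k). apply pow_incr; lra. }
    specialize (HKk t Ht). pose proof (Cmod_ge_0 (HS h (1 - t) * bk c rho t)). nra. }
  assert (Hser : ex_series (fun k => Cmod (bs nu k) * Cmod z ^ k)%R) by (apply bs_ex_series, Cmod_ge_0).
  apply (II_series (fun k t => bs nu k * z ^ k * (HS h (1 - t) * bk c (rho + INR k) t))
    (fun k => 2 * Re (RtoC (Cmod (bs nu k) * Cmod z ^ k * K) * Bv (RtoC (Re c)) (RtoC (d / 2))))%R).
  - intros k. apply II_scal. apply Hrk.
  - intros k u v Hu Huv Hv.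
    apply (II_IntC_bound _ (fun t => Cmod (bs nu k) * Cmod z ^ k * K * rbk (Re c) (d / 2) t)%R); auto.
    + apply (proj1 (II_scal _ _ _ (Hrk k))).
    + eapply II_ext; [|exact (II_scal (RtoC (Cmod (bs nu k) * Cmod z ^ k * K)) _ _ HG)].
      intros t Ht. cbv beta. rewrite <- RtoC_mult. reflexivity.
    + intros t Ht. eapply Rle_trans. apply Hphi; auto. lra.
  - eapply ex_series_ext; [|exact (ex_series_R_scal (2 * K * Re (Bv (RtoC (Re c)) (RtoC (d / 2)))) _ Hser)].
    intros k. cbv beta. generalize (Bv (Re c) (d / 2)%R). intros w. unfold Re; simpl. ring.
  - intros u v Hu Huv Hv. destruct (rbk_bounded (Re c) (d / 2) u v Hu Huv Hv) as [K2 [HK2 HKb2]].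
    exists (fun k => K * K2 * (Cmod (bs nu k) * Cmod z ^ k))%R. split. apply ex_series_R_scal; auto.
    intros k t Ht. eapply Rle_trans. apply Hphi; lra.
    replace (K * K2 * (Cmod (bs nu k) * Cmod z ^ k))%R with (Cmod (bs nu k) * Cmod z ^ k * (K * K2))%R by ring.
    apply Rmult_le_compat_l. apply Rmult_le_pos. apply Cmod_ge_0. apply pow_le, Cmod_ge_0.
    apply Rmult_le_compat_l; auto.
  - intros t Ht. eapply is_series_C_ext; [|exact (is_series_C_scal (HS h (1 - t) * bk c rho t) _ _ (BS0_series nu (z * t)))].
    intros k. cbv beta. rewrite bk_add_q, Cpow_mult_l by lra. ring.
Qed.

(** The substitution [t = x s]: proper integrals are rescaled by a linear change of variable, and
    the filters at both ends are transported by division by [x]. *)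
Lemma II_is_RInt_gen_scaled (G f : R -> C) (x : R) (S : C) : (0 < x)%R -> II G S ->
  (forall t, (0 < t < x)%R -> f t = / x * G (t / x)%R) ->
  is_RInt_gen (V := C_R_NormedModule) f (at_right 0) (at_left x) S.
Proof.
  intros Hx [Hc HG] Hf.
  assert (Hxi : (0 < / x)%R) by (apply Rinv_0_lt_compat; auto).
  assert (HInt : forall a b, (0 < a)%R -> (a <= b)%R -> (b < x)%R ->
    is_RInt (V := C_R_NormedModule) f a b (IntC G (a / x) (b / x))).
  { intros a b Ha Hab Hb.
    assert (Ha1 : (0 < a / x)%R) by (apply Rdiv_lt_0_compat; auto).
    assert (Hb1 : (b / x < 1)%R) by (apply Rmult_lt_reg_r with x; auto; field_simplify; lra).
    assert (Hab1 : (a / x <= b / x)%R) by (apply Rmult_le_compat_r; lra).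
    assert (HI : is_RInt (V := C_R_NormedModule) G (a / x) (b / x) (IntC G (a / x) (b / x))).
    { apply (is_RInt_fct_extend_pair (U := R_NormedModule) (V := R_NormedModule)).
      - apply (RInt_correct (V := R_CompleteNormedModule) (fun t => Re (G t))). apply ex_RInt_cont; auto. intros; apply Hc; lra.
      - apply (RInt_correct (V := R_CompleteNormedModule) (fun t => Im (G t))). apply ex_RInt_cont; auto. intros; apply Hc; lra. }
    replace (a / x)%R with (/ x * a + 0)%R in HI at 1 by (field; lra).
    replace (b / x)%R with (/ x * b + 0)%R in HI at 1 by (field; lra).
    apply (is_RInt_comp_lin (V := C_R_NormedModule)) in HI.
    eapply is_RInt_ext; [|exact HI].
    intros t Ht. rewrite Rmin_left, Rmax_right in Ht by auto. rewrite Hf by lra.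
    replace (/ x * t + 0)%R with (t / x)%R by (field; lra).
    rewrite <- RtoC_inv by lra. apply C_ext; unfold Re, Im, scal; simpl; unfold prod_scal, scal; simpl; unfold mult; simpl; ring. }
  intros P HP.
  apply (Flim_iff F01) in HG. specialize (HG P HP).
  destruct HG as [Q1 Q2 HQ1 HQ2 HQ].
  (* The bounds [x / 2] keep the left endpoint below the right one. *)
  apply (Filter_prod _ _ _ (fun a => Q1 (a / x)%R /\ (0 < a < x / 2)%R) (fun b => Q2 (b / x)%R /\ (x / 2 < b < x)%R)).
  - destruct HQ1 as [e He]. assert (Hm : (0 < Rmin (e * x) (x / 2))%R) by (apply Rmin_pos; [apply Rmult_lt_0_compat; [apply cond_pos|auto]|lra]).
    exists (mkposreal _ Hm). intros a Ha Ha0.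
    assert (Ha' : (Rabs (a - 0) < Rmin (e * x) (x / 2))%R) by exact Ha.
    rewrite Rminus_0_r, Rabs_pos_eq in Ha' by lra.
    pose proof (Rmin_l (e * x) (x / 2)). pose proof (Rmin_r (e * x) (x / 2)).
    split; [|lra]. apply He. change (Rabs (a / x - 0) < e)%R.
    assert (0 < a / x)%R by (apply Rdiv_lt_0_compat; lra).
    rewrite Rminus_0_r, Rabs_pos_eq by lra. apply Rmult_lt_reg_r with x; auto. field_simplify; lra.
    apply Rdiv_lt_0_compat; lra.
  - destruct HQ2 as [e He]. assert (Hm : (0 < Rmin (e * x) (x / 2))%R) by (apply Rmin_pos; [apply Rmult_lt_0_compat; [apply cond_pos|auto]|lra]).
    exists (mkposreal _ Hm). intros b Hb Hb0.
    assert (Hb' : (Rabs (b - x) < Rmin (e * x) (x / 2))%R) by exact Hb.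
    rewrite Rabs_left in Hb' by lra.
    pose proof (Rmin_l (e * x) (x / 2)). pose proof (Rmin_r (e * x) (x / 2)).
    assert (Hbx : (b / x < 1)%R) by (apply Rmult_lt_reg_r with x; auto; field_simplify; lra).
    split; [|lra]. apply He; auto. change (Rabs (b / x - 1) < e)%R.
    rewrite Rabs_left by lra. apply Rmult_lt_reg_r with x; auto. field_simplify; lra.
  - intros a b [Ha1 Ha2] [Hb1 Hb2]. simpl. exists (IntC G (a / x) (b / x)). split.
    + apply HInt; lra.
    + apply (HQ (a / x)%R (b / x)%R Ha1 Hb1).
Qed.

Theorem theorem1
  (alpha alpha' beta beta' gamma rho lambda nu : C) (x : R)
  (hnu : forall n : nat, nu <> RtoC (- INR (S n))%R)
  (hx : (0 < x)%R)
  (hgamma : (0 < Re gamma)%R)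
  (hrho : forall n : nat,
     (Re (rho + INR n) >
      Rmax 0 (Rmax (Re (alpha + alpha' + beta - gamma)) (Re (alpha' - beta'))))%R) :
  let f : R -> C :=
    fun t => Rcpow t (rho - 1) * BesselStruve nu (lambda * t) in
  let num : list (C * R) :=
    [(RtoC (1 / 2), (1 / 2)%R); (rho, 1%R);
     (rho + gamma - alpha - alpha' - beta, 1%R);
     (rho + beta' - alpha', 1%R)] in
  let den : list (C * R) :=
    [(nu + 1, (1 / 2)%R); (rho + beta', 1%R);
     (rho + gamma - alpha - alpha', 1%R);
     (rho + gamma - alpha' - beta, 1%R)] in
  ex_MSM alpha alpha' beta beta' gamma f x /\
  ex_Wright num den (lambda * x) /\
  MSM alpha alpha' beta beta' gamma f x =
    Rcpow x (rho + gamma - alpha - alpha' - 1) * (Gamma (nu + 1) / sqrt PI) *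
    Wright num den (lambda * x).
Proof.
  intros f num den.
  (* The case [n = 0] is the strongest, since [Re (rho + n)] grows with [n]. *)
  specialize (hrho 0%nat). simpl INR in hrho. rewrite Cplus_0_r in hrho.
  pose proof (Rmax_l 0 (Rmax (Re (alpha + alpha' + beta - gamma)) (Re (alpha' - beta')))) as M1.
  pose proof (Rmax_r 0 (Rmax (Re (alpha + alpha' + beta - gamma)) (Re (alpha' - beta')))) as M0.
  pose proof (Rmax_l (Re (alpha + alpha' + beta - gamma)) (Re (alpha' - beta'))) as M2.
  pose proof (Rmax_r (Re (alpha + alpha' + beta - gamma)) (Re (alpha' - beta'))) as M3.
  assert (Hr1 : (0 < Re rho)%R) by lra.
  assert (Hr2 : (Re (alpha + alpha' + beta - gamma) < Re rho)%R) by lra.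
  assert (Hr3 : (Re (alpha' - beta') < Re rho)%R) by lra.
  clear M0 M1 M2 M3 hrho.
  assert (Hr2' : (0 < Re (rho + gamma - alpha - alpha' - beta))%R) by (unfold Re in *; simpl in *; lra).
  assert (Hr3' : (0 < Re (rho + beta' - alpha'))%R) by (unfold Re in *; simpl in *; lra).
  pose proof (Gamma_neq_0 gamma hgamma) as HGg.
  destruct (kernel_BS0 alpha alpha' beta beta' gamma rho nu (lambda * x) hgamma Hr1 Hr2' Hr3') as [S [HS1 HS2]].
  set (h := hN alpha alpha' beta beta' gamma) in *.
  assert (HW : is_Cseries (Wright_term num den (lambda * x)) (S / Gamma gamma)).
  { replace (S / Gamma gamma) with (/ Gamma gamma * S) by apply Cmult_comm.
    eapply is_series_C_ext; [|exact (is_series_C_scal (/ Gamma gamma) _ _ HS1)].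
    intros k. cbv beta. unfold Wright_term, num, den, Cprod. cbn [map fold_right fst snd].
    unfold MG, bs.
    assert (H2 : RtoC 2 <> 0) by (intros E; apply RtoC_inj in E; lra).
    assert (Eh : RtoC (1 / 2) = 1 / 2) by (apply RtoC_div; lra).
    replace (RtoC (1 / 2) + RtoC (1 / 2)%R * INR k) with ((INR k + 1) / 2) by (rewrite Eh; field; auto).
    replace (nu + 1 + RtoC (1 / 2)%R * INR k) with (INR k / 2 + nu + 1) by (rewrite Eh; field; auto).
    rewrite !Cmult_1_l.
    replace (rho + INR k + gamma - alpha - alpha' - beta) with (rho + gamma - alpha - alpha' - beta + INR k) by ring.
    replace (rho + INR k + beta' - alpha') with (rho + beta' - alpha' + INR k) by ring.
    replace (rho + INR k + beta') with (rho + beta' + INR k) by ring.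
    replace (rho + INR k + gamma - alpha - alpha') with (rho + gamma - alpha - alpha' + INR k) by ring.
    replace (rho + INR k + gamma - alpha' - beta) with (rho + gamma - alpha' - beta + INR k) by ring.
    field. split; auto. apply INR_fact_C_neq. }
  (* With [t = x s] the factors [(x - t)^(gamma - 1)], [t^(-alpha')] and [t^(rho - 1)] release their
     powers of [x]. The extra [x] is the differential, and the last factor is the constant of the
     Bessel-Struve series. *)
  set (X := x * Rcpow x (gamma - 1 - alpha' + (rho - 1)) * (Gamma (nu + 1) / sqrt PI)).
  assert (HI : is_RInt_gen (V := C_R_NormedModule) (MSM_integrand alpha alpha' beta beta' gamma f x)
    (at_right 0) (at_left x) (X * S)).
  { apply (II_is_RInt_gen_scaled (fun t => X * (HS h (1 - t) * bk gamma rho t * BS0 nu (lambda * x * t)))); auto.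
    - apply II_scal; auto.
    - intros t Ht. set (s := (t / x)%R).
      assert (Hs : (0 < s < 1)%R).
      { unfold s. split. apply Rdiv_lt_0_compat; lra. apply Rmult_lt_reg_r with x; auto. field_simplify; lra. }
      assert (Et : t = (x * s)%R) by (unfold s; field; lra).
      assert (HxC : RtoC x <> 0) by (intros E; apply RtoC_inj in E; lra).
      unfold MSM_integrand, f. rewrite BesselStruve_BS0.
      assert (Hu : (0 <= 1 - s < 1)%R) by lra.
      (* With [u = 1 - s] the second variable [- u / (1 - u)] is [1 - 1 / s], that is [1 - x / t].
         The resulting prefactor [s^alpha'] cancels against [t^(-alpha')] up to a power of [x]. *)
      destruct (appellF3_value alpha alpha' beta beta' gamma hgamma (1 - s)%R _ Hu eq_refl) as [H [HH HF]].
      assert (EF : appellF3 alpha alpha' beta beta' gamma (1 - t / x) (1 - x / t) = Rcpow s alpha' * HS h (1 - s)).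
      { replace (1 - t / x) with (RtoC (1 - s)) by (unfold s; rewrite RtoC_minus, RtoC_div by lra; reflexivity).
        replace (1 - x / t) with (RtoC (- (1 - s) / (1 - (1 - s)))).
        2:{ rewrite <- RtoC_div, <- RtoC_minus by lra. f_equal. rewrite Et. field. lra. }
        rewrite HF, Bf_real by auto. replace (1 - (1 - s))%R with s by ring.
        replace (- - alpha') with alpha' by ring. f_equal. symmetry. apply CSeries_unique. exact HH. }
      rewrite EF. unfold X, bk.
      replace (Rcpow (x - t) (gamma - 1)) with (Rcpow x (gamma - 1) * Rcpow (1 - s) (gamma - 1)).
      2:{ rewrite <- Rcpow_mult_l by lra. f_equal. rewrite Et. ring. }
      replace (Rcpow t (- alpha')) with (Rcpow x (- alpha') * Rcpow s (- alpha')).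
      2:{ rewrite <- Rcpow_mult_l by lra. rewrite <- Et. reflexivity. }
      replace (Rcpow t (rho - 1)) with (Rcpow x (rho - 1) * Rcpow s (rho - 1)).
      2:{ rewrite <- Rcpow_mult_l by lra. rewrite <- Et. reflexivity. }
      replace (lambda * x * s) with (lambda * t) by (rewrite Et, RtoC_mult; ring).
      replace (Rcpow x (gamma - 1 - alpha' + (rho - 1))) with (Rcpow x (gamma - 1) * Rcpow x (- alpha') * Rcpow x (rho - 1)).
      2:{ rewrite <- !Rcpow_plus. reflexivity. }
      rewrite (Rcpow_opp s). pose proof (Rcpow_neq_0 s alpha'). pose proof sqrt_PI_neq_0.
      field. repeat split; auto. }
  split; [|split].
  - exists (X * S). exact HI.
  - exists (S / Gamma gamma). exact HW.
  - unfold MSM, Wright.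
    rewrite (is_RInt_gen_unique (V := C_R_CompleteNormedModule) _ _ HI), (CSeries_unique _ _ HW).
    unfold X.
    replace (Rcpow x (rho + gamma - alpha - alpha' - 1)) with
      (Rcpow x (- alpha) * (x * Rcpow x (gamma - 1 - alpha' + (rho - 1)))).
    + pose proof sqrt_PI_neq_0. field. split; auto.
    + rewrite <- Rcpow_S, <- Rcpow_plus by auto. f_equal. ring.
Qed.
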